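(* Let $u_0\in C^1(\mathbb{R}^n)\cap C_b(\mathbb{R}^n)$ be a vector function $\mathbb{R}^n\to\mathbb{R}^n$, let $\rho_0\in L^1_{loc}(\mathbb{R}^n)$ be bounded and nonnegative, and let $\sigma=(\sigma_1,\sigma_2)$ with constants $\sigma_1,\sigma_2\ge 0$ and $|\sigma|\neq 0$. Let $P(t,x,u)$ be the joint probability density described in the context, and let $$\rho_\sigma(t,x)=\int_{\mathbb{R}^n}P(t,x,u)\,du,\qquad u_\sigma(t,x)=\frac{\int_{\mathbb{R}^n}u\,P(t,x,u)\,du}{\int_{\mathbb{R}^n}P(t,x,u)\,du}.$$ Then the scalar function $\rho_\sigma(t,x)$ and the vector function $u_\sigma(t,x)=(u_{\sigma,1},\dots,u_{\sigma,n})(t,x)$ solve the system $$\frac{\partial\rho_\sigma}{\partial t}+\mathrm{div}_x(\rho_\sigma u_\sigma)=\frac12\sigma_1^2\sum_{k=1}^n\frac{\partial^2\rho_\sigma}{\partial x_k^2},$$ $$\frac{\partial(\rho_\sigma u_{\sigma,i})}{\partial t}+\mathrm{div}_x(\rho_\sigma u_{\sigma,i}\,u_\sigma)=\frac12\sigma_1^2\sum_{k=1}^n\frac{\partial^2(\rho_\sigma u_{\sigma,i})}{\partial x_k^2}-I_{\sigma,i},$$ where $i=1,\dots,n$, $t\ge 0$, and $$I_{\sigma,i}=\int_{\mathbb{R}^n}(u_i-u_{\sigma,i})\,\big((u-u_\sigma),\nabla_xP(t,x,u)\big)\,du.$$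
   Context: Consider the system of stochastic differential equations $$dX_k(t)=U_k(t)\,dt+\sigma_1\,d(W^1_k)_t,\qquad dU_k(t)=\sigma_2\,d(W^2_k)_t,\qquad k=1,\dots,n,\ t>0,$$ where $X(t)$ and $U(t)$ are random variables with given initial distributions, $(X(t),U(t))$ runs in the phase space $\mathbb{R}^n\times\mathbb{R}^n$, and $(W^i)_t=(W^i_1,\dots,W^i_n)_t$, $i=1,2$, are independent $n$-dimensional Brownian motions. $P(t,x,u)$, with $x,u\in\mathbb{R}^n$, denotes the probability density of the joint distribution of $(X,U)$, subject to the initial data $$P_0(x,u)=\delta(u-u_0(x))\rho_0(x)=\prod_{k=1}^n\delta(u_k-(u_0(x))_k)\,\rho_0(x),$$ where $\delta$ is the Dirac delta. It obeys the Fokker–Planck equation $$\frac{\partial P}{\partial t}=\Big[-\sum_{k=1}^n u_k\frac{\partial}{\partial x_k}+\sum_{k=1}^n\frac12\sigma_1^2\frac{\partial^2}{\partial x_k^2}+\sum_{k=1}^n\frac12\sigma_2^2\frac{\partial^2}{\partial u_k^2}\Big]P$$ with initial data $P_0$. $(\cdot,\cdot)$ is the Euclidean inner product in $\mathbb{R}^n$.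
   Formalization: The system is asserted for t > 0 instead of t ≥ 0: at t = 0, P is the Dirac initial datum and ρ_σ = ρ_0 is only bounded and locally integrable, so the derivatives in the equations need not exist (e.g. ρ_0 the indicator of an interval). *)

(* Defs.v *)
From HB Require Import structures.
From mathcomp Require Import all_boot all_order all_algebra.
From mathcomp Require Import all_classical all_reals all_analysis.

Set Implicit Arguments.
Unset Strict Implicit.
Unset Printing Implicit Defensive.

Import Order.TTheory GRing.Theory Num.Theory.
Import numFieldNormedType.Exports.

Local Open Scope classical_set_scope.
Local Open Scope ring_scope.

(* R^n is 'rV[R]_n, with the product (= Borel) sigma-algebra generated by the
   coordinates, in analogy with the library's instance for n.-tuple. *)
Definition rV_display : measure_display.
Proof. exact: default_measure_display. Qed.

Section measurable_rV.
Variables (R : realType) (n : nat).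

Let coor (i : 'I_n) (v : 'rV[R]_n) : measurableTypeR R := v ord0 i.

Let rV_set0 : g_sigma_preimage coor set0.
Proof. exact: sigma_algebra0. Qed.

Let rV_setC A : g_sigma_preimage coor A -> g_sigma_preimage coor (~` A).
Proof. exact: sigma_algebraC. Qed.

Let rV_bigcup (F : _^nat) : (forall i, g_sigma_preimage coor (F i)) ->
  g_sigma_preimage coor (\bigcup_i (F i)).
Proof. exact: sigma_algebra_bigcup. Qed.

HB.instance Definition _ :=
  @isMeasurable.Build rV_display 'rV[R]_n
    (g_sigma_preimage coor) rV_set0 rV_setC rV_bigcup.

Lemma measurable_coor (i : 'I_n) :
  measurable_fun [set: 'rV[R]_n] (fun v => v ord0 i).
Proof.
move=> _ Y mY; rewrite setTI; apply: sub_sigma_algebra => /=.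
rewrite -bigcup_seq/=; exists i => /=; first by rewrite mem_index_enum.
by exists Y => //; rewrite setTI.
Qed.

Lemma measurable_fun_rV d (T : measurableType d) (f : T -> 'rV[R]_n) :
  (forall i, measurable_fun [set: T] (fun x => f x ord0 i)) ->
  measurable_fun [set: T] f.
Proof.
move=> mf _ Y mY; rewrite setTI.
suff : g_sigma_preimage coor `<=` [set A | measurable (f @^-1` A)] by apply.
apply: smallest_sub.
  split => /=; first by rewrite preimage_set0.
    by move=> A mA; rewrite setTD preimage_setC; exact: measurableC.
  by move=> F mF; rewrite preimage_bigcup; exact: bigcup_measurable.
rewrite -bigcup_seq/= => A [i _ [B mB <-]].
by rewrite setTI; have := mf i measurableT B mB; rewrite setTI.
Qed.

End measurable_rV.

Section lebesgue_rV.
Variable R : realType.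

Section step.
Variables (n : nat) (mu : {sigma_finite_measure set 'rV[R]_n -> \bar R}).

Definition rV_cons (p : measurableTypeR R * 'rV[R]_n) : 'rV[R]_n.+1 :=
  \row_j if unlift ord0 j is Some k then p.2 ord0 k else p.1.

Definition rV_uncons (v : 'rV[R]_n.+1) : measurableTypeR R * 'rV[R]_n :=
  (v ord0 ord0, \row_j v ord0 (lift ord0 j)).

Lemma rV_consK : cancel rV_cons rV_uncons.
Proof.
move=> [a v]; rewrite /rV_uncons mxE unlift_none; congr pair.
by apply/rowP => j; rewrite !mxE liftK.
Qed.

Lemma measurable_rV_cons : measurable_fun [set: _] rV_cons.
Proof.
apply: measurable_fun_rV => i.
case: (unliftP ord0 i) => [j|] ->.
  rewrite (_ : (fun x => _) = (fun v : 'rV[R]_n => v ord0 j) \o snd).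
    by apply: measurableT_comp => //; exact: measurable_coor.
  by apply/funext => x; rewrite mxE liftK.
rewrite (_ : (fun x => _) = fst) //.
by apply/funext => x; rewrite mxE unlift_none.
Qed.

Lemma measurable_rV_uncons : measurable_fun [set: _] rV_uncons.
Proof.
apply/measurable_fun_pairP; split; first exact: measurable_coor.
apply: measurable_fun_rV => i.
rewrite (_ : (fun x => _) = fun v : 'rV[R]_n.+1 => v ord0 (lift ord0 i)).
  exact: measurable_coor.
by apply/funext => x; rewrite /= mxE.
Qed.

Definition lebesgue_rV_step : set 'rV[R]_n.+1 -> \bar R :=
  pushforward (@lebesgue_measure R \x mu)%E rV_cons.

Let pushm : {measure set 'rV[R]_n.+1 -> \bar R} :=
  measure_function_pushforward__canonical__measure_function_Measure
    (@lebesgue_measure R \x mu)%E measurable_rV_cons.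

Let step0 : lebesgue_rV_step set0 = 0%E.
Proof. exact: (measure0 pushm). Qed.

Let step_ge0 A : (0 <= lebesgue_rV_step A)%E.
Proof. exact: (measure_ge0 pushm). Qed.

Let step_sigma_additive : semi_sigma_additive lebesgue_rV_step.
Proof. exact: (@measure_semi_sigma_additive _ _ _ pushm). Qed.

HB.instance Definition _ := isMeasure.Build _ _ _
  lebesgue_rV_step step0 step_ge0 step_sigma_additive.

Let step_sigma_finite : sigma_finite [set: 'rV[R]_n.+1] lebesgue_rV_step.
Proof.
have /sigma_finiteP[F [FT ndF Foo]] := sigma_finiteT (@lebesgue_measure R).
have /sigma_finiteP[G [GT ndG Goo]] := sigma_finiteT mu.
exists (fun i => rV_uncons @^-1` (F i `*` G i)).
  rewrite -preimage_bigcup; apply/esym; rewrite -subTset => v _ /=.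
  have [i _ Fi] : (\bigcup_i F i) (rV_uncons v).1 by rewrite -FT.
  have [j _ Gj] : (\bigcup_i G i) (rV_uncons v).2 by rewrite -GT.
  exists (maxn i j) => //; split.
    by move: Fi; exact/subsetPset/ndF/leq_maxl.
  by move: Gj; exact/subsetPset/ndG/leq_maxr.
move=> i; have [mF Fioo] := Foo i; have [mG Gioo] := Goo i; split.
  rewrite -[X in measurable X]setTI.
  by apply: measurable_rV_uncons => //; exact: measurableX.
rewrite /lebesgue_rV_step /pushforward -comp_preimage.
rewrite (_ : _ \o _ = id); last by apply/funext => x /=; rewrite rV_consK.
by rewrite preimage_id product_measure1E// lte_mul_pinfty// ge0_fin_numE.
Qed.

HB.instance Definition _ := @Measure_isSigmaFinite.Build _ _ _
  lebesgue_rV_step step_sigma_finite.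

End step.

Fixpoint lebesgue_rV (n : nat) : {sigma_finite_measure set 'rV[R]_n -> \bar R} :=
  if n is m.+1 then lebesgue_rV_step (lebesgue_rV m) else \d_(0 : 'rV[R]_0).

End lebesgue_rV.

Section brownian.
Context (R : realType) (n : nat) (d : measure_display) (T : measurableType d).
Variable Pr : probability T R.
Implicit Types W : R -> T -> 'rV[R]_n.

(* Taking [B i = setT] outside a subfamily gives the product rule for it. *)
Definition mutually_independent (I : finType) (Y : I -> T -> R) : Prop :=
  forall B : I -> set R, (forall i, measurable (B i)) ->
    Pr [set w | forall i, B i (Y i w)] = (\prod_i Pr (Y i @^-1` B i))%E.

Definition is_brownian W : Prop :=
  [/\ forall t, 0 <= t -> measurable_fun [set: T] (W t),
      {ae Pr, forall w, W 0 w = 0},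
      {ae Pr, forall w, {within `[0, +oo[, continuous (fun t => W t w)}},
      forall s t (k : 'I_n), 0 <= s -> s < t ->
        forall B : set R, measurable B ->
        Pr [set w | B (W t w ord0 k - W s w ord0 k)]
          = normal_prob 0 (Num.sqrt (t - s)) B
    & forall (m : nat) (tau : nat -> R), 0 <= tau 0%N ->
        (forall j, tau j < tau j.+1) ->
        mutually_independent (fun (jk : 'I_m * 'I_n) w =>
          W (tau jk.1.+1) w ord0 jk.2 - W (tau jk.1) w ord0 jk.2)].

Definition process_sigma_algebra W : set (set T) :=
  <<s [set A | exists t (B : set 'rV[R]_n),
         [/\ 0 <= t, measurable B & A = W t @^-1` B]] >>.

Definition independent_processes W1 W2 : Prop :=
  forall A B, process_sigma_algebra W1 A -> process_sigma_algebra W2 B ->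
    (Pr (A `&` B) = Pr A * Pr B)%E.

(* The noise being additive, the system is an integral equation solved path by
   path, and no stochastic integral is involved. *)
Definition sde_solution W1 W2 (s1 s2 : R) (x v : 'rV[R]_n)
    (X U : R -> T -> 'rV[R]_n) : Prop :=
  [/\ forall t, 0 <= t -> measurable_fun [set: T] (X t),
      forall t, 0 <= t -> measurable_fun [set: T] (U t)
    & {ae Pr, forall w t, 0 <= t -> forall k : 'I_n,
        X t w ord0 k = x ord0 k
          + (\int[lebesgue_measure]_(s in `[0, t]) U s w ord0 k)
          + s1 * W1 t w ord0 k /\
        U t w ord0 k = v ord0 k + s2 * W2 t w ord0 k}].

(* [X y], [U y] being the solution issued from [(y, u0 y)], this is the law at
   time [t] of the solution whose initial law is
   [delta (u - u0 x) * rho0 x dx du]. As [rho0] need not be integrable, this law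
   is in general only a sigma-finite measure. *)
Definition joint_law (rho0 : 'rV[R]_n -> R)
    (X U : 'rV[R]_n -> R -> T -> 'rV[R]_n) (t : R)
    (A : set ('rV[R]_n * 'rV[R]_n)) : \bar R :=
  (\int[lebesgue_rV R n]_y
     ((rho0 y)%:E * Pr [set w | A (X y t w, U y t w)]))%E.

End brownian.

Section spaces.
Context (R : realType) (n : nat).
Local Notation V := 'rV[R]_n.

Definition basis_vec (k : 'I_n) : V := delta_mx ord0 k.

Definition C1_vec (f : V -> V) : Prop :=
  (forall x, differentiable f x) /\
  (forall k, continuous (fun x => 'D_(basis_vec k) f x)).

Definition Cb_vec (f : V -> V) : Prop := continuous f /\ bounded_fun f.

Definition L1_loc (f : V -> R) : Prop :=
  measurable_fun [set: V] f /\
  forall K : set V, compact K ->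
    (lebesgue_rV R n).-integrable K (EFin \o f).

Definition inner (x y : V) : R := \sum_k x ord0 k * y ord0 k.

Definition grad (f : V -> R) (x : V) : V := \row_k 'D_(basis_vec k) f x.

End spaces.

Section balance_laws.
Context (R : realType) (n : nat).
Local Notation V := 'rV[R]_n.

(* [d_t f + div_x F = (s1^2 / 2) Laplacian_x f - S] at [(t, x)]. All the
   derivatives are required to exist, since ['D_v f x] is a junk value
   otherwise. *)
Definition balance_law (s1 : R) (f : R -> V -> R) (F : R -> V -> V)
    (S : R -> V -> R) (t : R) (x : V) : Prop :=
  [/\ derivable (fun s => f s x) t 1,
      forall k, derivable (fun y => F t y ord0 k) x (basis_vec R k),
      forall k y, derivable (f t) y (basis_vec R k),
      forall k,
        derivable (fun y => 'D_(basis_vec R k) (f t) y) x (basis_vec R k)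
    & 'D_1 (fun s => f s x) t
        + \sum_k 'D_(basis_vec R k) (fun y => F t y ord0 k) x
      = 2^-1 * s1 ^+ 2
          * (\sum_k 'D_(basis_vec R k)
                      (fun y => 'D_(basis_vec R k) (f t) y) x)
        - S t x].

Definition gas_system (s1 : R) (rho : R -> V -> R) (u : R -> V -> V)
    (I : 'I_n -> R -> V -> R) : Prop :=
  forall t x, 0 < t ->
    balance_law s1 rho (fun t x => rho t x *: u t x) (fun _ _ => 0) t x /\
    forall i, balance_law s1 (fun t x => rho t x * u t x ord0 i)
      (fun t x => (rho t x * u t x ord0 i) *: u t x) (I i) t x.

End balance_laws.

Section density_function.
Context (R : realType) (n : nat).
Local Notation V := 'rV[R]_n.
Local Notation leb := (lebesgue_rV R n).
Variable P : R -> V -> V -> R.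

(* A density is only defined almost everywhere; continuity selects the
   representative to which the pointwise formulas refer. *)
Definition is_density (law : R -> set (V * V) -> \bar R) : Prop :=
  forall t, 0 < t ->
  [/\ continuous (fun z : V * V => P t z.1 z.2),
      forall x u, 0 <= P t x u
    & forall A : set (V * V), measurable A ->
        law t A = (\int[leb \x leb]_(z in A) (P t z.1 z.2)%:E)%E].

Definition rho_dens (t : R) (x : V) : R := \int[leb]_u P t x u.

Definition u_dens (t : R) (x : V) : V :=
  \row_i ((\int[leb]_u (u ord0 i * P t x u)) / \int[leb]_u P t x u).

Definition I_integrand_dens (i : 'I_n) (t : R) (x u : V) : R :=
  (u ord0 i - u_dens t x ord0 i)
    * inner (u - u_dens t x) (grad (fun y => P t y u) x).

Definition I_dens (i : 'I_n) (t : R) (x : V) : R :=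
  \int[leb]_u I_integrand_dens i t x u.

(* The integrals and derivatives in [rho_dens], [u_dens], [I_dens] exist. *)
Definition moments_exist_dens : Prop :=
  forall t x, 0 < t ->
  [/\ leb.-integrable [set: V] (fun u => (P t x u)%:E),
      forall i, leb.-integrable [set: V] (fun u => (u ord0 i * P t x u)%:E),
      forall k u, derivable (fun y => P t y u) x (basis_vec R k)
    & forall i, leb.-integrable [set: V]
                  (fun u => (I_integrand_dens i t x u)%:E)].

End density_function.

Section charge_integral.
Context (d : measure_display) (T : measurableType d) (R : realType).
Variable nu : {charge set T -> \bar R}.

Lemma hahn_exists :
  exists PN : set T * set T, hahn_decomposition nu PN.1 PN.2.
Proof. by have [P [N h]] := Hahn_decomposition nu; exists (P, N). Qed.

Let nuPN := projT2 (cid hahn_exists).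

Definition charge_integrable (f : T -> R) : Prop :=
  (jordan_pos nuPN).-integrable [set: T] (EFin \o f) /\
  (jordan_neg nuPN).-integrable [set: T] (EFin \o f).

Definition charge_integral (f : T -> R) : R :=
  \int[jordan_pos nuPN]_u f u - \int[jordan_neg nuPN]_u f u.

End charge_integral.

(* When [s2 = 0], [U] is constant in time and the law of [(X, U)] has no density
   with respect to [du]: as for the initial data [delta (u - u0 x) * rho0 x],
   [P t x u du] is then a measure in [u], here [P t x], and [d P / d x_k] is the
   signed measure [dP t x k]. *)
Section density_measure.
Context (R : realType) (n : nat).
Local Notation V := 'rV[R]_n.
Local Notation leb := (lebesgue_rV R n).
Variable P : R -> V -> {finite_measure set V -> \bar R}.
Variable dP : R -> V -> 'I_n -> {charge set V -> \bar R}.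

Definition is_density_measure (law : R -> set (V * V) -> \bar R) : Prop :=
  forall t, 0 < t ->
  (forall B : set V, measurable B -> continuous (fun x => fine (P t x B))) /\
  (forall A B : set V, measurable A -> measurable B ->
     law t (A `*` B) = (\int[leb]_(x in A) P t x B)%E).

Definition is_x_gradient : Prop :=
  forall t x k, 0 < t -> forall B : set V, measurable B ->
    is_derive x (basis_vec R k) (fun y => fine (P t y B)) (fine (dP t x k B)).

Definition rho_meas (t : R) (x : V) : R := \int[P t x]_u 1.

Definition u_meas (t : R) (x : V) : V :=
  \row_i ((\int[P t x]_u u ord0 i) / \int[P t x]_u 1).

Definition I_integrand_meas (i : 'I_n) (t : R) (x : V) (k : 'I_n) (u : V) : R :=
  (u ord0 i - u_meas t x ord0 i) * (u - u_meas t x) ord0 k.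

Definition I_meas (i : 'I_n) (t : R) (x : V) : R :=
  \sum_k charge_integral (dP t x k) (I_integrand_meas i t x k).

Definition moments_exist_meas : Prop :=
  forall t x, 0 < t ->
  (forall i, (P t x).-integrable [set: V] (fun u => (u ord0 i)%:E)) /\
  (forall i k, charge_integrable (dP t x k) (I_integrand_meas i t x k)).

End density_measure.

(* Main.v *)
From HB Require Import structures.
Require Import Defs.
From mathcomp Require Import all_boot all_order all_algebra.
From mathcomp Require Import all_classical all_reals all_analysis.
From mathcomp Require Import measurable_realfun ring lra.

Set Implicit Arguments.
Unset Strict Implicit.
Unset Printing Implicit Defensive.

Import Order.TTheory GRing.Theory Num.Theory.
Import numFieldNormedType.Exports.

Local Open Scope classical_set_scope.
Local Open Scope ring_scope.

(** The noise is additive: the solution issued from [(y, u0 y)] is the free flight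
    [(y + t *: u0 y, u0 y)] plus a noise which does not depend on [y] and whose
    coordinates are, at time [t], the pairs of [s1 * W1 + s2 * \int W2] and
    [s2 * W2]. Riemann sums of the integral are linear in independent increments, so
    these pairs are independent centred Gaussian vectors with the covariance matrix
    [varX, covXU, varU] ([expectation_smoothing]). The joint law is therefore the
    average over [rho0 y dy] of Gaussian laws centred at the free flights. As a
    density is only required to be continuous, it is recovered everywhere by
    smoothing the law at a small scale and letting the scale vanish
    ([density_formula] and [density_measure_formula]).

    Everything is then explicit. Let [r] be the position minus the free flight. For
    given [y] and [r] the velocity is Gaussian, with a mean affine in [r]
    ([cmean]) and a variance [resvar] that depends only on time. Integrating it out
    by Fubini's theorem and Gaussian integration by parts ([mixture_integral],
    [gmean_stress]) turns the mass, the momentum and the term [I] of the system into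
    integrals over [y] of polynomials in [r] times a Gaussian density in [r] of
    variance [varX] ([mass], [momentum], [stress]). Such integrals are differentiated
    under the integral sign ([is_derive_tgauss_x], [is_derive_tgauss_t]), and the
    balance laws become identities between the integrands
    ([mass_balance], [momentum_balance]): for each [y] the transported Gaussian is a
    solution, which rests on a Riccati equation for the slope of [cmean]. The laws
    are linear in the moments once the velocity in the flux is treated as a
    parameter; dividing by the density is harmless because it vanishes either
    nowhere or together with all the moments ([wgauss_gt0_or]).

    When [s2 = 0] the velocity is frozen along the flow. The measure [P t x] is the
    image by [u0] of a density in [y], its gradient in [x] is the image of the
    derivative of that density, and the same moments appear, once integrals against
    a charge are computed from any decomposition of it into two measures
    ([charge_integral_difference]). *)

(** * Measurability and integration over row vectors *)

Section countable_range.
Context d (E : measurableType d) (D : countType).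

Lemma measurable_fun_countable_range d' (F : measurableType d') (c : E -> D)
    (g : D -> F) :
  (forall a, measurable (c @^-1` [set a])) -> measurable_fun [set: E] (g \o c).
Proof.
move=> mc _ Y mY; rewrite setTI.
rewrite (_ : _ @^-1` _ = \bigcup_(a in [set a | Y (g a)]) (c @^-1` [set a])).
  rewrite bigcup_mkcond; apply: countable_bigcupT_measurable => // a.
  by case: ifPn => // _; exact: mc.
by apply/seteqP; split => [x Yx|x [a Ya /= cxa]] /=; [exists (c x)|rewrite cxa].
Qed.

End countable_range.

Section norm_rV.
Context (R : realType).

Lemma rV_norm_le n (v : 'rV[R]_n) (e : R) :
  0 <= e -> (forall i, `|v ord0 i| <= e) -> `|v| <= e.
Proof.
move=> e0 ve; rewrite [`|v|]mx_normrE; elim/big_ind: _ => //.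
  by move=> x y xe ye; rewrite ge_max xe.
by move=> [i j] _ /=; rewrite (ord1 i).
Qed.

Lemma rV_norm_ge n (v : 'rV[R]_n) i : `|v ord0 i| <= `|v|.
Proof.
rewrite [leRHS]mx_normrE; apply: le_trans (le_bigmax _ _ (ord0, i)); exact: lexx.
Qed.

End norm_rV.

Section continuous_rV.
Context (R : realType).

Let cell n (m : nat) (v : 'rV[R]_n) : 'rV[int]_n :=
  \row_i Num.floor (m.+1%:R * v ord0 i).

Let corner n (m : nat) (a : 'rV[int]_n) : 'rV[R]_n :=
  \row_i ((a ord0 i)%:~R / m.+1%:R).

Let measurable_cell n m (a : 'rV[int]_n) : measurable (cell m @^-1` [set a]).
Proof.
rewrite (_ : _ @^-1` _ = \bigcap_(i in [set: 'I_n])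
    ([set: 'rV[R]_n] `&` (fun v => v ord0 i) @^-1`
      `[(a ord0 i)%:~R / m.+1%:R, ((a ord0 i) + 1)%:~R / m.+1%:R[)).
  apply: fin_bigcap_measurable => // i _.
  by apply: measurable_coor => //; exact: measurable_itv.
apply/seteqP; split=> [v /= <- i _|v /= H].
  split=> //=; rewrite mxE in_itv/= ler_pdivrMr// ltr_pdivlMr//.
  by rewrite mulrC floor_itv.
apply/rowP => i; have [_] := H i I; rewrite /= in_itv/= mxE.
rewrite ler_pdivrMr// ltr_pdivlMr// => h.
by apply: floor_def; rewrite mulrC.
Qed.

Let corner_cell n (v : 'rV[R]_n) : corner m (cell m v) @[m --> \oo] --> v.
Proof.
apply/cvgrPdist_le => /= e e0.
have := @cvg_harmonic R; move/cvgrPdist_le => /(_ _ e0); apply: filterS => m.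
rewrite sub0r normrN ger0_norm ?harmonic_ge0// => me.
apply: rV_norm_le; first exact: ltW.
move=> i; apply: le_trans me; rewrite !mxE.
have /andP[h1 h2] := floor_itv (m.+1%:R * v ord0 i : R).
rewrite ger0_norm; last by rewrite subr_ge0 ler_pdivrMr// [leRHS]mulrC.
rewrite lerBlDr /harmonic -[X in X + _]mul1r -mulrDl ler_pdivlMr//.
by rewrite [leLHS]mulrC addrC; move: h2; rewrite intrD => /ltW.
Qed.

(** A continuous function is the limit of its compositions with the rounding of
    the coordinates to a grid, and these take countably many values; this avoids
    describing the open sets of the space in terms of boxes. *)
Lemma continuous_measurable_rV n (f : 'rV[R]_n -> R) :
  continuous f -> measurable_fun [set: 'rV[R]_n] f.
Proof.
move=> cf; apply: (measurable_fun_cvg (h := fun m => f \o corner m \o cell m)).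
  by move=> m; apply: measurable_fun_countable_range => a; exact: measurable_cell.
by move=> v _ /=; apply: continuous_cvg; [exact: cf|exact: corner_cell].
Qed.

Lemma continuous_measurable_rV2 n (f : 'rV[R]_n * 'rV[R]_n -> R) :
  continuous f -> measurable_fun [set: 'rV[R]_n * 'rV[R]_n] f.
Proof.
move=> cf.
pose c m (z : 'rV[R]_n * 'rV[R]_n) := (cell m z.1, cell m z.2).
pose g m (z : 'rV[int]_n * 'rV[int]_n) := (corner m z.1, corner m z.2).
apply: (measurable_fun_cvg (h := fun m => f \o g m \o c m)).
  move=> m; apply: measurable_fun_countable_range => -[a b].
  rewrite (_ : _ @^-1` _ = (cell m @^-1` [set a]) `*` (cell m @^-1` [set b])).
    by apply: measurableX; exact: measurable_cell.
  by apply/seteqP; split=> [[u v]/= [ua vb]|[u v]/= [ua vb]];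
    rewrite /c/= ua vb.
move=> [x y] _ /=; apply: continuous_cvg; first exact: cf.
exact: (cvg_pair (@corner_cell n x) (@corner_cell n y)).
Qed.

End continuous_rV.

Section integral_rV.
Context (R : realType).
Local Notation leb := (@lebesgue_measure R).

Lemma integral_rV_S n (f : 'rV[R]_n.+1 -> \bar R) :
  measurable_fun [set: _] f -> (forall v, 0 <= f v)%E ->
  (\int[lebesgue_rV R n.+1]_v f v =
   \int[leb]_z \int[lebesgue_rV R n]_v f (rV_cons (z, v)))%E.
Proof.
move=> mf f0.
rewrite [LHS](@ge0_integral_pushforward _ _ _ _ _ _ (@measurable_rV_cons R n))//.
rewrite preimage_setT fubini_tonelli1//; last by move=> x /=.
by apply: measurableT_comp => //; exact: measurable_rV_cons.
Qed.

Lemma integral_rV_S2 n (f : 'rV[R]_n.+1 -> \bar R) :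
  measurable_fun [set: _] f -> (forall v, 0 <= f v)%E ->
  (\int[lebesgue_rV R n.+1]_v f v =
   \int[lebesgue_rV R n]_v \int[leb]_z f (rV_cons (z, v)))%E.
Proof.
move=> mf f0; rewrite integral_rV_S//.
rewrite (fubini_tonelli (f \o @rV_cons R n))//; last by move=> x /=.
by apply: measurableT_comp => //; exact: measurable_rV_cons.
Qed.

Lemma rV_cons0 n (z : measurableTypeR R) (v : 'rV[R]_n) :
  rV_cons (z, v) ord0 ord0 = z.
Proof. by rewrite mxE unlift_none. Qed.

Lemma rV_consS n (z : measurableTypeR R) (v : 'rV[R]_n) i :
  rV_cons (z, v) ord0 (lift ord0 i) = v ord0 i.
Proof. by rewrite mxE liftK. Qed.

Lemma measurable_prod_coor n (f : 'I_n -> R -> R) :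
  (forall k, measurable_fun [set: R] (f k)) ->
  measurable_fun [set: 'rV[R]_n] (fun v => \prod_k f k (v ord0 k)).
Proof.
move=> mf; apply: measurable_prod => k _.
by apply: measurableT_comp => //; exact: measurable_coor.
Qed.

Lemma integral_prod_rV n (f : 'I_n -> R -> R) :
  (forall k, measurable_fun [set: R] (f k)) -> (forall k z, 0 <= f k z) ->
  (\int[lebesgue_rV R n]_v (\prod_k f k (v ord0 k))%:E =
   \prod_k \int[leb]_z (f k z)%:E)%E.
Proof.
elim: n f => [|n IH] f mf f0.
  under eq_integral do rewrite big_ord0.
  by rewrite big_ord0 integral_dirac// diracT mul1e.
rewrite integral_rV_S.
- rewrite big_ord_recl -IH//; transitivity (\int[leb]_z ((f ord0 z)%:E *
      \int[lebesgue_rV R n]_v (\prod_k f (lift ord0 k) (v ord0 k))%:E))%E.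
    apply: eq_integral => z _; rewrite -ge0_integralZl_EFin//.
    + apply: eq_integral => v _; rewrite -EFinM; congr EFin.
      rewrite big_ord_recl rV_cons0; congr *%R.
      by apply: eq_bigr => i _; rewrite rV_consS.
    + by move=> v _; rewrite lee_fin prodr_ge0.
    + apply/measurable_EFinP.
      exact: (@measurable_prod_coor n (fun k => f (lift ord0 k))).
  rewrite ge0_integralZr//.
  + by apply/measurable_EFinP; exact: mf.
  + by move=> x _; rewrite lee_fin.
  + by apply: integral_ge0 => v _; rewrite lee_fin prodr_ge0.
- by apply/measurable_EFinP; exact: measurable_prod_coor.
- by move=> v; rewrite lee_fin prodr_ge0.
Qed.

End integral_rV.

Section density.
Import HBNNSimple.
Context d (T : measurableType d) (R : realType).
Variable mu : {measure set T -> \bar R}.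

(** The identity passes from indicators to simple functions by linearity, and to
    all nonnegative functions by monotone convergence. *)
Lemma ge0_integral_density (nu : {measure set T -> \bar R}) (p : T -> R)
    (f : T -> \bar R) :
  measurable_fun [set: T] p -> (forall x, 0 <= p x) ->
  (forall A, measurable A -> nu A = \int[mu]_(x in A) (p x)%:E)%E ->
  measurable_fun [set: T] f -> (forall x, 0 <= f x)%E ->
  (\int[nu]_x f x = \int[mu]_x (f x * (p x)%:E))%E.
Proof.
move=> mp p0 nuE mf f0.
pose h := nnsfun_approx measurableT mf.
have hf x : EFin \o h^~ x @ \oo --> f x by exact: cvg_nnsfun_approx.
have hnd x m n : (m <= n)%N -> ((h m x)%:E <= (h n x)%:E)%E.
  by move=> mn; rewrite lee_fin; exact/lefP/nd_nnsfun_approx.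
transitivity (limn (fun n => \int[nu]_x (h n x)%:E))%E.
  rewrite -monotone_convergence//.
  - by apply: eq_integral => x _; apply/esym/cvg_lim => //; exact: hf.
  - by move=> n; exact/measurable_EFinP.
  - by move=> n x _; rewrite lee_fin.
  - by move=> x _ m n; exact: hnd.
transitivity (limn (fun n => \int[mu]_x ((h n x)%:E * (p x)%:E)))%E; last first.
  rewrite -monotone_convergence//.
  - apply: eq_integral => x _; apply/cvg_lim => //.
    by apply: cvgeZr => //; exact: hf.
  - by move=> n; apply: emeasurable_funM; exact/measurable_EFinP.
  - by move=> n x _; rewrite -EFinM lee_fin mulr_ge0.
  - by move=> x _ m n mn; rewrite lee_wpmul2r ?lee_fin//; exact: hnd.
congr (limn _); apply/funext => n.
under eq_integral do rewrite fimfunE -fsumEFin//.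
rewrite ge0_integral_fsum//; last 2 first.
- by move=> r; exact/measurable_EFinP/measurableT_comp.
- by move=> r x _; rewrite EFinM nnfun_muleindic_ge0.
under [RHS]eq_integral.
  move=> x _; rewrite fimfunE -fsumEFin// ge0_mule_fsuml; last first.
    by move=> r; rewrite EFinM nnfun_muleindic_ge0.
  over.
rewrite ge0_integral_fsum//; last 2 first.
- move=> r; apply: emeasurable_funM; last exact/measurable_EFinP.
  exact/measurable_EFinP/measurableT_comp.
- move=> r x _; apply: mule_ge0; last by rewrite lee_fin.
  by rewrite EFinM nnfun_muleindic_ge0.
apply: eq_fsbigr => r _.
have mr : measurable (h n @^-1` [set r]) by [].
rewrite integralZl_indic_nnsfun// integral_indic// setIT nuE//.
under [RHS]eq_integral do rewrite EFinM -muleA.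
have [r0|r0] := leP 0 r.
  rewrite ge0_integralZl//.
  - congr mule; rewrite integral_mkcond; apply: eq_integral => x _.
    by rewrite patchE /indic; case: ifP => _; rewrite ?mul1e ?mul0e.
  - apply: emeasurable_funM; last exact/measurable_EFinP.
    exact/measurable_EFinP.
  - by move=> x _; rewrite -EFinM lee_fin mulr_ge0.
rewrite preimage_nnfun0// integral_set0 mule0 integral0_eq// => x _.
by rewrite indic0 mul0e mule0.
Qed.

End density.

(** The two proofs are arguments of the set function so that its measure structure
    can be inferred from the term. *)
Definition density_measure d (T : measurableType d) (R : realType)
    (mu : {measure set T -> \bar R}) (f : T -> R)
    (mf : measurable_fun [set: T] f) (f0 : forall x, 0 <= f x) :
    set T -> \bar R :=
  fun A => (\int[mu]_(x in A) (f x)%:E)%E.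

Section density_measure.
Context d (T : measurableType d) (R : realType).
Variables (mu : {measure set T -> \bar R}) (f : T -> R).
Hypotheses (mf : measurable_fun [set: T] f) (f0 : forall x, 0 <= f x).
Local Notation nu := (density_measure mu mf f0).

Let nu0 : nu set0 = 0%E. Proof. exact: integral_set0. Qed.

Let nu_ge0 A : (0 <= nu A)%E.
Proof. by apply: integral_ge0 => x _; rewrite lee_fin. Qed.

Let nu_sigma_additive : semi_sigma_additive nu.
Proof.
apply: semi_sigma_additive_nng_induced; first exact/measurable_EFinP.
by move=> x; rewrite lee_fin.
Qed.

HB.instance Definition _ := isMeasure.Build _ _ _ nu nu0 nu_ge0 nu_sigma_additive.

End density_measure.

Section integrableR.
Context d (T : measurableType d) (R : realType).
Variables (mu : {measure set T -> \bar R}) (D : set T).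
Hypothesis mD : measurable D.
Local Notation intR f := (mu.-integrable D (EFin \o f)).
Implicit Types f g : T -> R.

Lemma integrableRZ c f : intR f -> intR (fun z => c * f z).
Proof.
move=> fi; rewrite (_ : _ \o _ = (fun z => c%:E * (EFin \o f) z)%E)//.
exact: integrableZl.
Qed.

Lemma integrableRD f g : intR f -> intR g -> intR (fun z => f z + g z).
Proof.
move=> fi gi; rewrite (_ : _ \o _ = (EFin \o f) \+ (EFin \o g))%E//.
exact: integrableD.
Qed.

Lemma integrableR_sum (I : Type) (s : seq I) (F : I -> T -> R) :
  (forall i, intR (F i)) -> intR (fun z => \sum_(i <- s) F i z).
Proof.
move=> Fi; elim: s => [|i s IH].
  under [X in _.-integrable _ (_ \o X)]eq_fun do rewrite big_nil.
  exact: integrable0.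
under [X in _.-integrable _ (_ \o X)]eq_fun do rewrite big_cons.
exact: integrableRD.
Qed.

Lemma RintegralR_sum (I : Type) (s : seq I) (F : I -> T -> R) :
  (forall i, intR (F i)) ->
  \int[mu]_(z in D) (\sum_(i <- s) F i z) = \sum_(i <- s) \int[mu]_(z in D) F i z.
Proof.
move=> Fi; elim: s => [|i s IH].
  rewrite big_nil; under eq_Rintegral do rewrite big_nil.
  by rewrite /Rintegral integral0.
under eq_Rintegral do rewrite big_cons.
by rewrite RintegralD// ?IH ?big_cons//; exact: integrableR_sum.
Qed.

Lemma integrableR_le f g : measurable_fun D f -> intR g ->
  (forall z, D z -> `|f z| <= g z) -> intR f.
Proof.
move=> mf gi fg; apply: (le_integrable mD _ _ gi); first exact/measurable_EFinP.
by move=> z Dz /=; rewrite lee_fin (le_trans (fg z Dz))// ler_norm.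
Qed.

Lemma RintegralE f : intR f -> (\int[mu]_(z in D) (f z)%:E)%E = (\int[mu]_(z in D) f z)%:E.
Proof. by move=> fi; rewrite /Rintegral fineK//; exact: integrable_fin_num. Qed.

Lemma ge0_integrableR f : measurable_fun D f -> (forall z, D z -> 0 <= f z) ->
  (\int[mu]_(z in D) (f z)%:E < +oo)%E -> intR f.
Proof.
move=> mf f0 foo; apply/integrableP; split; first exact/measurable_EFinP.
rewrite (eq_integral (fun z => (f z)%:E))// => z /set_mem Dz.
by rewrite /= ger0_norm// f0.
Qed.

End integrableR.

(** * Gaussian densities *)

Section gauss.
Context (R : realType).
Local Notation leb := (@lebesgue_measure R).
Implicit Types V z x u : R.

(** The parameter is the variance rather than the standard deviation: it is what
    adds up under convolution and what depends smoothly on time. *)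
Definition gauss V z : R :=
  (Num.sqrt (V * pi *+ 2))^-1 * expR (- z ^+ 2 / (V *+ 2)).

Lemma gauss_gt0 V z : 0 < V -> 0 < gauss V z.
Proof.
move=> V0; rewrite mulr_gt0 ?expR_gt0// invr_gt0 sqrtr_gt0 mulrn_wgt0//.
by rewrite mulr_gt0 ?pi_gt0.
Qed.

Lemma gauss_ge0 V z : 0 <= gauss V z.
Proof. by rewrite mulr_ge0 ?expR_ge0// invr_ge0 sqrtr_ge0. Qed.

Lemma gaussN V z : gauss V (- z) = gauss V z.
Proof. by rewrite /gauss sqrrN. Qed.

Lemma gauss_normal_pdf V m z : 0 < V ->
  gauss V (m - z) = normal_pdf m (Num.sqrt V) z.
Proof.
move=> V0; rewrite normal_pdfE ?gt_eqF ?sqrtr_gt0//.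
by rewrite /normal_peak /normal_fun sqr_sqrtr ?ltW// -sqrrN opprB.
Qed.

Lemma gauss_le_peak V z : 0 < V -> gauss V z <= (Num.sqrt (V * pi *+ 2))^-1.
Proof.
move=> V0; rewrite /gauss ler_piMr ?invr_ge0 ?sqrtr_ge0// -expR0 ler_expR.
by rewrite mulNr oppr_le0 divr_ge0 ?sqr_ge0// mulrn_wge0// ltW.
Qed.

Lemma measurable_gauss V : measurable_fun [set: R] (gauss V).
Proof.
apply: measurable_funM => //; apply: measurableT_comp => //.
by apply: measurable_funM => //; apply: measurableT_comp => //;
  apply: measurable_funX.
Qed.

Lemma integral_gauss V m : 0 < V -> (\int[leb]_z (gauss V (m - z))%:E = 1)%E.
Proof.
move=> V0; rewrite -(integral_normal_pdf m (Num.sqrt V)).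
by apply: eq_integral => z _; rewrite gauss_normal_pdf.
Qed.

(** The logarithmic derivative of [W ^ (-1/2)], up to the constant factor. *)
Lemma is_derive_gauss_peak (W : R -> R) (W' t : R) : 0 < W t ->
  is_derive t 1 W W' ->
  is_derive t 1 (fun s => (Num.sqrt (W s * pi *+ 2))^-1)
    (- (W' / (W t *+ 2)) * (Num.sqrt (W t * pi *+ 2))^-1).
Proof.
move=> W0 dW; have W0' := gt_eqF W0.
have W2 : 0 < W t * pi *+ 2 by rewrite mulrn_wgt0// mulr_gt0 ?pi_gt0.
have d1 : is_derive t 1 (fun s => W s * pi *+ 2) (W' * pi *+ 2).
  by apply: is_derive_eq; rewrite scaler0 add0r -[_ *: _]/(_ * _) mulrC.
have d2 : is_derive t 1 (Num.sqrt \o (fun s => W s * pi *+ 2))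
    ((2 * Num.sqrt (W t * pi *+ 2))^-1 * (W' * pi *+ 2)).
  by apply: is_derive1_comp; exact: is_derive1_sqrt.
have S0 : Num.sqrt (W t * pi *+ 2) != 0 by rewrite gt_eqF ?sqrtr_gt0.
have d3 : is_derive t 1 (fun s => (Num.sqrt (W s * pi *+ 2))^-1)
    (- Num.sqrt (W t * pi *+ 2) ^- 2 *:
      ((2 * Num.sqrt (W t * pi *+ 2))^-1 * (W' * pi *+ 2))).
  exact: is_deriveV.
have S2 : Num.sqrt (W t * pi *+ 2) ^+ 2 = W t * pi *+ 2 by rewrite sqr_sqrtr ?ltW.
apply: is_derive_eq; rewrite /= -![_ *: _]/(_ * _) /gauss.
move: S0 S2; set S := Num.sqrt _ => S0 S2.
rewrite S2; move: (pi_gt0 R) => /gt_eqF pi0.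
by generalize (@pi R) pi0 => p p0; field; rewrite p0 W0' S0.
Qed.

Lemma is_derive_exprn (c : R -> R) (a t : R) n :
  is_derive t 1 c (a * c t) ->
  is_derive t 1 (fun s => c s ^+ n) (n%:R * a * c t ^+ n).
Proof.
move=> dc; elim: n => [|n IH].
  by under eq_fun do rewrite expr0; apply: is_derive_eq; rewrite !mul0r.
under eq_fun do rewrite exprS.
apply: is_derive_eq; rewrite -![_ *: _]/(_ * _) exprS -natr1.
by ring.
Qed.

(** Completing the square in [z]: a prior of variance [T] on [z] and an observation
    [x] of [a * z] with error of variance [A] give the law of [x] times the
    posterior law of [z]. *)
Lemma gauss_bayes A T a x z : 0 < A -> 0 < T ->
  gauss A (x - a * z) * gauss T z =
  gauss (A + a ^+ 2 * T) x *
  gauss (A * T / (A + a ^+ 2 * T)) (a * T * x / (A + a ^+ 2 * T) - z).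
Proof.
move=> A0 T0; have B0 : 0 < A + a ^+ 2 * T.
  by rewrite ltr_pwDl// mulr_ge0 ?sqr_ge0// ltW.
have pi0 : 0 < (pi : R) by exact: pi_gt0.
rewrite /gauss mulrACA [RHS]mulrACA -!expRD -!invfM -!sqrtrM; last 2 first.
- by rewrite pmulrn_lge0// mulr_ge0 ?ltW.
- by rewrite pmulrn_lge0// mulr_ge0 ?ltW.
congr (_^-1 * expR _).
  by congr Num.sqrt; field; rewrite gt_eqF.
by field; rewrite !gt_eqF// mulr_gt0.
Qed.

(** The density of the centred Gaussian pair with variances [A], [D] and covariance
    [B], as the density of [x] times the conditional density of [u]. *)
Definition gauss2 A B D x u : R :=
  gauss A x * gauss (D - B ^+ 2 / A) (u - B / A * x).

Lemma gauss2_ge0 A B D x u : 0 <= gauss2 A B D x u.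
Proof. by rewrite mulr_ge0 ?gauss_ge0. Qed.

Lemma gauss2_diag A D x u : gauss2 A 0 D x u = gauss A x * gauss D u.
Proof. by rewrite /gauss2 expr0n/= !mul0r !subr0. Qed.

(** The convolution of Gaussian densities in the plane, when the second one is
    carried by the line of direction [(a, b)]: twice completing the square in the
    first factor, the mass of what remains is one. *)
Lemma integral_gauss2_line A B D T a b x u : 0 < A -> B ^+ 2 < A * D -> 0 < T ->
  (\int[leb]_z (gauss2 A B D (x - a * z) (u - b * z) * gauss T z)%:E =
   (gauss2 (A + a ^+ 2 * T) (B + a * b * T) (D + b ^+ 2 * T) x u)%:E)%E.
Proof.
move=> A0 AD T0.
set A' := A + a ^+ 2 * T; set q := D - B ^+ 2 / A.
have A'0 : 0 < A' by rewrite /A' ltr_pwDl// mulr_ge0 ?sqr_ge0// ltW.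
have q0 : 0 < q by rewrite subr_gt0 ltr_pdivrMr// mulrC.
pose k := A * T / A'; pose m := a * T * x / A'.
have k0 : 0 < k by rewrite divr_gt0 ?mulr_gt0.
pose e := b - B / A * a; pose w := u - B / A * x - e * m.
have q'0 : 0 < q + e ^+ 2 * k.
  by rewrite ltr_pwDl// mulr_ge0 ?sqr_ge0// ltW.
pose k' := q * k / (q + e ^+ 2 * k).
have k'0 : 0 < k' by rewrite divr_gt0// mulr_gt0.
transitivity (\int[leb]_z ((gauss A' x * gauss (q + e ^+ 2 * k) w)%:E *
    (gauss k' (e * k * w / (q + e ^+ 2 * k) + m - z))%:E))%E.
  apply: eq_integral => z _; rewrite -EFinM /gauss2 -/q; congr EFin.
  rewrite mulrAC gauss_bayes// -/A' -/k -/m.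
  rewrite -[m - z]opprB gaussN -[LHS]mulrA -[RHS]mulrA; congr *%R.
  rewrite [_ * gauss q _]mulrC [X in gauss q X](_ : _ = w - e * (z - m)).
    rewrite gauss_bayes// -/k'; congr (_ * gauss _ _).
    by rewrite opprB addrA addrAC.
  by rewrite /w /e; field; rewrite gt_eqF.
rewrite ge0_integralZl_EFin//.
- rewrite integral_gauss// mule1 /gauss2 -/A'; congr (_ * gauss _ _)%:E.
    by rewrite /q /e /k /A'; field; rewrite !gt_eqF.
  by rewrite /w /e /m /A'; field; rewrite !gt_eqF.
- by move=> z _; rewrite lee_fin gauss_ge0.
- apply/measurable_EFinP/measurableT_comp; first exact: measurable_gauss.
  exact: measurable_funB.
- by rewrite mulr_ge0// gauss_ge0.
Qed.

(** This is [1 + y <= expR y] at [y = x / N], raised to the power [N]. *)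
Lemma expr_le_expR (N : nat) x : 0 <= x -> x ^+ N <= N%:R ^+ N * expR x.
Proof.
move=> x0; case: N => [|N]; first by rewrite !expr0 mul1r (le_trans _ (expR_ge1Dx x))// lerDl.
rewrite -[X in expR X](@divfK _ N.+1%:R)// expRM_natr -exprMn.
rewrite lerXn2r ?nnegrE// ?mulr_ge0 ?expR_ge0//.
apply: le_trans (_ : N.+1%:R * (1 + x / N.+1%:R) <= _).
  by rewrite mulrDr mulr1 mulrCA divff// mulr1 lerDr.
by rewrite ler_pM2l// expR_ge1Dx.
Qed.
End gauss.

Section gaussn.
Context (R : realType).
Variable n : nat.
Local Notation V := 'rV[R]_n.
Local Notation leb := (lebesgue_rV R n).

Definition gaussn (s : R) (r : V) : R := \prod_k gauss s (r ord0 k).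

Definition sqn (r : V) : R := \sum_k r ord0 k ^+ 2.

Lemma sqn_ge0 r : 0 <= sqn r.
Proof. by apply: sumr_ge0 => k _; exact: sqr_ge0. Qed.

Lemma gaussnE s r : gaussn s r =
  (Num.sqrt (s * pi *+ 2))^-1 ^+ n * expR (- sqn r / (s *+ 2)).
Proof.
rewrite /gaussn big_split/= prodr_const card_ord; congr *%R.
by rewrite /sqn -sumrN mulr_suml expR_sum.
Qed.

Lemma gaussn_gt0 s r : 0 < s -> 0 < gaussn s r.
Proof. by move=> s0; apply: prodr_gt0 => k _; exact: gauss_gt0. Qed.

Lemma gaussn_ge0 s r : 0 <= gaussn s r.
Proof. by apply: prodr_ge0 => k _; exact: gauss_ge0. Qed.

Lemma gaussnN s r : gaussn s (- r) = gaussn s r.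
Proof. by apply: eq_bigr => k _; rewrite mxE gaussN. Qed.

(** When time varies, the variance and the squared norm both do: [q] stands for the
    latter along a path. *)
Lemma is_derive_gaussn_path (W q : R -> R) (W' q' t : R) : 0 < W t ->
  is_derive t 1 W W' -> is_derive t 1 q q' ->
  is_derive t 1 (fun t => (Num.sqrt (W t * pi *+ 2))^-1 ^+ n *
      expR (- q t / (W t *+ 2)))
    ((q t * W' / (2 * W t ^+ 2) - n%:R * W' / (2 * W t) - q' / (2 * W t)) *
     ((Num.sqrt (W t * pi *+ 2))^-1 ^+ n * expR (- q t / (W t *+ 2)))).
Proof.
move=> W0 dW dq; have W0' := gt_eqF W0.
have d1 := is_derive_exprn n (is_derive_gauss_peak W0 dW).
have d4 : is_derive t 1 (fun s => (W s *+ 2)^-1) (- (W t *+ 2) ^- 2 *: (W' *+ 2)).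
  by apply: is_deriveV; rewrite gt_eqF// mulrn_wgt0.
have d5 : is_derive t 1 (expR \o (fun s => - q s / (W s *+ 2)))
    (expR (- q t / (W t *+ 2)) * (q t * W' / (2 * W t ^+ 2) - q' / (2 * W t))).
  apply: is_derive1_comp; apply: is_derive_eq.
  by rewrite -![_ *: _]/(_ * _); field; rewrite W0'.
apply: is_derive_eq; rewrite /= -![_ *: _]/(_ * _).
by set a := _ ^+ n; set b := expR _; field; rewrite W0'.
Qed.

Lemma integral_gaussn s a : 0 < s -> (\int[leb]_y (gaussn s (a - y))%:E = 1)%E.
Proof.
move=> s0.
under eq_integral do rewrite /gaussn; under eq_integral do under eq_bigr do rewrite !mxE.
rewrite (@integral_prod_rV _ _ (fun k z => gauss s (a ord0 k - z))).
- by rewrite big1// => k _; rewrite integral_gauss.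
- move=> k; apply/measurableT_comp; first exact: measurable_gauss.
  exact: measurable_funB.
- by move=> k z; exact: gauss_ge0.
Qed.

Lemma measurable_gaussn s : measurable_fun [set: V] (gaussn s).
Proof.
by apply: (@measurable_prod_coor _ n (fun=> gauss s)) => k; exact: measurable_gauss.
Qed.

End gaussn.

(** * Gaussian approximate identities *)

Section approx_identity.
Context d (E : measurableType d) (R : realType).
Variable mu : {measure set E -> \bar R}.

(** The mass of a kernel dominated by a multiple of the initial one away from the
    point disappears there in the limit, whatever the growth of the function, as
    long as its first average is finite. *)
Lemma approx_identity (k : nat -> E -> R) (p : E -> R) (z0 : E) :
  (forall m, measurable_fun [set: E] (k m)) -> (forall m z, 0 <= k m z) ->
  (forall m, \int[mu]_z (k m z)%:E = 1)%E ->
  measurable_fun [set: E] p -> (forall z, 0 <= p z) ->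
  (\int[mu]_z (k 0%N z * p z)%:E < +oo)%E ->
  (forall e, 0 < e -> exists2 C, 0 <= C & forall m z,
     `|p z - p z0| <= e \/ k m z <= C / m.+1%:R * k 0%N z) ->
  (\int[mu]_z (k m z * p z)%:E)%E @[m --> \oo] --> (p z0)%:E.
Proof.
move=> mk k0 k1 mp p0 kp_oo far.
have ik m : mu.-integrable [set: E] (EFin \o k m).
  apply/integrableP; split; first exact/measurable_EFinP.
  under eq_integral do rewrite /= ger0_norm//.
  by rewrite k1 ltry.
have ikp0 : mu.-integrable [set: E] (EFin \o (fun z => k 0%N z * p z)).
  apply/integrableP; split; first exact/measurable_EFinP/measurable_funM.
  by under eq_integral do rewrite /= ger0_norm ?mulr_ge0//.
have bnd e : 0 < e -> exists2 C, 0 <= C & forall m z,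
    k m z * `|p z - p z0| <= e * k m z + C / m.+1%:R * (k 0%N z * p z + p z0 * k 0%N z).
  move=> e0; have [C C0 H] := far _ e0; exists C => // m z.
  have [H1|H1] := H m z.
    apply: le_trans (_ : e * k m z <= _); first by rewrite mulrC ler_wpM2r.
    by rewrite lerDl mulr_ge0 ?divr_ge0// addr_ge0// mulr_ge0.
  apply: le_trans (_ : (C / m.+1%:R * k 0%N z) * (p z + p z0) <= _).
    apply: ler_pM => //; rewrite (le_trans (ler_normB _ _))//.
    by rewrite !ger0_norm.
  rewrite [X in _ <= _ + X](_ : _ = C / m.+1%:R * k 0%N z * (p z + p z0)); last by ring.
  by rewrite lerDr mulr_ge0// ltW.
pose M := \int[mu]_z (k 0%N z * p z) + p z0.
have M0 : 0 <= M.
  by rewrite addr_ge0//; apply: Rintegral_ge0 => z _; rewrite mulr_ge0.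
have ibnd e C m : mu.-integrable [set: E] (EFin \o (fun z =>
    e * k m z + C / m.+1%:R * (k 0%N z * p z + p z0 * k 0%N z))).
  apply: integrableRD => //; first exact: integrableRZ.
  by apply: integrableRZ => //; apply: integrableRD => //; exact: integrableRZ.
have Ibnd e C m : \int[mu]_z
    (e * k m z + C / m.+1%:R * (k 0%N z * p z + p z0 * k 0%N z)) =
    e + C / m.+1%:R * M.
  have R1 j : \int[mu]_z k j z = 1 by rewrite /Rintegral k1.
  have i1 c j : mu.-integrable [set: E] (EFin \o (fun z => c * k j z)).
    exact: integrableRZ.
  have i2 : mu.-integrable [set: E]
      (EFin \o (fun z => k 0%N z * p z + p z0 * k 0%N z)).
    exact: integrableRD.
  rewrite RintegralD//; last exact: integrableRZ.
  by rewrite !RintegralZl// R1 mulr1 RintegralD// RintegralZl// R1 mulr1.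
have mkp m : measurable_fun [set: E] (EFin \o (fun z => k m z * (p z - p z0))).
  apply/measurable_EFinP/measurable_funM => //; exact: measurable_funB.
have ikpd m : mu.-integrable [set: E] (EFin \o (fun z => k m z * (p z - p z0))).
  have [C C0 H] := bnd 1 ltr01.
  apply: (le_integrable _ _ _ (ibnd 1 C m)) => // z _ /=.
  rewrite lee_fin normrM (ger0_norm (k0 _ _)) (le_trans (H m z))// ler_norm//.
have ikp m : mu.-integrable [set: E] (EFin \o (fun z => k m z * p z)).
  rewrite (_ : (fun z => k m z * p z) =
      (fun z => k m z * (p z - p z0) + p z0 * k m z)).
    by apply: integrableRD => //; exact: integrableRZ.
  by apply/funext => z; ring.
have -> : (fun m => \int[mu]_z (k m z * p z)%:E)%E =
          EFin \o (fun m => \int[mu]_z (k m z * p z)).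
  by apply/funext => m /=; rewrite RintegralE.
apply: cvg_EFin; first by near=> m.
apply/cvgrPdist_le => /= e e0.
have e20 : 0 < e / 2 by rewrite divr_gt0.
have [C C0 H] := bnd _ e20.
have CM : C * M / m.+1%:R @[m --> \oo] --> 0.
  rewrite -(mulr0 (C * M)); apply: cvgMr; exact: cvg_harmonic.
move/cvgrPdist_le : CM => /(_ _ e20); apply: filterS => m.
rewrite sub0r normrN ger0_norm; last by rewrite divr_ge0// mulr_ge0.
move=> Hm.
have -> : p z0 - \int[mu]_z (k m z * p z) = - \int[mu]_z (k m z * (p z - p z0)).
  transitivity (- \int[mu]_z (k m z * p z - p z0 * k m z)).
    rewrite RintegralB//; last exact: integrableRZ.
    have Rk : \int[mu]_z k m z = 1 by rewrite /Rintegral k1.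
    by rewrite RintegralZl// Rk mulr1 opprB.
  by congr (- _); apply: eq_Rintegral => z _; ring.
rewrite normrN (le_trans (le_normr_Rintegral _ _))//.
apply: le_trans (_ : e / 2 + C / m.+1%:R * M <= _); last first.
  by rewrite [leRHS](splitr e) lerD2l mulrAC.
rewrite -(Ibnd _ C m); apply: le_Rintegral => //.
- rewrite (_ : _ \o _ = abse \o (EFin \o (fun z => k m z * (p z - p z0))))//.
  exact: integrable_abse.
- by move=> z _; rewrite normrM (ger0_norm (k0 _ _)).
Unshelve. all: end_near. Qed.

End approx_identity.

Section gauss_harmonic.
Context (R : realType).

Lemma gauss_harmonicE m (z : R) : gauss m.+1%:R^-1 z =
  Num.sqrt m.+1%:R * expR (- (z ^+ 2 * m%:R / 2)) * gauss 1 z.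
Proof.
rewrite /gauss -[_^-1 * pi *+ 2]mulrnAr mul1r sqrtrM ?invr_ge0//.
rewrite sqrtrV// invfM invrK -!mulrA; congr *%R.
rewrite [RHS]mulrCA; congr *%R; rewrite -expRD; congr expR.
by rewrite -natr1; field.
Qed.

Let sqrt_le m : Num.sqrt m.+1%:R <= m.+1%:R :> R.
Proof.
rewrite -{2}(@sqr_sqrtr _ m.+1%:R)// expr2 ler_peMr ?sqrtr_ge0//.
by rewrite -{1}(@sqrtr1 R) ler_sqrt// ler1n.
Qed.

Lemma gauss_harmonic_le m (z : R) : gauss m.+1%:R^-1 z <= m.+1%:R * gauss 1 z.
Proof.
rewrite gauss_harmonicE ler_wpM2r ?gauss_ge0// -[leRHS]mulr1.
rewrite ler_pM ?sqrtr_ge0 ?expR_ge0 ?sqrt_le//.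
by rewrite -expR0 ler_expR oppr_le0 divr_ge0// mulr_ge0// sqr_ge0.
Qed.

Lemma gauss_harmonic_far (e : R) N : 0 < e -> exists2 C, 0 <= C & forall m z,
  e <= `|z| -> gauss m.+1%:R^-1 z <= C / m.+1%:R ^+ N * gauss 1 z.
Proof.
move=> e0; have [a aE] : exists a, a = e ^+ 2 / 2 by exists (e ^+ 2 / 2).
have a0 : 0 < a by rewrite aE divr_gt0 ?exprn_gt0.
exists (a ^- N.+1 * N.+1%:R ^+ N.+1 * expR a) => [|m z ez].
  by rewrite !mulr_ge0 ?expR_ge0 ?invr_ge0 ?exprn_ge0// ltW.
rewrite gauss_harmonicE ler_wpM2r ?gauss_ge0// ler_pdivlMr ?exprn_gt0//.
apply: le_trans (_ : m.+1%:R * expR (- (a * m%:R)) * m.+1%:R ^+ N <= _).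
  rewrite ler_wpM2r ?exprn_ge0// ler_pM ?sqrtr_ge0 ?expR_ge0 ?sqrt_le//.
  rewrite ler_expR lerN2 aE mulrAC ler_wpM2r ?invr_ge0// ler_wpM2r//.
  by rewrite -[leRHS]real_normK ?num_real// lerXn2r ?nnegrE// ltW.
rewrite mulrAC -exprS -lter_pdivlMr ?expR_gt0//.
apply: le_trans (_ : a ^- N.+1 * (a * m.+1%:R) ^+ N.+1 <= _).
  by rewrite [(a * _) ^+ _]exprMn mulrA mulVf ?mul1r// expf_neq0// gt_eqF.
rewrite -!mulrA ler_pM2l ?invr_gt0 ?exprn_gt0//.
apply: le_trans (expr_le_expR _ _) _; first by rewrite mulr_ge0 ?ltW.
rewrite ler_pM2l ?exprn_gt0// -expRN opprK -expRD ler_expR -natr1.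
by rewrite mulrDr mulr1 addrC.
Qed.

Variable n : nat.
Local Notation V := 'rV[R]_n.

Lemma gaussn_harmonic_le m (r : V) :
  gaussn m.+1%:R^-1 r <= m.+1%:R ^+ n * gaussn 1 r.
Proof.
rewrite /gaussn -[X in _ ^+ X]card_ord -prodr_const -big_split/=.
by apply: ler_prod => k _; rewrite gauss_ge0 gauss_harmonic_le.
Qed.

(** The coordinate which is far from zero gains any power of [m]. An arbitrary [N]
    is needed because each other coordinate loses a factor [m]. *)
Lemma gaussn_harmonic_far (e : R) N : 0 < e -> exists2 C, 0 <= C & forall m (r : V),
  (exists k, e <= `|r ord0 k|) ->
  gaussn m.+1%:R^-1 r <= C / m.+1%:R ^+ N * gaussn 1 r.
Proof.
move=> e0; have [C C0 H] := @gauss_harmonic_far e (N + n) e0.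
exists C => // m r [k rk].
pose c i : R := if i == k then C / m.+1%:R ^+ (N + n) else m.+1%:R.
have c0 i : 0 <= c i by rewrite /c; case: ifP => // _; rewrite divr_ge0 ?exprn_ge0.
apply: le_trans (_ : \prod_i (c i * gauss 1 (r ord0 i)) <= _).
  apply: ler_prod => i _; rewrite gauss_ge0/= /c.
  by case: eqP => [->|_]; [exact: H|exact: gauss_harmonic_le].
rewrite big_split/= ler_wpM2r ?gaussn_ge0// (bigD1 k)//= {1}/c eqxx.
rewrite exprD invfM mulrA -[leLHS]mulrA ler_piMr ?divr_ge0 ?exprn_ge0//.
rewrite mulrC ler_pdivrMr ?exprn_gt0// mul1r.
rewrite -[X in _ <= _ ^+ X]card_ord -prodr_const.
rewrite [leRHS](bigD1 k)//= (@le_trans _ _ (\prod_(i | i != k) m.+1%:R))//.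
  by apply: ler_prod => i ik; rewrite c0/= /c (negbTE ik).
by rewrite ler_peMl ?prodr_ge0// ler1n.
Qed.

End gauss_harmonic.

Section approx_identity_rV.
Context (R : realType) (n : nat).
Local Notation V := 'rV[R]_n.
Local Notation leb := (lebesgue_rV R n).

Lemma measurable_gaussn_shift d (T : measurableType d) (s : R) (x : V) (F : T -> V) :
  measurable_fun [set: T] F ->
  measurable_fun [set: T] (fun z => gaussn s (x - F z)).
Proof.
move=> mF; apply: measurableT_comp; first exact: measurable_gaussn.
apply: measurable_fun_rV => k; under eq_fun do rewrite !mxE.
apply: measurable_funB => //.
exact: (measurableT_comp (measurable_coor k) mF).
Qed.

Let dist_or (x z : V) (e : R) :
  (forall k, `|x ord0 k - z ord0 k| < e) \/
  (exists k, e <= `|(x - z) ord0 k|).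
Proof.
have [|] := boolP [forall k, `|x ord0 k - z ord0 k| < e].
  by move/forallP; left.
by move/forallPn => [k]; rewrite -leNgt => ek; right; exists k; rewrite !mxE.
Qed.

Lemma approx_identity_rV (p : V -> R) (x : V) :
  continuous p -> (forall z, 0 <= p z) ->
  (\int[leb]_z (gaussn 1 (x - z) * p z)%:E < +oo)%E ->
  (\int[leb]_z (gaussn m.+1%:R^-1 (x - z) * p z)%:E)%E @[m --> \oo] --> (p x)%:E.
Proof.
move=> cp p0 poo.
apply: (@approx_identity _ _ _ leb (fun m z => gaussn m.+1%:R^-1 (x - z))).
- by move=> m; exact: measurable_gaussn_shift.
- by move=> m z; exact: gaussn_ge0.
- by move=> m; rewrite integral_gaussn.
- exact: continuous_measurable_rV.
- exact: p0.
- by rewrite invr1.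
move=> e e0; have /cvgrPdist_le/(_ _ e0)/nbhs_ballP[r /= r0 H] := cp x.
have [C C0 HC] := @gaussn_harmonic_far R n _ 1 r0.
exists C => // m z; have [xz|xz] := dist_or x z r.
  left; rewrite distrC; apply: H.
  by split=> // i j; rewrite (ord1 i); exact: xz.
by right; rewrite invr1 (le_trans (HC m _ xz)).
Qed.

(** When one of the two variables is far, its kernel has to compensate the loss of
    the other one, whence the exponent [n.+1] in the proof. *)
Lemma approx_identity_rV2 (p : V * V -> R) (x u : V) :
  continuous p -> (forall z, 0 <= p z) ->
  (\int[leb \x leb]_z (gaussn 1 (x - z.1) * gaussn 1 (u - z.2) * p z)%:E < +oo)%E ->
  (\int[leb \x leb]_z (gaussn m.+1%:R^-1 (x - z.1) *
      gaussn m.+1%:R^-1 (u - z.2) * p z)%:E)%E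
    @[m --> \oo] --> (p (x, u))%:E.
Proof.
move=> cp p0 poo.
pose k m (z : V * V) := gaussn m.+1%:R^-1 (x - z.1) * gaussn m.+1%:R^-1 (u - z.2).
have mk m : measurable_fun [set: V * V] (k m).
  apply: measurable_funM.
    by apply: (@measurable_gaussn_shift _ _ _ x fst); exact: measurable_fst.
  by apply: (@measurable_gaussn_shift _ _ _ u snd); exact: measurable_snd.
apply: (@approx_identity _ _ _ (leb \x leb)%E k).
- exact: mk.
- by move=> m z; rewrite mulr_ge0 ?gaussn_ge0.
- move=> m; rewrite fubini_tonelli1//=; last 2 first.
  + exact/measurable_EFinP.
  + by move=> z; rewrite lee_fin mulr_ge0 ?gaussn_ge0.
  rewrite -[RHS](integral_gaussn x (s := m.+1%:R^-1))//.
  apply: eq_integral => y _; rewrite /fubini_F /k/=.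
  under eq_integral do rewrite EFinM.
  rewrite ge0_integralZl_EFin ?gaussn_ge0//.
  + by rewrite integral_gaussn// mule1.
  + by move=> z _; rewrite lee_fin gaussn_ge0.
  + by apply/measurable_EFinP; exact: (@measurable_gaussn_shift _ _ _ u id).
- exact: continuous_measurable_rV2.
- exact: p0.
- by rewrite /k invr1.
move=> e e0; have /cvgrPdist_le/(_ _ e0)/nbhs_ballP[r /= r0 H] := cp (x, u).
have [C C0 HC] := @gaussn_harmonic_far R n _ n.+1 r0.
exists C => // m -[y v] /=.
have far a b c d' : 0 <= a -> 0 <= b -> a <= C / m.+1%:R ^+ n.+1 * c ->
    b <= m.+1%:R ^+ n * d' -> a * b <= C / m.+1%:R * (c * d') :> R.
  move=> a0 b0 ac bd; apply: le_trans (ler_pM a0 b0 ac bd) _.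
  rewrite mulrACA le_eqVlt; apply/orP; left; apply/eqP; congr *%R.
  by rewrite exprS invfM mulrA divfK ?expf_neq0.
have [xy|xy] := dist_or x y r; have [uv|uv] := dist_or u v r.
- left; rewrite distrC; apply: H.
  by split; split=> // i j /=; rewrite (ord1 i); [exact: xy|exact: uv].
- right; rewrite /k/= invr1 mulrC [gaussn 1 _ * _]mulrC.
  by apply: far; rewrite ?gaussn_ge0// ?HC// gaussn_harmonic_le.
- right; rewrite /k/= invr1.
  by apply: far; rewrite ?gaussn_ge0// ?HC// gaussn_harmonic_le.
- right; rewrite /k/= invr1.
  by apply: far; rewrite ?gaussn_ge0// ?HC// gaussn_harmonic_le.
Qed.

End approx_identity_rV.

(** * Differentiation of transported Gaussian averages *)

Section derive_line.
Context (R : realType) (E : normedModType R).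

(** Along a line the rules of calculus of one variable become available. *)
Lemma is_derive_line (f : E -> R) (x v : E) (h d : R) :
  is_derive (h *: v + x) v f d <-> is_derive h 1 (fun k => f (k *: v + x)) d.
Proof.
have H : (fun k : R => k^-1 *: ((f \o shift (h *: v + x)) (k *: v) - f (h *: v + x))) =
    (fun k : R => k^-1 *: (((fun k => f (k *: v + x)) \o shift h) (k *: 1)
       - (fun k => f (k *: v + x)) h)).
  apply/funext => k /=; congr (_ *: (f _ - _)).
  by rewrite -[k *: 1]/(k * 1) mulr1 scalerDl addrA.
split=> -[d1 d2]; split; move: d1 d2; rewrite /derivable /derive H//.
Qed.

Lemma is_derive_line0 (f : E -> R) (x v : E) (d : R) :
  is_derive (0 : R) 1 (fun k : R => f (k *: v + x)) d -> is_derive x v f d.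
Proof. by move/is_derive_line; rewrite scale0r add0r. Qed.

Lemma is_derive_inv (f : E -> R) (x v : E) (d : R) : f x != 0 ->
  is_derive x v f d -> is_derive x v (fun y => (f y)^-1) (- f x ^- 2 * d).
Proof.
move=> fx0; rewrite -{1}[x]add0r -{1}(scale0r v) => /is_derive_line df.
apply: is_derive_line0.
have := @is_deriveV R (fun k : R => f (k *: v + x)) 0 d 1.
by rewrite scale0r add0r; apply.
Qed.

End derive_line.

Section derive_integral.
Context (R : realType) (E : normedModType R) d (Y : measurableType d).
Variable mu : {measure set Y -> \bar R}.

(** Along the line through [x] of direction [v], this is differentiation under the
    integral sign with respect to a real parameter; so the domination is only
    needed on a segment of that line. *)
Lemma is_derive_Rintegral (f f' : E -> Y -> R) (x v : E) (e : R) (G : Y -> R) :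
  0 < e ->
  (forall h, `|h| < e -> mu.-integrable [set: Y] (EFin \o f (h *: v + x))) ->
  (forall h y, `|h| < e -> is_derive (h *: v + x) v (f^~ y) (f' (h *: v + x) y)) ->
  mu.-integrable [set: Y] (EFin \o G) ->
  (forall h y, `|h| < e -> `|f' (h *: v + x) y| <= G y) ->
  is_derive x v (fun z => \int[mu]_y f z y) (\int[mu]_y f' x y).
Proof.
move=> e0 intf df intG bG.
pose F h y := f (h *: v + x) y.
have inI h : `]- e, e[%classic h -> `|h| < e by rewrite /= in_itv/= ltr_norml.
have I0 : `]- e, e[%classic (0 : R) by rewrite /= in_itv/= oppr_lt0 e0.
have dF h y : `]- e, e[%classic h -> is_derive h 1 (F^~ y) (f' (h *: v + x) y).
  by move=> /inI he; exact: (proj1 (is_derive_line (f^~ y) x v h _) (df h y he)).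
have d1 h y : `]- e, e[%classic h -> partial1of2 F h y = f' (h *: v + x) y.
  by move=> Ih; rewrite partial1of2E; have [_ ->] := dF h y Ih.
have G0 y : 0 <= G y.
  by apply: le_trans (bG 0 y _); rewrite ?normr0.
have intF h : `]- e, e[%classic h -> mu.-integrable [set: Y] (EFin \o F h).
  by move=> /inI; exact: intf.
have derF h y : `]- e, e[%classic h -> setT y -> derivable (F^~ y) h 1.
  by move=> Ih _; have [] := dF h y Ih.
have GF h y : `]- e, e[%classic h -> setT y -> `|partial1of2 F h y| <= G y.
  by move=> Ih _; rewrite d1//; apply: bG; exact: inI.
have := cvg_differentiation_under_integral measurableT I0 intF derF G0 intG GF.
have -> : \int[mu]_y partial1of2 F 0 y = \int[mu]_y f' x y.
  by apply: eq_Rintegral => y _; rewrite d1// scale0r add0r.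
move=> H; apply: is_derive_line0; rewrite /F in H.
have H' : h^-1 *: (((fun k => \int[mu]_y f (k *: v + x) y) \o shift 0) (h *: 1)
    - (fun k => \int[mu]_y f (k *: v + x) y) 0) @[h --> 0^'] --> \int[mu]_y f' x y.
  apply: cvg_trans H; apply: near_eq_cvg; near=> h => /=.
  by rewrite -[h *: 1]/(h * 1) mulr1.
apply: DeriveDef; first by apply/cvg_ex; exists (\int[mu]_y f' x y).
exact/cvg_lim.
Unshelve. all: end_near. Qed.

End derive_integral.

Section growth.
Context (R : realType) (n : nat).
Local Notation V := 'rV[R]_n.
Local Notation leb := (lebesgue_rV R n).

(** The growth which a Gaussian density in the second argument compensates. *)
Definition pgrowth (p : V -> V -> R) : Prop :=
  exists A m, forall y r, `|p y r| <= A * (1 + sqn r) ^+ m.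

Let sqn1 (r : V) : 1 <= 1 + sqn r. Proof. by rewrite lerDl sqn_ge0. Qed.

Lemma pgrowth_bounded p A : (forall y r, `|p y r| <= A) -> pgrowth p.
Proof. by move=> pA; exists A, 0%N => y r; rewrite expr0 mulr1. Qed.

Lemma sqn_coor (r : V) k : r ord0 k ^+ 2 <= sqn r.
Proof.
by rewrite /sqn (bigD1 k)//= lerDl sumr_ge0// => i _; exact: sqr_ge0.
Qed.

Lemma coor_le_sqn (r : V) k : `|r ord0 k| <= 1 + sqn r.
Proof.
apply: le_trans (_ : 1 + r ord0 k ^+ 2 <= _); last by rewrite lerD2l sqn_coor.
rewrite -[r ord0 k ^+ 2]real_normK ?num_real//.
by have := normr_ge0 (r ord0 k); nra.
Qed.

Lemma pgrowth_coor k : pgrowth (fun _ r => r ord0 k).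
Proof. by exists 1, 1%N => _ r; rewrite mul1r expr1 coor_le_sqn. Qed.

Let pg_ge0 (p : V -> V -> R) A m : (forall y r, `|p y r| <= A * (1 + sqn r) ^+ m) ->
  0 <= A.
Proof.
move=> /(_ 0 0); rewrite -(pmulr_lge0 A (x := (1 + sqn (0 : V)) ^+ m)).
  exact: le_trans.
by rewrite exprn_gt0// (lt_le_trans ltr01).
Qed.

Lemma pgrowthM p1 p2 : pgrowth p1 -> pgrowth p2 ->
  pgrowth (fun y r => p1 y r * p2 y r).
Proof.
move=> [A1 [m1 H1]] [A2 [m2 H2]]; exists (A1 * A2), (m1 + m2)%N => y r.
by rewrite normrM exprD mulrACA ler_pM.
Qed.

Lemma pgrowthD p1 p2 : pgrowth p1 -> pgrowth p2 ->
  pgrowth (fun y r => p1 y r + p2 y r).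
Proof.
move=> [A1 [m1 H1]] [A2 [m2 H2]]; exists (A1 + A2), (m1 + m2)%N => y r.
rewrite (le_trans (ler_normD _ _))// mulrDl lerD//.
- apply: le_trans (H1 _ _) _; rewrite ler_wpM2l ?(pg_ge0 H1)//.
  by rewrite ler_weXn2l// leq_addr.
- apply: le_trans (H2 _ _) _; rewrite ler_wpM2l ?(pg_ge0 H2)//.
  by rewrite ler_weXn2l// leq_addl.
Qed.

Lemma pgrowth_cst c : pgrowth (fun _ _ => c).
Proof. exact: (@pgrowth_bounded _ `|c|). Qed.

Lemma pgrowthN p : pgrowth p -> pgrowth (fun y r => - p y r).
Proof. by move=> [A [m H]]; exists A, m => y r; rewrite normrN. Qed.

Lemma pgrowthB p1 p2 : pgrowth p1 -> pgrowth p2 ->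
  pgrowth (fun y r => p1 y r - p2 y r).
Proof. by move=> h1 h2; apply: pgrowthD => //; exact: pgrowthN. Qed.

Lemma pgrowth_sum (I : Type) (s : seq I) (F : I -> V -> V -> R) :
  (forall i, pgrowth (F i)) -> pgrowth (fun y r => \sum_(i <- s) F i y r).
Proof.
move=> HF; elim: s => [|i s IH].
  by apply: (@pgrowth_bounded _ 0) => y r; rewrite big_nil normr0.
have [A [m H]] := pgrowthD (HF i) IH.
by exists A, m => y r; rewrite big_cons.
Qed.

(** Half of the exponent absorbs the polynomial factor. As [b] stays bounded, the
    other half is controlled by [sqn y], whatever the variance in the given range:
    the resulting Gaussian in [y] dominates all the integrands met below. *)
Lemma gaussn_envelope (s0 s1 B : R) (m : nat) : 0 < s0 -> s0 <= s1 -> 0 <= B ->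
  exists2 K, 0 <= K & forall s (y b : V), s0 <= s <= s1 -> (forall k, `|b ord0 k| <= B) ->
    (1 + sqn (b - y)) ^+ m * gaussn s (b - y) <= K * gaussn (4 * s1) y.
Proof.
move=> s00 s01 B0.
have s10 : 0 < s1 by apply: lt_le_trans s01.
have pos (s : R) : 0 < s -> 0 < (Num.sqrt (s * pi *+ 2))^-1 ^+ n.
  move=> s_gt0; rewrite exprn_gt0// invr_gt0 sqrtr_gt0 mulrn_wgt0// mulr_gt0//.
  exact: pi_gt0.
have [c cE] : exists c, c = (Num.sqrt (s0 * pi *+ 2))^-1 ^+ n by eexists.
have [c' c'E] : exists c, c = (Num.sqrt (4 * s1 * pi *+ 2))^-1 ^+ n by eexists.
have c0 : 0 < c by rewrite cE; exact: pos.
have c'0 : 0 < c' by rewrite c'E; apply: pos; rewrite mulr_gt0.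
have [M ME] : exists M, M = (4 * s1) ^+ m * m%:R ^+ m by eexists.
have M0 : 0 <= M by rewrite ME mulr_ge0 ?exprn_ge0// mulr_ge0// ltW.
have [Z ZE] : exists Z, Z = (4 * s1)^-1 + n%:R * B ^+ 2 / (4 * s1) by eexists.
exists (M * c * expR Z / c').
  by rewrite divr_ge0 ?(ltW c'0)// !mulr_ge0 ?expR_ge0 ?(ltW c0).
move=> s y b /andP[s0s ss1] bB.
have s_gt0 : 0 < s by apply: lt_le_trans s0s.
have S0 := sqn_ge0 (b - y); have := S0.
have [S SE] : exists S, S = sqn (b - y) by eexists.
rewrite -SE in S0 * => _.
have stepA : (1 + S) ^+ m <= M * expR ((1 + S) / (4 * s1)).
  have /(expr_le_expR m) : 0 <= (1 + S) / (4 * s1).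
    by rewrite divr_ge0 ?addr_ge0// mulr_ge0// ltW.
  rewrite expr_div_n ler_pdivrMr; last by rewrite exprn_gt0// mulr_gt0.
  by rewrite ME mulrC mulrA.
have stepB : gaussn s (b - y) <= c * expR (- S / (s1 *+ 2)).
  rewrite gaussnE -SE cE ler_pM ?expR_ge0 ?(ltW (pos _ s_gt0))//.
    rewrite lerXn2r ?nnegrE ?invr_ge0 ?sqrtr_ge0// lef_pV2 ?posrE ?sqrtr_gt0.
    + rewrite ler_sqrt; last by rewrite mulrn_wge0// mulr_ge0 ?pi_ge0// ltW.
      by rewrite ler_wMn2r// ler_wpM2r ?pi_ge0.
    + by rewrite mulrn_wgt0// mulr_gt0 ?pi_gt0.
    + by rewrite mulrn_wgt0// mulr_gt0 ?pi_gt0.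
  rewrite ler_expR !mulNr lerN2 ler_wpM2l// lef_pV2 ?posrE ?mulrn_wgt0//.
  by rewrite ler_wMn2r.
have stepC : sqn y / 2 - n%:R * B ^+ 2 <= S.
  rewrite SE /sqn mulr_suml.
  have -> : n%:R * B ^+ 2 = \sum_(k < n) B ^+ 2 by rewrite sumr_const card_ord mulr_natl.
  rewrite -sumrB.
  apply: ler_sum => k _; rewrite !mxE.
  have : b ord0 k ^+ 2 <= B ^+ 2.
    by rewrite -[leLHS]real_normK ?num_real// lerXn2r ?nnegrE.
  have := sqr_ge0 (y ord0 k - 2 * b ord0 k).
  set y' := y _ _; set b' := b _ _; set B2 := B ^+ 2.
  by rewrite !expr2; lra.
apply: le_trans (ler_pM _ _ stepA stepB) _.
- by rewrite exprn_ge0// addr_ge0.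
- exact: gaussn_ge0.
rewrite mulrACA -expRD gaussnE -c'E [leRHS]mulrA divfK ?gt_eqF//.
rewrite -[leRHS]mulrA -expRD ler_wpM2l ?mulr_ge0 ?(ltW c0)// ler_expR ZE.
rewrite -subr_ge0 (_ : _ - _ = (S - (sqn y / 2 - n%:R * B ^+ 2)) / (4 * s1)).
  by rewrite divr_ge0 ?subr_ge0// mulr_ge0// ltW.
by field; rewrite gt_eqF.
Qed.

Lemma sqnD (x y : V) : sqn (x + y) = sqn x + 2 * inner x y + sqn y.
Proof.
rewrite /sqn /inner mulr_sumr -!big_split/=; apply: eq_bigr => k _.
by rewrite !mxE; ring.
Qed.

Lemma sqnZ (a : R) (x : V) : sqn (a *: x) = a ^+ 2 * sqn x.
Proof. by rewrite /sqn mulr_sumr; apply: eq_bigr => k _; rewrite !mxE exprMn. Qed.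

Lemma is_derive_gaussn s (r v : V) : 0 < s ->
  is_derive r v (gaussn s) (- (inner r v / s) * gaussn s r).
Proof.
move=> s0; apply: is_derive_line0.
under eq_fun do rewrite gaussnE.
have dq : is_derive (0 : R) 1 (fun k : R => sqn (k *: v + r)) (2 * inner r v).
  rewrite (_ : (fun k : R => _) =
      (fun k : R => k ^+ 2 * sqn v + 2 * (k * inner r v) + sqn r)).
    by apply: is_derive_eq; rewrite -![_ *: _]/(_ * _); ring.
  apply/funext => k; rewrite sqnD sqnZ; congr (_ + 2 * _ + _).
  by rewrite /inner mulr_sumr; apply: eq_bigr => i _; rewrite !mxE; ring.
have := is_derive_gaussn_path n (W := fun=> s) s0 (is_derive_cst _ _ _) dq.
rewrite scale0r add0r -gaussnE => H; apply: is_derive_eq.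
by congr (_ * _); field; rewrite gt_eqF.
Qed.

Lemma is_derive_shift (f : V -> R) (c x v : V) (d : R) :
  is_derive (x + c) v f d -> is_derive x v (fun z => f (z + c)) d.
Proof.
have H : (fun k : R => k^-1 *: ((f \o shift (x + c)) (k *: v) - f (x + c))) =
    (fun k : R => k^-1 *: (((fun z => f (z + c)) \o shift x) (k *: v)
       - (fun z => f (z + c)) x)).
  by apply/funext => k /=; rewrite addrA.
by move=> -[d1 d2]; split; move: d1 d2; rewrite /derivable /derive H.
Qed.

End growth.

Section transported_gaussian.
Context (R : realType) (n : nat).
Local Notation V := 'rV[R]_n.
Local Notation leb := (lebesgue_rV R n).
Variables (v : V -> V) (C0 : R).
Hypothesis mv : forall k, measurable_fun [set: V] (fun y => v y ord0 k).
Hypothesis vC : forall y k, `|v y ord0 k| <= C0.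
Hypothesis C00 : 0 <= C0.

(** The part of the displacement from [y] to [x] that the free flight with velocity
    [v y] does not explain: the value that the noise of the position must take. *)
Definition resid (t : R) (x y : V) : V := x - t *: v y - y.

Definition tgauss (p : V -> V -> R) (s t : R) (x : V) : R :=
  \int[leb]_y (p y (resid t x y) * gaussn s (resid t x y)).

(** The factors [p y r], with [r] standing for the residual, whose averages against the
    transported Gaussian density exist. *)
Definition adm (p : V -> V -> R) : Prop := pgrowth p /\
  forall t x, measurable_fun [set: V] (fun y => p y (resid t x y)).

Lemma measurable_resid t x : measurable_fun [set: V] (resid t x).
Proof.
apply: measurable_fun_rV => k; under eq_fun do rewrite !mxE.
apply: measurable_funB; last exact: measurable_coor.
apply: measurable_funB => //; exact: measurable_funM.
Qed.

Lemma adm_weight (w : V -> R) A : measurable_fun [set: V] w -> (forall y, `|w y| <= A) ->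
  adm (fun y _ => w y).
Proof. by move=> mw wA; split => //; apply: (@pgrowth_bounded _ _ _ A). Qed.

Lemma adm_cst c : adm (fun _ _ => c).
Proof. by apply: (@adm_weight _ `|c|). Qed.

Lemma adm_coor k : adm (fun _ r => r ord0 k).
Proof.
split; first exact: pgrowth_coor.
move=> t x; apply: (measurableT_comp (f := fun r : V => r ord0 k)).
  exact: measurable_coor.
exact: measurable_resid.
Qed.

Lemma adm_v k : adm (fun y _ => v y ord0 k).
Proof. by apply: (@adm_weight _ C0). Qed.

Lemma admM p1 p2 : adm p1 -> adm p2 -> adm (fun y r => p1 y r * p2 y r).
Proof.
move=> [h1 m1] [h2 m2]; split; first exact: pgrowthM.
by move=> t x; exact: measurable_funM.
Qed.

Lemma admD p1 p2 : adm p1 -> adm p2 -> adm (fun y r => p1 y r + p2 y r).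
Proof.
move=> [h1 m1] [h2 m2]; split; first exact: pgrowthD.
by move=> t x; exact: measurable_funD.
Qed.

Lemma admB p1 p2 : adm p1 -> adm p2 -> adm (fun y r => p1 y r - p2 y r).
Proof.
move=> [h1 m1] [h2 m2]; split; first exact: pgrowthB.
by move=> t x; exact: measurable_funB.
Qed.

Lemma adm_sum (I : Type) (s : seq I) (F : I -> V -> V -> R) :
  (forall i, adm (F i)) -> adm (fun y r => \sum_(i <- s) F i y r).
Proof.
move=> HF; split; first by apply: pgrowth_sum => i; case: (HF i).
by move=> t x; apply: measurable_sum => i; case: (HF i).
Qed.

Lemma adm_inner_v : adm (fun y r => inner r (v y)).
Proof.
by apply: adm_sum => k; apply: admM; [exact: adm_coor|exact: adm_v].
Qed.

Lemma adm_inner e : adm (fun y r => inner r e).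
Proof.
by apply: adm_sum => k; apply: admM; [exact: adm_coor|exact: adm_cst].
Qed.

Lemma adm_sqn : adm (fun y r => sqn r).
Proof.
rewrite /sqn; apply: adm_sum => k; under [fun y r => _]eq_fun2 do rewrite expr2.
by apply: admM; exact: adm_coor.
Qed.

Lemma integrable_gaussn_scaled K s : 0 < s ->
  leb.-integrable [set: V] (EFin \o (fun y => K * gaussn s y)).
Proof.
move=> s0; apply: integrableRZ => //; apply: ge0_integrableR => //.
- exact: measurable_gaussn.
- by move=> y _; exact: gaussn_ge0.
rewrite (_ : integral _ _ _ = 1%E) ?ltry// -(@integral_gaussn R n s 0 s0).
apply: eq_integral => y _; congr EFin; apply: eq_bigr => k _.
by rewrite !mxE add0r gaussN.
Qed.

Lemma integrable_tgauss p s t x : adm p -> 0 < s ->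
  leb.-integrable [set: V]
    (EFin \o (fun y => p y (resid t x y) * gaussn s (resid t x y))).
Proof.
move=> [[A [m pA]] mp] s0.
pose B := `|x| + `|t| * C0.
have B0 : 0 <= B by rewrite addr_ge0// mulr_ge0.
have [K K0 HK] := gaussn_envelope n m s0 (lexx s) B0.
apply: (@integrableR_le _ _ _ _ _ _ _ (fun y => `|A| * K * gaussn (4 * s) y)) => //.
- apply: measurable_funM => //; apply: measurableT_comp.
    exact: measurable_gaussn.
  exact: measurable_resid.
- by apply: integrable_gaussn_scaled; rewrite mulr_gt0.
move=> y _; rewrite normrM (ger0_norm (gaussn_ge0 _ _)).
apply: le_trans (_ : `|A| * ((1 + sqn (resid t x y)) ^+ m * gaussn s (resid t x y)) <= _).
  rewrite mulrA ler_wpM2r ?gaussn_ge0// (le_trans (pA _ _))//.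
  by rewrite ler_wpM2r ?ler_norm// exprn_ge0// addr_ge0// sqn_ge0.
rewrite -mulrA ler_wpM2l// HK ?lexx// => k.
rewrite !mxE (le_trans (ler_normB _ _))// lerD ?rV_norm_ge// normrM ler_wpM2l//.
Qed.

(** Differentiation with respect to the space variable falls on the factor [p]
    and on the Gaussian density; the envelope gives the domination. *)
Lemma is_derive_tgauss_x p p' s t (x e : V) : 0 < s -> adm p -> adm p' ->
  (forall y r, is_derive r e (p y) (p' y r)) ->
  is_derive x e (tgauss p s t)
    (tgauss (fun y r => p' y r - inner r e / s * p y r) s t x).
Proof.
move=> s0 ap ap' dp.
pose q y r := p' y r - inner r e / s * p y r.
have aq : adm q.
  apply: admB => //; apply: admM => //; apply: admM; last exact: adm_cst.
  exact: adm_inner.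
have [[A [m qA]] mq] := aq.
pose B := `|e| + `|x| + `|t| * C0.
have B0 : 0 <= B by rewrite !addr_ge0// mulr_ge0.
have [K K0 HK] := gaussn_envelope n m s0 (lexx s) B0.
rewrite /tgauss.
apply: (@is_derive_Rintegral _ _ _ _ leb _ (fun z y => q y (resid t z y) * gaussn s (resid t z y))
   x e 1 (fun y => `|A| * K * gaussn (4 * s) y)) => //.
- by move=> h _; exact: integrable_tgauss.
- move=> h y _.
  have E z : resid t z y = z + (- (t *: v y) - y) by rewrite /resid !addrA.
  rewrite E; under eq_fun do rewrite E.
  apply: (@is_derive_shift _ _ (fun r => p y r * gaussn s r)).
  set r := _ + _; have d1 := is_derive_gaussn r e s0; have d2 := dp y r.
  apply: is_derive_eq; rewrite /q -![_ *: _]/(_ * _).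
  ring.
- by apply: integrable_gaussn_scaled; rewrite mulr_gt0.
move=> h y h1; rewrite normrM (ger0_norm (gaussn_ge0 _ _)).
set z := h *: e + x.
apply: le_trans (_ : `|A| * ((1 + sqn (resid t z y)) ^+ m * gaussn s (resid t z y)) <= _).
  rewrite mulrA ler_wpM2r ?gaussn_ge0// (le_trans (qA _ _))//.
  by rewrite ler_wpM2r ?ler_norm// exprn_ge0// addr_ge0// sqn_ge0.
rewrite -mulrA ler_wpM2l// HK ?lexx// => k.
rewrite !mxE (le_trans (ler_normB _ _))// lerD//; last by rewrite normrM ler_wpM2l.
rewrite (le_trans (ler_normD _ _))// lerD ?rV_norm_ge// normrM.
by rewrite -[leRHS]mul1r ler_pM ?rV_norm_ge// ltW.
Qed.

Variables W W' : R -> R.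
Hypothesis W_gt0 : forall t, 0 < t -> 0 < W t.
Hypothesis dW : forall t : R, 0 < t -> is_derive t 1 W (W' t).
Hypothesis W_nd : forall t1 t2, 0 < t1 -> t1 <= t2 -> W t1 <= W t2.
Hypothesis W'_nd : forall t1 t2, 0 < t1 -> t1 <= t2 -> 0 <= W' t1 <= W' t2.

Lemma inner_v_le y r : `|inner r (v y)| <= n%:R * C0 * (1 + sqn r).
Proof.
rewrite (le_trans (ler_norm_sum _ _ _))// -mulrA -[X in X%:R](card_ord n).
rewrite mulr_natl -sumr_const; apply: ler_sum => k _.
by rewrite normrM mulrC ler_pM ?coor_le_sqn.
Qed.

Lemma is_derive_resid_sqn (t : R) x y : is_derive t 1 (fun t : R => sqn (resid t x y))
  (- (2 * inner (resid t x y) (v y))).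
Proof.
have E s : sqn (resid s x y) =
    sqn (x - y) - 2 * (s * inner (x - y) (v y)) + s ^+ 2 * sqn (v y).
  rewrite /sqn /inner !mulr_sumr -sumrB -big_split/=; apply: eq_bigr => k _.
  by rewrite !mxE; ring.
under eq_fun do rewrite E.
apply: is_derive_eq; rewrite -![_ *: _]/(_ * _).
have -> : inner (resid t x y) (v y) = inner (x - y) (v y) - t * sqn (v y).
  rewrite /sqn /inner mulr_sumr -sumrB; apply: eq_bigr => k _.
  by rewrite !mxE; ring.
by ring.
Qed.

(** For times between [t / 2] and [2 * t], the logarithmic derivative of the Gaussian
    factor is at most a multiple of [1 + sqn r], and the envelope applies. *)
Lemma is_derive_tgauss_t p p' (t : R) x : 0 < t -> adm p -> adm p' ->
  (forall (s : R) y, is_derive s 1 (fun s : R => p y (resid s x y)) (p' y (resid s x y))) ->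
  is_derive t 1 (fun t : R => tgauss p (W t) t x)
    (tgauss (fun y r => p' y r + p y r * (sqn r * W' t / (2 * W t ^+ 2)
       - n%:R * W' t / (2 * W t) + inner r (v y) / W t)) (W t) t x).
Proof.
move=> t0 ap ap' dp.
pose L s y r := sqn r * W' s / (2 * W s ^+ 2)
       - n%:R * W' s / (2 * W s) + inner r (v y) / W s.
have t20 : 0 < t / 2 by rewrite divr_gt0.
have t2t : t / 2 <= t * 2 by rewrite ler_pdivrMr// -mulrA ler_peMr ?ltW// ; lra.
pose s0 := W (t / 2); pose s1 := W (t * 2).
have s00 : 0 < s0 by exact: W_gt0.
have s01 : s0 <= s1 by exact: W_nd.
have W'1 : 0 <= W' (t * 2) by have /andP[] := W'_nd (mulr_gt0 t0 (ltr0n _ 2)) (lexx _).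
pose c := W' (t * 2) / (2 * s0 ^+ 2) + n%:R * W' (t * 2) / (2 * s0) + n%:R * C0 / s0.
have Lc s y r : t / 2 <= s <= t * 2 -> `|L s y r| <= c * (1 + sqn r).
  move=> /andP[ts st]; have S0 := sqn_ge0 r.
  have sgt0 : 0 < s by exact: lt_le_trans ts.
  have Ws0 : s0 <= W s by exact: W_nd.
  have Wgt0 : 0 < W s by exact: W_gt0.
  have /andP[W's0 W's] := W'_nd sgt0 st.
  have Wi : (W s)^-1 <= s0^-1 by rewrite lef_pV2.
  have Wi0 : 0 <= (W s)^-1 by rewrite invr_ge0 ltW.
  have W2i : (2 * W s)^-1 <= (2 * s0)^-1 by rewrite lef_pV2 ?posrE ?mulr_gt0// ler_pM2l.
  have W3i : (2 * W s ^+ 2)^-1 <= (2 * s0 ^+ 2)^-1.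
    rewrite lef_pV2 ?posrE ?mulr_gt0 ?exprn_gt0// ler_pM2l//.
    by rewrite lerXn2r ?nnegrE// ltW.
  rewrite /L /c [leRHS]mulrDl [X in _ <= X + _]mulrDl (le_trans (ler_normD _ _))// lerD//.
    rewrite (le_trans (ler_normB _ _))// lerD//.
      rewrite ger0_norm; last by rewrite !mulr_ge0// invr_ge0 mulr_ge0// exprn_ge0// ltW.
      rewrite -mulrA mulrC ler_pM ?mulr_ge0 ?lerDr// ?invr_ge0 ?mulr_ge0 ?exprn_ge0 ?(ltW Wgt0)//.
      by rewrite ler_pM ?invr_ge0 ?mulr_ge0 ?exprn_ge0 ?(ltW Wgt0).
    rewrite ger0_norm; last by rewrite !mulr_ge0// invr_ge0 mulr_ge0// ltW.
    rewrite -[leLHS]mulr1 ler_pM ?lerDl// ?mulr_ge0 ?invr_ge0 ?mulr_ge0 ?(ltW Wgt0)//.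
    by rewrite ler_pM ?mulr_ge0 ?invr_ge0 ?mulr_ge0 ?(ltW Wgt0)// ler_wpM2l.
  rewrite normrM (ger0_norm Wi0) mulrAC ler_pM//; exact: inner_v_le.
have [A [m PA]] : pgrowth (fun y r => `|p' y r| + `|p y r| * (c * (1 + sqn r))).
  have nrm (f : V -> V -> R) : pgrowth f -> pgrowth (fun y r => `|f y r|).
    by move=> [A [m H]]; exists A, m => y r; rewrite normr_id.
  apply: pgrowthD; first by apply: nrm; case: ap'.
  apply: pgrowthM; first by apply: nrm; case: ap.
  apply: pgrowthM; first exact: pgrowth_cst.
  apply: pgrowthD; first exact: pgrowth_cst.
  by case: adm_sqn.
pose B := `|x| + (t * 2) * C0.
have B0 : 0 <= B by rewrite !addr_ge0// !mulr_ge0 ?(ltW t0).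
have [K K0 HK] := gaussn_envelope n m s00 s01 B0.
have near_t h : `|h| < t / 2 -> t / 2 <= h *: (1 : R) + t <= t * 2.
  rewrite -[h *: _]/(h * 1) mulr1 ltr_norml => /andP[h1 h2].
  by apply/andP; split; lra.
apply: (@is_derive_Rintegral _ _ _ _ leb _ (fun s y => (p' y (resid s x y) +
   p y (resid s x y) * L s y (resid s x y)) * gaussn (W s) (resid s x y))
   t 1 (t / 2) (fun y => `|A| * K * gaussn (4 * s1) y)) => //.
- move=> h /near_t/andP[ht _]; apply: integrable_tgauss => //.
  by apply: W_gt0; exact: lt_le_trans ht.
- move=> h y /near_t/andP[ht _]; set s := _ + _.
  have sgt0 : 0 < s by exact: lt_le_trans ht.
  have d2 := dp s y.
  have d1 := is_derive_gaussn_path n (W_gt0 sgt0) (dW sgt0) (is_derive_resid_sqn s x y).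
  under eq_fun do rewrite gaussnE.
  apply: is_derive_eq; rewrite -![_ *: _]/(_ * _) /L gaussnE.
  have W0' := gt_eqF (W_gt0 sgt0).
  by set a := _ ^+ n; set b := expR _; field; rewrite W0'.
- by apply: integrable_gaussn_scaled; rewrite mulr_gt0// W_gt0// mulr_gt0.
move=> h y /near_t ht; rewrite normrM (ger0_norm (gaussn_ge0 _ _)).
move: ht; set s := _ + _ => ht; have /andP[ht1 ht2] := ht.
apply: le_trans (_ : `|A| * ((1 + sqn (resid s x y)) ^+ m * gaussn (W s) (resid s x y)) <= _).
  rewrite mulrA ler_wpM2r ?gaussn_ge0//.
  apply: le_trans (_ : A * (1 + sqn (resid s x y)) ^+ m <= _); last first.
    by rewrite ler_wpM2r ?ler_norm// exprn_ge0// addr_ge0// sqn_ge0.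
  apply: le_trans (PA y _); apply: le_trans (ler_norm _).
  by rewrite (le_trans (ler_normD _ _))// lerD// normrM ler_wpM2l// Lc.
have sgt0 : 0 < s by exact: lt_le_trans ht1.
rewrite -mulrA ler_wpM2l// HK//; first by rewrite !W_nd.
move=> k; rewrite !mxE (le_trans (ler_normB _ _))// lerD ?rV_norm_ge//.
by rewrite normrM ler_pM// gtr0_norm.
Qed.

End transported_gaussian.

(** * The balance laws for the Gaussian moments *)

Section covariance.
Context (R : realType).
Variables (s1 s2 : R).

(** The covariance matrix, in each coordinate, of the noise
    [(s1 * W1 t + s2 * \int_0^t W2, s2 * W2 t)] of the position and velocity. *)
Definition varX (t : R) : R := s1 ^+ 2 * t + s2 ^+ 2 * t ^+ 3 / 3.
Definition varX' (t : R) : R := s1 ^+ 2 + s2 ^+ 2 * t ^+ 2.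
Definition covXU (t : R) : R := s2 ^+ 2 * t ^+ 2 / 2.
Definition varU (t : R) : R := s2 ^+ 2 * t.
(** The coefficient of the regression of the noise of the velocity on that of the
    position, and below the variance that this regression leaves. *)
Definition slope (t : R) : R := covXU t / varX t.
Definition slope' (t : R) : R :=
  varU t / varX t - covXU t * varX' t / varX t ^+ 2.
Definition resvar (t : R) : R := varU t - covXU t ^+ 2 / varX t.

Hypothesis s_neq0 : (s1, s2) != (0, 0).

Lemma varX_gt0 t : 0 < t -> 0 < varX t.
Proof.
move=> t0; rewrite /varX.
have [s20|s20] := eqVneq s2 0.
  rewrite s20 expr0n/= !mul0r addr0 mulr_gt0// exprn_even_gt0//=.
  by apply: contra_neq s_neq0 => ->; rewrite s20.
rewrite ltr_wpDl//; first by rewrite mulr_ge0 ?sqr_ge0// ltW.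
by rewrite divr_gt0// mulr_gt0//; [rewrite exprn_even_gt0|rewrite exprn_gt0].
Qed.

Lemma is_derive_varX (t : R) : is_derive t 1 varX (varX' t).
Proof.
rewrite /varX; apply: is_derive_eq.
by rewrite -![_ *: _]/(_ * _) /varX'; field.
Qed.

Lemma varX_nd t1 t2 : 0 < t1 -> t1 <= t2 -> varX t1 <= varX t2.
Proof.
move=> t10 t12; rewrite /varX lerD//; first by rewrite ler_wpM2l ?sqr_ge0.
rewrite ler_wpM2r// ler_wpM2l ?sqr_ge0// lerXn2r ?nnegrE ?(ltW t10)//.
exact: le_trans (ltW t10) t12.
Qed.

Lemma varX'_nd t1 t2 : 0 < t1 -> t1 <= t2 -> 0 <= varX' t1 <= varX' t2.
Proof.
move=> t10 t12; have h : 0 <= s2 ^+ 2 * t1 ^+ 2 by rewrite -exprMn sqr_ge0.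
rewrite /varX' addr_ge0 ?sqr_ge0//=.
rewrite lerD// ler_wpM2l ?sqr_ge0// lerXn2r ?nnegrE ?(ltW t10)//.
exact: le_trans (ltW t10) t12.
Qed.

Lemma is_derive_slope (t : R) : 0 < t -> is_derive t 1 slope (slope' t).
Proof.
move=> t0; have W0 := varX_gt0 t0; have dW := is_derive_varX t.
have dV : is_derive t 1 (fun t => (varX t)^-1) (- varX t ^- 2 *: varX' t).
  by apply: is_deriveV; rewrite ?gt_eqF.
rewrite /slope /covXU; apply: is_derive_eq.
rewrite -![_ *: _]/(_ * _) /slope' /covXU /varU.
by field; rewrite gt_eqF.
Qed.

Lemma varX'E t : varX' t = s1 ^+ 2 + 2 * covXU t.
Proof. by rewrite /varX' /covXU; field. Qed.

(** The Riccati equation of the regression coefficient; it is through it that the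
    noise of the velocity enters the balance of momentum. *)
Lemma slope_riccati t : 0 < t ->
  slope' t + slope t ^+ 2 + s1 ^+ 2 * slope t / varX t = resvar t / varX t.
Proof.
move=> t0; have /gt_eqF W0 := varX_gt0 t0.
by rewrite /slope' varX'E /slope /resvar; field; rewrite W0.
Qed.

Lemma cov_lt t : 0 < t -> s2 != 0 -> covXU t ^+ 2 < varX t * varU t.
Proof.
move=> t0 s20; rewrite -subr_gt0 /varX /varU /covXU.
have s22 : 0 < s2 ^+ 2 by rewrite exprn_even_gt0.
have := sqr_ge0 s1; move: s22; move: (s1 ^+ 2) (s2 ^+ 2) => a b b0 a0.
have -> : (a * t + b * t ^+ 3 / 3) * (b * t) - (b * t ^+ 2 / 2) ^+ 2 =
  a * (b * t ^+ 2) + b ^+ 2 * t ^+ 4 / 12 by field.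
rewrite ltr_wpDl//; first by rewrite mulr_ge0// mulr_ge0 ?sqr_ge0// ltW.
by rewrite divr_gt0// mulr_gt0 ?exprn_gt0.
Qed.

Lemma resvar_gt0 t : 0 < t -> s2 != 0 -> 0 < resvar t.
Proof.
move=> t0 s20; rewrite subr_gt0 ltr_pdivrMr ?varX_gt0// mulrC.
exact: cov_lt.
Qed.

End covariance.

Section weighted_moments.
Context (R : realType) (n : nat).
Local Notation V := 'rV[R]_n.
Local Notation leb := (lebesgue_rV R n).
Variables (v : V -> V) (C0 : R).
Hypothesis mv : forall k, measurable_fun [set: V] (fun y => v y ord0 k).
Hypothesis vC : forall y k, `|v y ord0 k| <= C0.
Hypothesis C00 : 0 <= C0.
Variables (w : V -> R) (Cw : R).
Hypothesis mw : measurable_fun [set: V] w.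
Hypothesis wC : forall y, `|w y| <= Cw.
Hypothesis w0 : forall y, 0 <= w y.

Local Notation adm := (adm v).
Local Notation resid := (resid v).

Definition wgauss (p : V -> V -> R) (s t : R) (x : V) : R :=
  tgauss v (fun y r => w y * p y r) s t x.

Let aw p : adm p -> adm (fun y r => w y * p y r).
Proof. by move=> ap; apply: admM => //; apply: (adm_weight _ mw wC). Qed.

Lemma integrable_wgauss p s t x : adm p -> 0 < s ->
  leb.-integrable [set: V] (EFin \o (fun y =>
    w y * p y (resid t x y) * gaussn s (resid t x y))).
Proof. by move=> /aw ap s0; exact: (integrable_tgauss mv vC C00 t x ap s0). Qed.

Lemma admN p : adm p -> adm (fun y r => - p y r).
Proof.
move=> [h m]; split; first exact: pgrowthN.
by move=> t x; exact: measurable_funN.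
Qed.

Lemma wgauss_ext p1 p2 s t x : (forall y r, p1 y r = p2 y r) ->
  wgauss p1 s t x = wgauss p2 s t x.
Proof. by move=> p12; apply: eq_Rintegral => y _; rewrite p12. Qed.

Lemma wgauss0 p s t x : (forall y r, p y r = 0) -> wgauss p s t x = 0.
Proof.
move=> p0; rewrite /wgauss /tgauss /Rintegral integral0_eq// => y _.
by rewrite p0 mulr0 mul0r.
Qed.

Lemma wgaussD p1 p2 s t x : 0 < s -> adm p1 -> adm p2 ->
  wgauss (fun y r => p1 y r + p2 y r) s t x = wgauss p1 s t x + wgauss p2 s t x.
Proof.
move=> s0 a1 a2; rewrite /wgauss /tgauss -RintegralD//; try exact: integrable_wgauss.
by apply: eq_Rintegral => y _; ring.
Qed.

Lemma wgaussZ c p s t x : 0 < s -> adm p ->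
  wgauss (fun y r => c * p y r) s t x = c * wgauss p s t x.
Proof.
move=> s0 a; rewrite /wgauss /tgauss -RintegralZl//; try exact: integrable_wgauss.
by apply: eq_Rintegral => y _; ring.
Qed.

Lemma wgaussN p s t x : 0 < s -> adm p ->
  wgauss (fun y r => - p y r) s t x = - wgauss p s t x.
Proof.
move=> s0 a; rewrite -[RHS]mulN1r -wgaussZ//.
by apply: wgauss_ext => y r; rewrite mulN1r.
Qed.

Lemma wgaussB p1 p2 s t x : 0 < s -> adm p1 -> adm p2 ->
  wgauss (fun y r => p1 y r - p2 y r) s t x = wgauss p1 s t x - wgauss p2 s t x.
Proof.
move=> s0 a1 a2; rewrite -wgaussN// -wgaussD//.
exact: admN.
Qed.

Lemma wgauss_sum (I : Type) (l : seq I) (F : I -> V -> V -> R) s t x : 0 < s ->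
  (forall i, adm (F i)) ->
  wgauss (fun y r => \sum_(i <- l) F i y r) s t x = \sum_(i <- l) wgauss (F i) s t x.
Proof.
move=> s0 aF; rewrite /wgauss /tgauss -RintegralR_sum//.
  by apply: eq_Rintegral => y _; rewrite mulr_sumr mulr_suml.
by move=> i; exact: integrable_wgauss.
Qed.

Lemma is_derive_wgauss_x p p' s t (x e : V) : 0 < s -> adm p -> adm p' ->
  (forall y r, is_derive r e (p y) (p' y r)) ->
  is_derive x e (wgauss p s t)
    (wgauss (fun y r => p' y r - inner r e / s * p y r) s t x).
Proof.
move=> s0 ap ap' dp.
have d y r : is_derive r e (fun r => w y * p y r) (w y * p' y r).
  by have d := dp y r; apply: is_derive_eq; rewrite -![_ *: _]/(_ * _).
have := is_derive_tgauss_x mv vC C00 t x s0 (aw ap) (aw ap') d.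
move=> H; rewrite /wgauss; apply: is_derive_eq.
by apply: eq_Rintegral => y _; ring.
Qed.

Lemma is_derive_coor (r e : V) i : is_derive r e (fun r : V => r ord0 i) (e ord0 i).
Proof.
apply: is_derive_line0.
rewrite (_ : (fun k : R => _) = (fun k : R => k * e ord0 i + r ord0 i)).
  by apply: is_derive_eq; rewrite -![_ *: _]/(_ * _); ring.
by apply/funext => k; rewrite !mxE.
Qed.

Section time.
Variables W W' : R -> R.
Hypothesis W_gt0 : forall t, 0 < t -> 0 < W t.
Hypothesis dW : forall t : R, 0 < t -> is_derive t 1 W (W' t).
Hypothesis W_nd : forall t1 t2, 0 < t1 -> t1 <= t2 -> W t1 <= W t2.
Hypothesis W'_nd : forall t1 t2, 0 < t1 -> t1 <= t2 -> 0 <= W' t1 <= W' t2.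

Lemma is_derive_wgauss_t p p' (t : R) x : 0 < t -> adm p -> adm p' ->
  (forall (s : R) y, is_derive s 1 (fun s : R => p y (resid s x y)) (p' y (resid s x y))) ->
  is_derive t 1 (fun t : R => wgauss p (W t) t x)
    (wgauss (fun y r => p' y r + p y r * (sqn r * W' t / (2 * W t ^+ 2)
       - n%:R * W' t / (2 * W t) + inner r (v y) / W t)) (W t) t x).
Proof.
move=> t0 ap ap' dp.
have d (s : R) y : is_derive s 1 (fun s : R => w y * p y (resid s x y))
    (w y * p' y (resid s x y)).
  by have d := dp s y; apply: is_derive_eq; rewrite -![_ *: _]/(_ * _).
have := is_derive_tgauss_t mv vC C00 W_gt0 dW W_nd W'_nd t0 (aw ap) (aw ap') d.
move=> H; rewrite /wgauss; apply: is_derive_eq.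
by apply: eq_Rintegral => y _; ring.
Qed.

End time.

(** A Gaussian density vanishes nowhere: vacuum at one point forces the weight to
    vanish almost everywhere, hence all the moments to vanish everywhere. *)
Lemma wgauss_gt0_or :
  (forall s t x, 0 < s -> 0 < wgauss (fun _ _ => 1) s t x) \/
  (forall p s t x, 0 < s -> adm p -> wgauss p s t x = 0).
Proof.
have [H|H] := pselect ({ae leb, forall y, w y = 0}).
  right=> p s t x s0 ap.
  rewrite /wgauss /tgauss /Rintegral (ae_eq_integral (cst 0%E)) ?integral0//.
    by have /integrableP[] := integrable_wgauss t x ap s0.
  by apply: filterS H => y /= -> _; rewrite !mul0r.
left=> s t x s0.
have I0 := integrable_wgauss t x (adm_cst v 1) s0.
rewrite lt_neqAle; apply/andP; split; last first.
  by apply: Rintegral_ge0 => y _; rewrite !mulr_ge0// gaussn_ge0.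
apply/eqP => /esym E; apply: H.
have : (\int[leb]_y `|(w y * 1 * gaussn s (resid t x y))%:E| = 0)%E.
  rewrite -[RHS]/(0%:E) -{}E -RintegralE//; apply: eq_integral => y _.
  by rewrite gee0_abs// lee_fin !mulr_ge0// gaussn_ge0.
move/(ae_eq_integral_abs _ measurableT).
have /integrableP[m1 _] := I0.
move=> /(_ m1); apply: filterS => y /= /(_ I) [] /eqP.
by rewrite mulr1 mulf_eq0 [gaussn _ _ == 0]gt_eqF ?gaussn_gt0// orbF => /eqP.
Qed.

Variables (s1 s2 : R).
Hypothesis s_neq0 : (s1, s2) != (0, 0).
Local Notation var := (varX s1 s2).
Local Notation var' := (varX' s1 s2).
Local Notation sl := (slope s1 s2).
Local Notation sl' := (slope' s1 s2).
Local Notation rv := (resvar s1 s2).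
Local Notation ek := (basis_vec R).

(** The mean of the velocity, knowing the starting point and the residual. *)
Definition cmean (t : R) (y r : V) (i : 'I_n) : R :=
  v y ord0 i + sl t * r ord0 i.

Definition mass (t : R) (x : V) : R := wgauss (fun _ _ => 1) (var t) t x.

Definition momentum (i : 'I_n) (t : R) (x : V) : R :=
  wgauss (fun y r => cmean t y r i) (var t) t x.

(** The conditional mean of
    [(u_i - ub_i) * (u_k - ub_k) * (d_k log p)], where [p] is the density of the pair
    (position, velocity) and [d_k] the derivative in the position. *)
Definition stress (ub : V) (i k : 'I_n) (t : R) (y r : V) : R :=
  - (r ord0 k / var t) * ((cmean t y r i - ub ord0 i) * (cmean t y r k - ub ord0 k)
     + (i == k)%:R * rv t)
  + sl t * ((cmean t y r i - ub ord0 i) + (i == k)%:R * (cmean t y r k - ub ord0 k)).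

(** The derivative in time of the logarithm of the Gaussian factor. *)
Let logdt (t : R) (y r : V) : R := sqn r * var' t / (2 * var t ^+ 2)
       - n%:R * var' t / (2 * var t) + inner r (v y) / var t.

Let adm_logdt t : adm (logdt t).
Proof.
rewrite /logdt; apply: admD.
  apply: admB; last exact: adm_cst.
  apply: admM; last exact: adm_cst.
  apply: admM; last exact: adm_cst.
  exact: (adm_sqn mv).
apply: admM; last exact: adm_cst.
exact: (adm_inner_v mv vC).
Qed.

Let acst c : adm (fun _ _ => c). Proof. exact: adm_cst. Qed.
Let acoor k : adm (fun _ r => r ord0 k). Proof. exact: (adm_coor mv). Qed.
Let av k : adm (fun y _ => v y ord0 k). Proof. exact: (adm_v mv vC). Qed.

Let acmean t i : adm (fun y r => cmean t y r i).
Proof. by apply: admD => //; apply: admM. Qed.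

Lemma inner_basis (r : V) k : inner r (ek k) = r ord0 k.
Proof.
rewrite /inner (bigD1 k)//= big1 ?addr0 => [|i ik].
  by rewrite mxE !eqxx mulr1.
by rewrite mxE eqxx/= (negbTE ik) mulr0.
Qed.

Lemma basis_coor (k i : 'I_n) : ek k ord0 i = (i == k)%:R.
Proof. by rewrite mxE eqxx. Qed.

Let is_derive_coor_basis (r : V) k : is_derive r (ek k) (fun r : V => r ord0 k) 1.
Proof. by have := is_derive_coor r (ek k) k; rewrite basis_coor eqxx. Qed.

Let is_derive_resid_coor (s : R) x y i :
  is_derive s 1 (fun s : R => resid s x y ord0 i) (- v y ord0 i).
Proof.
rewrite (_ : (fun s : R => _) = (fun s : R => x ord0 i - s * v y ord0 i - y ord0 i)).
  by apply: is_derive_eq; rewrite -![_ *: _]/(_ * _); ring.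
by apply/funext => z; rewrite !mxE.
Qed.

Lemma is_derive_mass_t (t : R) x : 0 < t ->
  is_derive t 1 (fun t : R => mass t x) (wgauss (logdt t) (var t) t x).
Proof.
move=> t0.
have d (s : R) (y : V) : is_derive s 1 (fun s : R => 1 : R) 0 by exact: is_derive_cst.
have := is_derive_wgauss_t (varX_gt0 s_neq0) (fun t _ => is_derive_varX s1 s2 t)
  (varX_nd s1 s2) (varX'_nd s1 s2) t0 (acst 1) (acst 0) d.
by move=> H; apply: is_derive_eq; apply: wgauss_ext => y r; rewrite add0r mul1r.
Qed.

Lemma is_derive_mass_x (t : R) x k : 0 < t ->
  is_derive x (ek k) (mass t)
    (wgauss (fun y r => - (r ord0 k / var t)) (var t) t x).
Proof.
move=> t0; have V0 := varX_gt0 s_neq0 t0.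
have d (y r : V) : is_derive r (ek k) (fun r : V => 1 : R) 0 by exact: is_derive_cst.
have H := is_derive_wgauss_x t x V0 (acst 1) (acst 0) d.
apply: is_derive_eq; apply: wgauss_ext => y r.
by rewrite inner_basis mulr1 sub0r.
Qed.

Lemma is_derive_mass_xx (t : R) x k : 0 < t ->
  is_derive x (ek k) (wgauss (fun y r => - (r ord0 k / var t)) (var t) t)
    (wgauss (fun y r => r ord0 k ^+ 2 / var t ^+ 2 - (var t)^-1) (var t) t x).
Proof.
move=> t0; have V0 := varX_gt0 s_neq0 t0.
have d (y r : V) : is_derive r (ek k) (fun r : V => - (r ord0 k / var t)) (- (var t)^-1).
  have d1 := is_derive_coor_basis r k.
  by apply: is_derive_eq; rewrite -![_ *: _]/(_ * _); ring.
have a1 : adm (fun y r => - (r ord0 k / var t)) by apply: admN; apply: admM.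
have H := is_derive_wgauss_x t x V0 a1 (acst (- (var t)^-1)) d.
apply: is_derive_eq; apply: wgauss_ext => y r.
by rewrite inner_basis; field; rewrite gt_eqF.
Qed.

Lemma is_derive_momentum_t (t : R) x i : 0 < t ->
  is_derive t 1 (fun t : R => momentum i t x)
    (wgauss (fun y r => - sl t * v y ord0 i + sl' t * r ord0 i +
       cmean t y r i * logdt t y r) (var t) t x).
Proof.
move=> t0; have V0 := varX_gt0 s_neq0 t0.
have E : \forall s \near t, (wgauss (fun y _ => v y ord0 i) (var s) s x +
    sl s * wgauss (fun _ r => r ord0 i) (var s) s x) = momentum i s x.
  near=> s; have s0 : 0 < s by near: s; exact: lt_nbhsr.
  have Vs := varX_gt0 s_neq0 s0.
  by rewrite /momentum /cmean wgaussD ?wgaussZ//; apply: admM.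
apply: (near_eq_is_derive E).
have dt p p' (ap : adm p) (ap' : adm p') d : is_derive t 1 (fun t : R => wgauss p (var t) t x)
    (wgauss (fun y r => p' y r + p y r * logdt t y r) (var t) t x) :=
  is_derive_wgauss_t (varX_gt0 s_neq0) (fun t _ => is_derive_varX s1 s2 t)
  (varX_nd s1 s2) (varX'_nd s1 s2) t0 ap ap' d.
have d1 := dt _ _ (av i) (acst 0) (fun s y => is_derive_cst _ _ _).
have d2 := dt _ _ (acoor i) (admN (av i)) (fun s y => is_derive_resid_coor s x y i).
have d3 := is_derive_slope s_neq0 t0.
apply: is_derive_eq; rewrite -![_ *: _]/(_ * _).
have aL p : adm p -> adm (fun y r => p y r * logdt t y r) by move=> ap; apply: admM.
rewrite [in RHS]wgaussD//; last 2 first.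
- by apply: admD; apply: admM.
- exact: aL.
rewrite [in RHS]wgaussD//; [|by apply: admM|by apply: admM].
rewrite !wgaussZ//.
have -> : wgauss (fun y r => cmean t y r i * logdt t y r) (var t) t x =
  wgauss (fun y r => v y ord0 i * logdt t y r) (var t) t x +
  sl t * wgauss (fun y r => r ord0 i * logdt t y r) (var t) t x.
  rewrite -wgaussZ//; last exact: aL.
  rewrite -wgaussD//; [|exact: aL|by apply: admM => //; exact: aL].
  by apply: wgauss_ext => y r; rewrite /cmean; ring.
rewrite wgaussD//; [|exact: aL].
rewrite (wgaussD (p1 := fun y r => - v y ord0 i))//; [|exact: admN|exact: aL].
rewrite wgaussN// (wgauss0 (p := fun _ _ => 0))//.
by ring.
Unshelve. all: end_near. Qed.

Lemma is_derive_momentum_x (t : R) x i k : 0 < t ->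
  is_derive x (ek k) (momentum i t)
    (wgauss (fun y r => sl t * (i == k)%:R - r ord0 k / var t * cmean t y r i)
      (var t) t x).
Proof.
move=> t0; have V0 := varX_gt0 s_neq0 t0.
have d (y r : V) : is_derive r (ek k) (fun r : V => cmean t y r i) (sl t * (i == k)%:R).
  rewrite /cmean; have d1 := is_derive_coor r (ek k) i; rewrite basis_coor in d1.
  by apply: is_derive_eq; rewrite -![_ *: _]/(_ * _); ring.
have H := is_derive_wgauss_x t x V0 (acmean t i) (acst (sl t * (i == k)%:R)) d.
by apply: is_derive_eq; apply: wgauss_ext => y r; rewrite inner_basis.
Qed.

Lemma is_derive_momentum_xx (t : R) x i k : 0 < t ->
  is_derive x (ek k)
    (wgauss (fun y r => sl t * (i == k)%:R - r ord0 k / var t * cmean t y r i)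
      (var t) t)
    (wgauss (fun y r => - (cmean t y r i / var t)
       - 2 * sl t * (i == k)%:R * (r ord0 k / var t)
       + r ord0 k ^+ 2 / var t ^+ 2 * cmean t y r i) (var t) t x).
Proof.
move=> t0; have V0 := varX_gt0 s_neq0 t0.
pose p' (y r : V) := - ((var t)^-1 * cmean t y r i + r ord0 k / var t * (sl t * (i == k)%:R)).
have d (y r : V) : is_derive r (ek k)
    (fun r : V => sl t * (i == k)%:R - r ord0 k / var t * cmean t y r i) (p' y r).
  rewrite /cmean; have d1 := is_derive_coor r (ek k) i; rewrite basis_coor in d1.
  have d2 := is_derive_coor_basis r k.
  by apply: is_derive_eq; rewrite -![_ *: _]/(_ * _) /p' /cmean; ring.
have a1 : adm (fun y r => sl t * (i == k)%:R - r ord0 k / var t * cmean t y r i).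
  by apply: admB => //; apply: admM => //; apply: admM.
have a2 : adm p'.
  by apply: admN; apply: admD; [apply: admM|apply: admM => //; apply: admM].
have H := is_derive_wgauss_x t x V0 a1 a2 d.
apply: is_derive_eq; apply: wgauss_ext => y r.
by rewrite inner_basis /p'; field; rewrite gt_eqF.
Qed.

Lemma logdtE t y r : logdt t y r = \sum_k
  (r ord0 k ^+ 2 * var' t / (2 * var t ^+ 2) - var' t / (2 * var t)
     + r ord0 k * v y ord0 k / var t).
Proof.
rewrite !big_split/= sumrN sumr_const card_ord /logdt /sqn /inner !mulr_suml.
by congr (_ - _ + _); rewrite -[RHS]mulr_natl [RHS]mulrA.
Qed.

(** For each [y] the transported Gaussian obeys the balance laws on its own: the
    integrands cancel identically in [y] and [r]. *)
Lemma mass_balance (t : R) x : 0 < t ->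
  wgauss (logdt t) (var t) t x +
    \sum_k wgauss (fun y r => sl t * (k == k)%:R - r ord0 k / var t * cmean t y r k)
      (var t) t x =
  2^-1 * s1 ^+ 2 * \sum_k wgauss (fun y r => r ord0 k ^+ 2 / var t ^+ 2 - (var t)^-1)
    (var t) t x.
Proof.
move=> t0; have V0 := varX_gt0 s_neq0 t0.
have aP (k : 'I_n) : adm (fun y r => sl t * (k == k)%:R - r ord0 k / var t * cmean t y r k).
  by apply: admB => //; apply: admM => //; apply: admM.
have aQ k : adm (fun (y r : V) => r ord0 k ^+ 2 / var t ^+ 2 - (var t)^-1).
  by apply: admB => //; apply: admM => //; apply: admM.
have aQ' k : adm (fun (y r : V) => 2^-1 * s1 ^+ 2 * (r ord0 k ^+ 2 / var t ^+ 2 - (var t)^-1)).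
  by apply: admM.
apply/eqP; rewrite -subr_eq0 mulr_sumr -addrA -sumrB; apply/eqP.
under eq_bigr do rewrite -wgaussZ// -wgaussB//.
rewrite -wgauss_sum//; last by move=> k; exact: admB.
rewrite -wgaussD//; last by apply: adm_sum => // k; exact: admB.
apply: wgauss0 => y r; rewrite logdtE -big_split/= big1// => k _.
by rewrite eqxx mulr1n varX'E /cmean /slope; field; rewrite gt_eqF.
Qed.

(** The sum over [k] is the derivative of the flux [m_i * m_k / rho] at a point where
    the velocity is [ub], developed by the product rule. With [ub] as a parameter,
    the identity is linear in the moments and may again be checked under the
    integral. *)
Lemma momentum_balance (t : R) x (ub : V) i : 0 < t ->
  wgauss (fun y r => - sl t * v y ord0 i + sl' t * r ord0 i +
       cmean t y r i * logdt t y r) (var t) t x +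
    \sum_k (ub ord0 k * wgauss (fun y r => sl t * (i == k)%:R
                 - r ord0 k / var t * cmean t y r i) (var t) t x +
            ub ord0 i * wgauss (fun y r => sl t * (k == k)%:R
                 - r ord0 k / var t * cmean t y r k) (var t) t x -
            ub ord0 i * ub ord0 k * wgauss (fun y r => - (r ord0 k / var t)) (var t) t x) =
  2^-1 * s1 ^+ 2 * (\sum_k wgauss (fun y r => - (cmean t y r i / var t)
       - 2 * sl t * (i == k)%:R * (r ord0 k / var t)
       + r ord0 k ^+ 2 / var t ^+ 2 * cmean t y r i) (var t) t x)
  - \sum_k wgauss (stress ub i k t) (var t) t x.
Proof.
move=> t0; have V0 := varX_gt0 s_neq0 t0.
have aP (j k : 'I_n) : adm (fun y r => sl t * (j == k)%:R - r ord0 k / var t * cmean t y r j).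
  by apply: admB => //; apply: admM => //; apply: admM.
have aN k : adm (fun (y r : V) => - (r ord0 k / var t)).
  by apply: admN; apply: admM.
have aQ k : adm (fun (y r : V) => - (cmean t y r i / var t)
       - 2 * sl t * (i == k)%:R * (r ord0 k / var t)
       + r ord0 k ^+ 2 / var t ^+ 2 * cmean t y r i).
  apply: admD; last by apply: admM => //; apply: admM => //; apply: admM.
  by apply: admB; [apply: admN; apply: admM|apply: admM => //; apply: admM].
have aS k : adm (stress ub i k t).
  have ac j : adm (fun y r => cmean t y r j - ub ord0 j) by apply: admB.
  apply: admD.
    apply: admM; first exact: aN.
    by apply: admD => //; apply: admM.
  by apply: admM => //; apply: admD => //; apply: admM.
have aC c p : adm p -> adm (fun y r => c * p y r) by move=> ap; apply: admM.
have aT : adm (fun y r => - sl t * v y ord0 i + sl' t * r ord0 i + cmean t y r i * logdt t y r).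
  by apply: admD; [apply: admD; exact: aC|apply: admM].
pose F k (y r : V) := ub ord0 k * (sl t * (i == k)%:R - r ord0 k / var t * cmean t y r i) +
            ub ord0 i * (sl t * (k == k)%:R - r ord0 k / var t * cmean t y r k) -
            ub ord0 i * ub ord0 k * (- (r ord0 k / var t)).
have aF k : adm (F k) by apply: admB; [apply: admD|]; exact: aC.
have aG k : adm (fun y r => 2^-1 * s1 ^+ 2 * (- (cmean t y r i / var t)
       - 2 * sl t * (i == k)%:R * (r ord0 k / var t)
       + r ord0 k ^+ 2 / var t ^+ 2 * cmean t y r i) - stress ub i k t y r).
  by apply: admB => //; exact: aC.
apply/eqP; rewrite -subr_eq0 mulr_sumr -addrA -!sumrB; apply/eqP.
under eq_bigr => k _.
  rewrite -(wgaussZ (ub ord0 k))// -(wgaussZ (ub ord0 i))// -(wgaussZ (ub ord0 i * _))//.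
  rewrite -wgaussD//; [|exact: aC|exact: aC].
  rewrite -wgaussB//; [|by apply: admD; exact: aC|exact: aC].
  rewrite -(wgaussZ (2^-1 * s1 ^+ 2))//.
  rewrite -(wgaussB (p1 := fun y r => 2^-1 * s1 ^+ 2 * _ ))//; [|exact: aC].
  rewrite -(wgaussB (p1 := F k))//.
  over.
rewrite -wgauss_sum//; last by move=> k; exact: admB.
rewrite -wgaussD//; last by apply: adm_sum => // k; exact: admB.
apply: wgauss0 => y r.
have -> : - sl t * v y ord0 i + sl' t * r ord0 i + cmean t y r i * logdt t y r =
  \sum_k ((i == k)%:R * (- sl t * v y ord0 k + sl' t * r ord0 k) + cmean t y r i *
  (r ord0 k ^+ 2 * var' t / (2 * var t ^+ 2) - var' t / (2 * var t)
     + r ord0 k * v y ord0 k / var t)).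
  rewrite big_split/= -mulr_sumr -logdtE; congr (_ + _).
  rewrite (bigD1 i)//= eqxx mul1r big1 ?addr0// => k ki.
  by rewrite eq_sym (negbTE ki) mul0r.
rewrite -big_split/= big1// => k _; rewrite /F /stress eqxx.
have Q := slope_riccati s_neq0 t0.
have Vn := gt_eqF V0.
have {Q}Q : rv t = (sl' t + sl t ^+ 2 + s1 ^+ 2 * sl t / var t) * var t.
  by rewrite Q divfK ?Vn.
have E : sl t * var t = covXU s2 t by rewrite /slope divfK ?Vn.
rewrite Q varX'E -E /cmean.
have [<-|ik] := eqVneq i k; first by rewrite !mulr1n; field; rewrite Vn.
by rewrite mulr1n !mulr0n; field; rewrite Vn.
Qed.

Lemma gas_system_of_moments (rho : R -> V -> R) (u : R -> V -> V)
    (S : 'I_n -> R -> V -> R) :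
  (forall t x, 0 < t -> rho t x = mass t x) ->
  (forall t x i, 0 < t -> rho t x * u t x ord0 i = momentum i t x) ->
  (forall t x i, 0 < t -> S i t x = \sum_k wgauss (stress (u t x) i k t) (var t) t x) ->
  gas_system s1 rho u S.
Proof.
move=> Hrho Hmom HS t x t0; have V0 := varX_gt0 s_neq0 t0.
have rhoE : rho t = mass t by apply/funext => y; exact: Hrho.
have momE i : (fun y => rho t y * u t y ord0 i) = momentum i t.
  by apply/funext => y; exact: Hmom.
have near_rho : \forall s \near t, mass s x = rho s x.
  by near=> s; rewrite Hrho//; near: s; exact: lt_nbhsr.
have near_mom i : \forall s \near t, momentum i s x = rho s x * u s x ord0 i.
  by near=> s; rewrite Hmom//; near: s; exact: lt_nbhsr.
have D_mass k : (fun y => 'D_(ek k) (mass t) y) =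
    wgauss (fun y r => - (r ord0 k / var t)) (var t) t.
  by apply/funext => y; have [_ ->] := is_derive_mass_x y k t0.
have D_mom i k : (fun y => 'D_(ek k) (momentum i t) y) =
    wgauss (fun y r => sl t * (i == k)%:R - r ord0 k / var t * cmean t y r i)
      (var t) t.
  by apply/funext => y; have [_ ->] := is_derive_momentum_x y i k t0.
split.
  have [dt1 dt2] := near_eq_is_derive near_rho (is_derive_mass_t x t0).
  have fluxE k : (fun y => (rho t y *: u t y) ord0 k) = momentum k t.
    by rewrite -momE; apply/funext => y; rewrite mxE.
  split.
  - exact: dt1.
  - by move=> k; rewrite fluxE; case: (is_derive_momentum_x x k k t0).
  - by move=> k y; rewrite rhoE; case: (is_derive_mass_x y k t0).
  - by move=> k; rewrite rhoE D_mass; case: (is_derive_mass_xx x k t0).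
  rewrite subr0 dt2.
  under eq_bigr do rewrite fluxE.
  under [in RHS]eq_bigr do rewrite rhoE D_mass.
  have -> : \sum_k 'D_(ek k) (momentum k t) x = \sum_k wgauss (fun y r =>
      sl t * (k == k)%:R - r ord0 k / var t * cmean t y r k) (var t) t x.
    by apply: eq_bigr => k _; case: (is_derive_momentum_x x k k t0).
  rewrite mass_balance//; congr (_ * _); apply: eq_bigr => k _.
  by case: (is_derive_mass_xx x k t0) => _ ->.
move=> i.
have [dt1 dt2] := near_eq_is_derive (near_mom i) (is_derive_momentum_t x i t0).
have fluxE k : (fun y => ((rho t y * u t y ord0 i) *: u t y) ord0 k) =
    (fun y => momentum i t y * u t y ord0 k).
  by apply/funext => y; rewrite mxE Hmom.
have dF k : is_derive x (ek k) (fun y => momentum i t y * u t y ord0 k)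
   (u t x ord0 k * wgauss (fun y r => sl t * (i == k)%:R
                 - r ord0 k / var t * cmean t y r i) (var t) t x +
    u t x ord0 i * wgauss (fun y r => sl t * (k == k)%:R
                 - r ord0 k / var t * cmean t y r k) (var t) t x -
    u t x ord0 i * u t x ord0 k * wgauss (fun y r => - (r ord0 k / var t)) (var t) t x).
  have [pos|zero] := wgauss_gt0_or.
    (* Away from the vacuum, the flux is a quotient of differentiable moments. *)
    have m0 y : mass t y != 0 by rewrite gt_eqF// pos.
    have uE j y : u t y ord0 j = momentum j t y / mass t y.
      by rewrite -Hmom// Hrho// mulrAC divff ?mul1r.
    have -> : (fun y => momentum i t y * u t y ord0 k) =
        (fun y => momentum i t y * (momentum k t y * (mass t y)^-1)).
      by apply/funext => y; rewrite uE.
    have d1 := is_derive_momentum_x x i k t0.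
    have d2 := is_derive_momentum_x x k k t0.
    have d3 := is_derive_mass_x x k t0.
    have d4 := is_derive_inv (m0 x) d3.
    apply: is_derive_eq; rewrite -![_ *: _]/(_ * _) !uE.
    by field; rewrite m0.
  have aP (j l : 'I_n) : adm (fun y r => sl t * (j == l)%:R - r ord0 l / var t * cmean t y r j).
    by apply: admB => //; apply: admM => //; apply: admM.
  have aN l : adm (fun (y r : V) => - (r ord0 l / var t)).
    by apply: admN; apply: admM.
  rewrite !zero// !mulr0 subr0 addr0.
  have -> : (fun y => momentum i t y * u t y ord0 k) = cst 0.
    by apply/funext => y; rewrite /momentum zero// mul0r.
  exact: is_derive_cst.
split.
- exact: dt1.
- by move=> k; rewrite fluxE; case: (dF k).
- by move=> k y; rewrite momE; case: (is_derive_momentum_x y i k t0).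
- by move=> k; rewrite momE D_mom; case: (is_derive_momentum_xx x i k t0).
rewrite dt2 HS//.
under eq_bigr do rewrite fluxE.
under [in RHS]eq_bigr do rewrite momE D_mom.
under eq_bigr => k _ do have [_ ->] := dF k.
rewrite momentum_balance//; congr (_ * _ - _); apply: eq_bigr => k _.
by case: (is_derive_momentum_xx x i k t0) => _ ->.
Unshelve. all: end_near. Qed.

(** At a point of vacuum the momentum vanishes as well, so that no value given
    there to the velocity contradicts it. *)
Lemma momentum_of_mass t x i : 0 < t -> mass t x = 0 -> momentum i t x = 0.
Proof.
move=> t0; have V0 := varX_gt0 s_neq0 t0.
have [H|H] := wgauss_gt0_or.
  by move=> /eqP; rewrite gt_eqF//; exact: H.
by move=> _; apply: H.
Qed.

End weighted_moments.

(** * Velocity moments of a density *)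

Section gaussian_moments.
Context (R : realType) (n : nat).
Local Notation V := 'rV[R]_n.
Local Notation leb := (lebesgue_rV R n).
Local Notation ek := (basis_vec R).
Variable s : R.
Hypothesis s0 : 0 < s.

Let v0 : V -> V := fun=> 0.

Let mv0 (k : 'I_n) : measurable_fun [set: V] (fun y => v0 y ord0 k).
Proof. by []. Qed.

Let v0C (y : V) k : `|v0 y ord0 k| <= 0 :> R.
Proof. by rewrite mxE normr0. Qed.

Let m1 : measurable_fun [set: V] (fun=> 1 : R). Proof. by []. Qed.

Let C1 (y : V) : `|1 : R| <= 1. Proof. by rewrite normr1. Qed.

(** The mean of [psi] under the Gaussian law of covariance [s] in the variable
    [a - u]; it is constant in [a], which is kept as a variable in order to
    differentiate in it. *)
Definition gmean (psi : V -> R) (a : V) : R :=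
  wgauss (fun=> 0) (fun=> 1) (fun _ => psi) s 0 a.

(** The case of [adm] for the mean above, where nothing is transported. *)
Definition padm (psi : V -> R) : Prop := adm (fun=> 0 : V) (fun _ => psi).

Lemma gmeanE psi a : gmean psi a = \int[leb]_u (psi (a - u) * gaussn s (a - u)).
Proof.
rewrite /gmean /wgauss /tgauss; apply: eq_Rintegral => u _.
by rewrite mul1r /resid scale0r subr0.
Qed.

Lemma integrable_gmean psi a : padm psi ->
  leb.-integrable [set: V] (EFin \o (fun u => psi (a - u) * gaussn s (a - u))).
Proof.
move=> pp; rewrite (_ : (fun u => _) = (fun u =>
    psi (resid (fun=> 0) 0 a u) * gaussn s (resid (fun=> 0) 0 a u))).
  exact: (integrable_tgauss mv0 v0C (lexx 0) 0 a pp s0).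
by apply/funext => u; rewrite /resid scale0r subr0.
Qed.

Lemma padm_cst c : padm (fun=> c). Proof. exact: adm_cst. Qed.
Lemma padm_coor k : padm (fun r => r ord0 k). Proof. exact: (adm_coor mv0). Qed.
Lemma padmM p q : padm p -> padm q -> padm (fun r => p r * q r).
Proof. exact: admM. Qed.
Lemma padmD p q : padm p -> padm q -> padm (fun r => p r + q r).
Proof. exact: admD. Qed.

Lemma gmeanD p q a : padm p -> padm q ->
  gmean (fun r => p r + q r) a = gmean p a + gmean q a.
Proof. by move=> pp pq; exact: (wgaussD mv0 v0C (lexx 0) m1 C1). Qed.

Lemma gmeanZ c p a : padm p -> gmean (fun r => c * p r) a = c * gmean p a.
Proof. by move=> pp; exact: (wgaussZ mv0 v0C (lexx 0) m1 C1). Qed.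

Lemma gmean_cst c a : gmean (fun=> c) a = c.
Proof.
rewrite -[c]mulr1 gmeanZ; last exact: padm_cst.
congr (c * _); rewrite gmeanE /Rintegral.
by under eq_integral do rewrite mul1r; rewrite integral_gaussn.
Qed.

(** Differentiating in [a] an integral that does not depend on [a] gives the
    Gaussian integration by parts. *)
Lemma gmean_by_parts psi psi' k c a : padm psi -> padm psi' ->
  (forall r, is_derive r (ek k) psi (psi' r)) -> (forall b, gmean psi b = c) ->
  gmean (fun r => r ord0 k * psi r) a = s * gmean psi' a.
Proof.
move=> ap ap' dpsi psic.
have := is_derive_wgauss_x mv0 v0C (lexx 0) m1 C1 0 a s0 ap ap' (fun=> dpsi).
rewrite -[wgauss _ _ _ _ _]/(gmean psi) (funext psic : gmean psi = cst c).
move=> [_]; rewrite derive_cst.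
rewrite -[wgauss _ _ _ _ _ _]/(gmean (fun r => psi' r - inner r (ek k) / s * psi r) a).
rewrite (_ : (fun r => _) = (fun r => psi' r + (- s^-1) * (r ord0 k * psi r))); last first.
  by apply/funext => r; rewrite inner_basis; ring.
have pk := padm_coor k.
rewrite gmeanD//; last by apply: padmM; [exact: padm_cst|exact: padmM].
rewrite gmeanZ; last exact: padmM.
by move=> /esym/eqP; rewrite mulNr subr_eq0 => /eqP ->; rewrite mulVKf// gt_eqF.
Qed.

Let is_derive_coor_delta (r : V) i k : is_derive r (ek k) (fun r : V => r ord0 i) (i == k)%:R.
Proof. by have := is_derive_coor r (ek k) i; rewrite basis_coor. Qed.

Lemma gmean_coor k a : gmean (fun r => r ord0 k) a = 0.
Proof.
have := @gmean_by_parts (fun=> 1) (fun=> 0) k 1 a (padm_cst 1) (padm_cst 0)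
  (fun r => is_derive_cst _ _ _) (gmean_cst 1).
by rewrite gmean_cst mulr0; under [X in gmean X]eq_fun do rewrite mulr1.
Qed.

Lemma gmean_coor2 k i a : gmean (fun r => r ord0 k * r ord0 i) a = (i == k)%:R * s.
Proof.
have -> := @gmean_by_parts (fun r => r ord0 i) (fun=> (i == k)%:R) k 0 a (padm_coor i)
  (padm_cst _) (fun r => is_derive_coor_delta r i k) (gmean_coor i).
by rewrite gmean_cst mulrC.
Qed.

Lemma gmean_coor3 k i a :
  gmean (fun r => r ord0 k * (r ord0 k * r ord0 i)) a = 0.
Proof.
have pp : padm (fun r => r ord0 k * r ord0 i) by apply: padmM; exact: padm_coor.
have pk : padm (fun r => (i == k)%:R * r ord0 k).
  by apply: padmM; [exact: padm_cst|exact: padm_coor].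
have pp' : padm (fun r => r ord0 i + (i == k)%:R * r ord0 k).
  by apply: padmD => //; exact: padm_coor.
have d (r : V) : is_derive r (ek k) (fun r : V => r ord0 k * r ord0 i)
    (r ord0 i + (i == k)%:R * r ord0 k).
  have dk := is_derive_coor_delta r k k; have di := is_derive_coor_delta r i k.
  rewrite eqxx in dk.
  apply: is_derive_eq; rewrite -![_ *: _]/(_ * _).
  by rewrite mulr1 addrC mulrC.
have -> := @gmean_by_parts _ _ k ((i == k)%:R * s) a pp pp' d (gmean_coor2 k i).
rewrite gmeanD//; last exact: padm_coor.
by rewrite gmeanZ ?gmean_coor ?mulr0 ?addr0 ?mulr0//; exact: padm_coor.
Qed.

(** The average which defines [stress], with [r] the mean minus the velocity: expand
    the product and integrate by parts. *)
Lemma gmean_stress i k (Ai Ak b e : R) a :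
  gmean (fun r => (Ai - r ord0 i) * (Ak - r ord0 k) * (- (b * r ord0 k) - e)) a =
  - e * (Ai * Ak + (i == k)%:R * s) + b * s * (Ai + (i == k)%:R * Ak).
Proof.
have pk := padm_coor k; have pj := padm_coor i; have pc := padm_cst.
have pki : padm (fun r => r ord0 k * r ord0 i) by exact: padmM.
have pkk : padm (fun r => r ord0 k * r ord0 k) by exact: padmM.
have pkki : padm (fun r => r ord0 k * (r ord0 k * r ord0 i)) by exact: padmM.
rewrite (_ : (fun r => _) = (fun r : V => - e * Ai * Ak + ((e * Ai - b * Ai * Ak) * r ord0 k +
   (e * Ak * r ord0 i + ((b * Ak - e) * (r ord0 k * r ord0 i) +
   (b * Ai * (r ord0 k * r ord0 k) + (- b) * (r ord0 k * (r ord0 k * r ord0 i)))))))).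
  have pZ c p : padm p -> padm (fun r => c * p r) by move=> pp; apply: padmM.
  rewrite gmeanD ?gmean_cst//; last by do ?[apply: padmD; first exact: pZ]; exact: pZ.
  rewrite gmeanD; [|exact: pZ|by do ?[apply: padmD; first exact: pZ]; exact: pZ].
  rewrite gmeanD; [|exact: pZ|by do ?[apply: padmD; first exact: pZ]; exact: pZ].
  rewrite gmeanD; [|exact: pZ|by do ?[apply: padmD; first exact: pZ]; exact: pZ].
  rewrite gmeanD; [|exact: pZ|exact: pZ].
  rewrite !gmeanZ// !gmean_coor gmean_coor3 !gmean_coor2 eqxx/=; ring.
by apply/funext => r; ring.
Qed.

End gaussian_moments.

Section mixture.
Context (R : realType) (n : nat).
Local Notation V := 'rV[R]_n.
Local Notation leb := (lebesgue_rV R n).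
Variables (v : V -> V) (C0 : R).
Hypothesis mv : forall k, measurable_fun [set: V] (fun y => v y ord0 k).
Hypothesis vC : forall y k, `|v y ord0 k| <= C0.
Hypothesis C00 : 0 <= C0.
Variables (w : V -> R) (Cw : R).
Hypothesis mw : measurable_fun [set: V] w.
Hypothesis wC : forall y, `|w y| <= Cw.
Variables (c q s t : R).
Hypotheses (q0 : 0 < q) (s0 : 0 < s).

Local Notation adm := (adm v).
Local Notation resid := (resid v).

(** The centre of the conditional law of the velocity. *)
Definition centre (y r : V) : V := v y + c *: r.

(** The average over the starting point and the position noise of a factor times
    the conditional density of the velocity [u]. The density of the joint law is the
    mixture of the constant [1]; its moments and derivatives bring in factors that
    are polynomial in the residual and in the deviation [centre y r - u]. *)
Definition mixture (p : V -> V -> V -> R) (x u : V) : R :=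
  wgauss v w (fun y r => p y r (centre y r - u) * gaussn q (centre y r - u)) s t x.

(** The analogue of [adm] for factors that depend also on the deviation [z]. *)
Definition jadm (p : V -> V -> V -> R) : Prop :=
  (exists A m, forall y r z, `|p y r z| <= A * (1 + sqn r) ^+ m * (1 + sqn z) ^+ m) /\
  forall t x, measurable_fun [set: V * V] (fun z => p z.1 (resid t x z.1) z.2).

Lemma jadmM p1 p2 : jadm p1 -> jadm p2 -> jadm (fun y r z => p1 y r z * p2 y r z).
Proof.
move=> [[A1 [m1 h1]] M1] [[A2 [m2 h2]] M2]; split; last first.
  by move=> t' x; exact: measurable_funM.
exists (A1 * A2), (m1 + m2)%N => y r z; rewrite normrM !exprD.
apply: le_trans (ler_pM _ _ (h1 y r z) (h2 y r z)) _ => //.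
by rewrite le_eqVlt; apply/orP; left; apply/eqP; ring.
Qed.

Lemma jadmD p1 p2 : jadm p1 -> jadm p2 -> jadm (fun y r z => p1 y r z + p2 y r z).
Proof.
move=> [[A1 [m1 h1]] M1] [[A2 [m2 h2]] M2]; split; last first.
  by move=> t' x; exact: measurable_funD.
have up (A : R) m m' (r z : V) : (m <= m')%N ->
    A * (1 + sqn r) ^+ m * (1 + sqn z) ^+ m <=
    `|A| * (1 + sqn r) ^+ m' * (1 + sqn z) ^+ m'.
  move=> mm'; have e1 (a : V) : 1 <= 1 + sqn a by rewrite lerDl sqn_ge0.
  have e0 (a : V) k : 0 <= (1 + sqn a) ^+ k by rewrite exprn_ge0// addr_ge0// sqn_ge0.
  rewrite -!mulrA; apply: le_trans (_ : `|A| * ((1 + sqn r) ^+ m * (1 + sqn z) ^+ m) <= _).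
    by rewrite ler_wpM2r ?mulr_ge0// ler_norm.
  by rewrite ler_wpM2l// ler_pM ?ler_weXn2l.
exists (`|A1| + `|A2|), (maxn m1 m2) => y r z; rewrite (le_trans (ler_normD _ _))//.
rewrite !mulrDl lerD//.
  by rewrite (le_trans (h1 y r z))// up// leq_maxl.
by rewrite (le_trans (h2 y r z))// up// leq_maxr.
Qed.

Lemma jadm_lift p : adm p -> jadm (fun y r _ => p y r).
Proof.
move=> [[A [m h]] M]; split; last first.
  by move=> t' x; exact: (measurableT_comp (M t' x) measurable_fst).
exists `|A|, m => y r z; apply: le_trans (h y r) _.
have e0 (a : V) k : 0 <= (1 + sqn a) ^+ k by rewrite exprn_ge0// addr_ge0// sqn_ge0.
rewrite -[leLHS]mulr1 ler_pM//.
  by rewrite (le_trans (normr_ge0 _) (h y r)).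
  by rewrite ler_wpM2r// ler_norm.
by rewrite exprn_ege1// lerDl sqn_ge0.
Qed.

Lemma jadm_coor k : jadm (fun _ _ z => z ord0 k).
Proof.
split; last by move=> t' x; exact: (measurableT_comp (measurable_coor k) measurable_snd).
exists 1, 1%N => y r z; rewrite !expr1 mul1r (le_trans (coor_le_sqn z k))//.
by rewrite ler_peMl ?addr_ge0 ?sqn_ge0// lerDl sqn_ge0.
Qed.

Lemma poly_gauss_bound m : exists2 K, 0 <= K & forall z : V,
  (1 + sqn z) ^+ m * gaussn q z <= K * gaussn (4 * q) z.
Proof.
have [K K0 HK] := gaussn_envelope n m q0 (lexx q) (lexx 0).
exists K => // z; have := HK q (- z) 0; rewrite sub0r opprK gaussnN.
by apply; [rewrite !lexx|move=> k; rewrite mxE normr0].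
Qed.

Lemma gaussn_bounded (a : R) : 0 < a -> exists C, forall z : V, gaussn a z <= C.
Proof.
move=> a0; exists ((Num.sqrt (a * pi *+ 2))^-1 ^+ n) => z.
rewrite -[X in _ ^+ X]card_ord -prodr_const /gaussn; apply: ler_prod => k _.
by rewrite gauss_ge0/= gauss_le_peak.
Qed.

Lemma measurable_centre t' x : measurable_fun [set: V] (fun y => centre y (resid t' x y)).
Proof.
apply: measurable_fun_rV => k.
rewrite (_ : (fun y => _) = (fun y => v y ord0 k + c * resid t' x y ord0 k)).
  apply: measurable_funD => //; apply: measurable_funM => //.
  exact: (measurableT_comp (measurable_coor k) (measurable_resid mv t' x)).
by apply/funext => y; rewrite mxE [X in _ + X]mxE.
Qed.

Let measurable_subl d (T : measurableType d) (f g : T -> V) :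
  measurable_fun [set: T] f -> measurable_fun [set: T] g ->
  measurable_fun [set: T] (fun a => f a - g a).
Proof.
move=> mf mg; apply: measurable_fun_rV => k.
rewrite (_ : (fun a => _) = (fun a => f a ord0 k - g a ord0 k)).
  by apply: measurable_funB; apply: (measurableT_comp (measurable_coor k)).
by apply/funext => a; rewrite mxE [X in _ + X]mxE.
Qed.

Lemma jadm_padm p y r : jadm p -> padm (p y r).
Proof.
move=> [[A [m h]] M]; split.
  exists (A * (1 + sqn r) ^+ m), m => _ z; exact: h.
move=> t' x.
have mz : measurable_fun [set: V] (fun z => p y r z).
  have E : resid 0 (r + y) y = r by apply/rowP => j; rewrite !mxE; ring.
  have := measurableT_comp (M 0 (r + y)) (pair1_measurable y).
  by apply: eq_measurable_fun => z _; rewrite /= E.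
by apply: (measurableT_comp mz); apply: measurable_resid => k.
Qed.

Lemma adm_slice p u : jadm p ->
  adm (fun y r => p y r (centre y r - u) * gaussn q (centre y r - u)).
Proof.
move=> [[A [m h]] M]; split.
  have [K K0 HK] := poly_gauss_bound m.
  have [C HC] := gaussn_bounded (mulr_gt0 (ltr0n R 4) q0).
  exists (`|A| * (K * C)), m => y r; set z := centre y r - u.
  rewrite normrM (ger0_norm (gaussn_ge0 _ _)).
  have e0 (a : V) : 0 <= (1 + sqn a) ^+ m by rewrite exprn_ge0// addr_ge0// sqn_ge0.
  apply: le_trans (_ : `|A| * (1 + sqn r) ^+ m * ((1 + sqn z) ^+ m * gaussn q z) <= _).
    rewrite mulrA ler_wpM2r ?gaussn_ge0// (le_trans (h y r z))// !ler_wpM2r//.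
    exact: ler_norm.
  rewrite mulrAC ler_wpM2r// ler_wpM2l//.
  by rewrite (le_trans (HK z))// ler_wpM2l.
move=> t' x.
have mz : measurable_fun [set: V] (fun y => centre y (resid t' x y) - u).
  by apply: measurable_subl => //; exact: measurable_centre.
apply: measurable_funM; last exact: (measurableT_comp (measurable_gaussn _) mz).
apply: (measurableT_comp (M t' x) (g := fun y => (y, centre y (resid t' x y) - u))).
by apply/measurable_fun_pairP; split => //; exact: measurable_id.
Qed.

Lemma mixtureZ b p x u : jadm p ->
  mixture (fun y r z => b * p y r z) x u = b * mixture p x u.
Proof.
move=> j1; rewrite /mixture -(wgaussZ mv vC C00 mw wC)//; try exact: adm_slice.
by apply: wgauss_ext => y r; rewrite mulrA.
Qed.

(** At a given velocity [u], a factor of [u] may be written in terms of the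
    variable of the mixture. *)
Lemma mixture_ext p1 p2 x u :
  (forall y r, p1 y r (centre y r - u) = p2 y r (centre y r - u)) ->
  mixture p1 x u = mixture p2 x u.
Proof. by move=> p12; apply: wgauss_ext => y r; rewrite p12. Qed.

(** By Fubini's theorem, integrating in the velocity replaces the factor by its
    Gaussian mean. *)
Lemma mixture_integral p Ep x : jadm p ->
  (forall y r, gmean q (p y r) (centre y r) = Ep y r) ->
  leb.-integrable [set: V] (fun u => (mixture p x u)%:E) /\
  \int[leb]_u mixture p x u = wgauss v w Ep s t x.
Proof.
move=> jp EpE; have [[A [m h]] M] := jp.
pose z (y u : V) := centre y (resid t x y) - u.
pose H (a : V * V) := w a.2 * (p a.2 (resid t x a.2) (z a.2 a.1) * gaussn q (z a.2 a.1))
  * gaussn s (resid t x a.2).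
have mz : measurable_fun [set: V * V] (fun a => z a.2 a.1).
  apply: measurable_subl; last exact: measurable_fst.
  exact: (measurableT_comp (measurable_centre t x) measurable_snd).
have mH : measurable_fun [set: V * V] H.
  apply: measurable_funM; last first.
    apply: (measurableT_comp (measurable_gaussn _)).
    exact: (measurableT_comp (measurable_resid mv t x) measurable_snd).
  apply: measurable_funM; first exact: (measurableT_comp mw measurable_snd).
  apply: measurable_funM; last exact: (measurableT_comp (measurable_gaussn _) mz).
  apply: (measurableT_comp (M t x) (g := fun a => (a.2, z a.2 a.1))).
  by apply/measurable_fun_pairP; split => //; exact: measurable_snd.
have [K K0 HK] := poly_gauss_bound m.
have e0 (a : V) : 0 <= (1 + sqn a) ^+ m by rewrite exprn_ge0// addr_ge0// sqn_ge0.
pose Q (y r : V) := `|Cw| * `|A| * K * (1 + sqn r) ^+ m.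
have aQ : adm Q.
  split.
    exists (`|Cw| * `|A| * K), m => y r; rewrite ger0_norm// mulr_ge0// mulr_ge0//.
  move=> t' x'; apply: measurable_funM => //; apply: measurable_funX.
  apply: measurable_funD => //; have [_] := adm_sqn mv; exact.
pose G y := Q y (resid t x y) * gaussn s (resid t x y).
have iG : leb.-integrable [set: V] (EFin \o G) := integrable_tgauss mv vC C00 t x aQ s0.
have G0 y : 0 <= G y by rewrite mulr_ge0 ?gaussn_ge0// !mulr_ge0.
have HG u y : `|H (u, y)| <= G y * gaussn (4 * q) (z y u).
  rewrite /H /G /Q /= !normrM !(ger0_norm (gaussn_ge0 _ _)) -!mulrA.
  rewrite ler_pM ?mulr_ge0 ?gaussn_ge0//; first by rewrite (le_trans (wC y))// ler_norm.
  set r := resid t x y; set g := gaussn s r.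
  apply: le_trans (_ : (`|A| * (1 + sqn r) ^+ m * ((1 + sqn (z y u)) ^+ m * gaussn q (z y u))) * g <= _).
    rewrite mulrA ler_wpM2r ?gaussn_ge0// mulrA ler_wpM2r ?gaussn_ge0//.
    by rewrite (le_trans (h y r (z y u)))// !ler_wpM2r// ler_norm.
  rewrite [leRHS](_ : _ = `|A| * (1 + sqn r) ^+ m * (K * gaussn (4 * q) (z y u)) * g); last by ring.
  by rewrite ler_wpM2r ?gaussn_ge0// ler_wpM2l ?mulr_ge0.
have iH : (leb \x leb)%E.-integrable [set: V * V] (EFin \o H).
  apply/integrable21ltyP; first exact/measurable_EFinP.
  apply: (@le_lt_trans _ _ (\int[leb]_y (G y)%:E)%E); last by rewrite RintegralE// ltry.
  apply: ge0_le_integral => //.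
  - by move=> y _; apply: integral_ge0.
  - apply: (@measurable_fun_fubini_tonelli_G _ _ _ _ _ leb (fun a : V * V => `|H a|%:E)) => //.
    by apply/measurable_EFinP/measurableT_comp.
  - by case/integrableP : iG.
  move=> y _; rewrite -[leRHS]mule1.
  rewrite -(@integral_gaussn R n (4 * q) (centre y (resid t x y))); last by rewrite mulr_gt0.
  rewrite -ge0_integralZl_EFin//; last 2 first.
  - by move=> u _; rewrite lee_fin gaussn_ge0.
  - by apply/measurable_EFinP; exact: measurable_gaussn_shift.
  apply: ge0_le_integral => //.
  - apply/measurable_EFinP/measurableT_comp => //.
    exact: (measurableT_comp mH (pair2_measurable y)).
  - apply: emeasurable_funM => //.
    by apply/measurable_EFinP; exact: measurable_gaussn_shift.
  by move=> u _; rewrite -EFinM lee_fin; exact: HG.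
have iF := integrable_fubini_F iH.
have mixE u : fubini_F leb (EFin \o H) u = (mixture p x u)%:E.
  rewrite /fubini_F /mixture /wgauss /tgauss -RintegralE//.
  exact: (integrable_wgauss mv vC C00 mw wC t x (adm_slice u jp) s0).
split.
  by rewrite -(funext mixE).
rewrite /Rintegral -(eq_integral _ _ (fun u _ => mixE u)).
rewrite -[LHS]/(fine (\int[leb]_u \int[leb]_y (EFin \o H) (u, y))%E) (Fubini iH).
congr fine; apply: eq_integral => y _ /=.
set r := resid t x y.
have ip : leb.-integrable [set: V]
    (EFin \o (fun u => p y r (centre y r - u) * gaussn q (centre y r - u))).
  exact: (integrable_gmean q0 (centre y r) (jadm_padm y r jp)).
rewrite (_ : (fun u : V => _) = (fun u => (w y * gaussn s r *
   (p y r (centre y r - u) * gaussn q (centre y r - u)))%:E)); last first.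
  by apply/funext => u; congr EFin; rewrite /H /z /= -/r; ring.
rewrite RintegralE//; last exact: integrableRZ.
by rewrite RintegralZl// -gmeanE EpE mulrAC.
Qed.

(** The residual appears both in the centre and in the Gaussian factor of the
    position, whence the two terms. *)
Lemma is_derive_mixture x u k : is_derive x (basis_vec R k)
  (fun x => mixture (fun _ _ _ => 1) x u)
  (mixture (fun _ r z => - (c / q * z ord0 k) - r ord0 k / s) x u).
Proof.
have j1 : jadm (fun _ _ _ => 1) by exact: (jadm_lift (adm_cst v 1)).
have jk : jadm (fun _ _ z => - (c / q) * z ord0 k).
  by apply: jadmM; [exact: (jadm_lift (adm_cst v _))|exact: jadm_coor].
have d y r : is_derive r (basis_vec R k) (fun r => 1 * gaussn q (centre y r - u))
    (- (c / q) * (centre y r - u) ord0 k * gaussn q (centre y r - u)).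
  apply: is_derive_line0.
  have := is_derive_gaussn (centre y r - u) (c *: basis_vec R k) q0.
  have -> : inner (centre y r - u) (c *: basis_vec R k) = c * (centre y r - u) ord0 k.
    rewrite -inner_basis /inner mulr_sumr; apply: eq_bigr => i _.
    by rewrite [X in _ * X]mxE mulrCA.
  rewrite -[X in is_derive X](add0r) -[X in is_derive (X + _)](scale0r (c *: basis_vec R k)).
  move/is_derive_line => H.
  rewrite (_ : (fun h : R => _) =
     (fun h : R => gaussn q (h *: (c *: basis_vec R k) + (centre y r - u)))).
    by apply: is_derive_eq; ring.
  apply/funext => h; rewrite mul1r; congr gaussn; apply/rowP => i.
  by rewrite !mxE; ring.
have := is_derive_wgauss_x mv vC C00 mw wC t x s0 (adm_slice u j1) (adm_slice u jk) d.
move=> H; apply: is_derive_eq; apply: wgauss_ext => y r.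
by rewrite inner_basis; ring.
Qed.

End mixture.

Section density_case.
Context (R : realType) (n : nat).
Local Notation V := 'rV[R]_n.
Local Notation leb := (lebesgue_rV R n).
Variables (v : V -> V) (C0 : R).
Hypothesis mv : forall k, measurable_fun [set: V] (fun y => v y ord0 k).
Hypothesis vC : forall y k, `|v y ord0 k| <= C0.
Hypothesis C00 : 0 <= C0.
Variables (w : V -> R) (Cw : R).
Hypothesis mw : measurable_fun [set: V] w.
Hypothesis wC : forall y, `|w y| <= Cw.
Hypothesis w0 : forall y, 0 <= w y.
Variables (s1 s2 : R).
Hypothesis s_neq0 : (s1, s2) != (0, 0).
Hypothesis s20 : s2 != 0.
Variable P : R -> V -> V -> R.
Hypothesis PE : forall t x u, 0 < t -> P t x u = tgauss v (fun y r => w y *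
  gaussn (resvar s1 s2 t) (u - v y - slope s1 s2 t *: r)) (varX s1 s2 t) t x.

Local Notation jadm := (jadm v).

Section fixed_time.
Variable t : R.
Hypothesis t0 : 0 < t.
Local Notation c := (slope s1 s2 t).
Local Notation q := (resvar s1 s2 t).
Local Notation s := (varX s1 s2 t).
Let q0 : 0 < q := resvar_gt0 s_neq0 t0 s20.
Let sgt0 : 0 < s := varX_gt0 s_neq0 t0.
Local Notation mixture := (mixture v w c q s t).

Let jcst b : jadm (fun _ _ _ => b). Proof. exact: (jadm_lift (adm_cst v _)). Qed.
Let jZ b p : jadm p -> jadm (fun y r z => b * p y r z).
Proof. by move=> jp; apply: jadmM. Qed.
Let jcoor k : jadm (fun _ _ z => z ord0 k). Proof. exact: jadm_coor. Qed.
Let jr k : jadm (fun _ r _ => r ord0 k).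
Proof. exact: (jadm_lift (adm_coor mv k)). Qed.
Let jmean i : jadm (fun y r z => cmean v s1 s2 t y r i - z ord0 i).
Proof.
apply: jadmD; last by under eq_fun3 do rewrite -mulN1r; exact: jZ.
apply: jadmD; first exact: (jadm_lift (adm_v mv vC i)).
exact: jZ.
Qed.

Let jgrad k : jadm (fun _ r z => - (c / q * z ord0 k) - r ord0 k / s).
Proof.
rewrite [X in jadm X](_ : _ =
  (fun _ r z : V => - (c / q) * z ord0 k + - s^-1 * r ord0 k)); last first.
  by apply/funext => y; apply/funext => r; apply/funext => z; ring.
by apply: jadmD; exact: jZ.
Qed.

Let P_mixture x u : P t x u = mixture (fun _ _ _ => 1) x u.
Proof.
rewrite PE//; apply: eq_Rintegral => y _; congr (w y * _ * _).
by rewrite mul1r -gaussnN; congr gaussn; apply/rowP => i; rewrite !mxE; ring.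
Qed.

Let centre_coor y r (u : V) i :
  cmean v s1 s2 t y r i - (centre v c y r - u) ord0 i = u ord0 i.
Proof. by rewrite /cmean !mxE; ring. Qed.

Let mulu_mixture x (u : V) i p : jadm p -> u ord0 i * mixture p x u =
  mixture (fun y r z => (cmean v s1 s2 t y r i - z ord0 i) * p y r z) x u.
Proof.
move=> jp; rewrite -(mixtureZ mv vC C00 mw wC)//.
by apply: mixture_ext => y r; rewrite centre_coor.
Qed.

Lemma density_mass x : leb.-integrable [set: V] (fun u => (P t x u)%:E) /\
  \int[leb]_u P t x u = mass v w s1 s2 t x.
Proof.
rewrite (funext (P_mixture x)).
apply: (mixture_integral mv vC C00 mw wC) => // y r.
exact: gmean_cst.
Qed.

Lemma density_momentum x i :
  leb.-integrable [set: V] (fun u => (u ord0 i * P t x u)%:E) /\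
  \int[leb]_u (u ord0 i * P t x u) = momentum v w s1 s2 i t x.
Proof.
rewrite (_ : (fun u : V => u ord0 i * P t x u) = mixture (fun y r z =>
    (cmean v s1 s2 t y r i - z ord0 i) * 1) x); last first.
  by apply/funext => u; rewrite P_mixture mulu_mixture.
rewrite (_ : (fun u : V => (u ord0 i * P t x u)%:E) = (fun u => (mixture (fun y r z =>
    (cmean v s1 s2 t y r i - z ord0 i) * 1) x u)%:E)); last first.
  by apply/funext => u; rewrite P_mixture mulu_mixture.
apply: (mixture_integral mv vC C00 mw wC) => // [|y r].
  exact: jadmM.
rewrite (_ : (fun z : V => _) = (fun z => cmean v s1 s2 t y r i + (-1) * z ord0 i)); last first.
  by apply/funext => z; ring.
rewrite gmeanD//; last 2 first.
- exact: padm_cst.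
- by apply: padmM; [exact: padm_cst|exact: padm_coor].
by rewrite gmean_cst// gmeanZ ?gmean_coor ?mulr0 ?addr0//; exact: padm_coor.
Qed.

Lemma rho_mass x : rho_dens P t x = mass v w s1 s2 t x.
Proof. by case: (density_mass x). Qed.

Lemma rhou_momentum x i :
  rho_dens P t x * u_dens P t x ord0 i = momentum v w s1 s2 i t x.
Proof.
rewrite mxE (density_momentum x i).2 -/(rho_dens P t x) rho_mass.
have [m0|m0] := eqVneq (mass v w s1 s2 t x) 0.
  by rewrite m0 mul0r (momentum_of_mass mv vC C00 mw wC w0 s_neq0).
by rewrite mulrC divfK.
Qed.

Lemma is_derive_density x u k : is_derive x (basis_vec R k) (fun x => P t x u)
  (mixture (fun _ r z => - (c / q * z ord0 k) - r ord0 k / s) x u).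
Proof.
rewrite (funext (fun x => P_mixture x u)).
exact: (is_derive_mixture mv vC C00 mw wC).
Qed.

Definition stress_factor (ub : V) (i k : 'I_n) (y r z : V) : R :=
  (cmean v s1 s2 t y r i - ub ord0 i - z ord0 i) *
  (cmean v s1 s2 t y r k - ub ord0 k - z ord0 k) *
  (- (c / q * z ord0 k) - r ord0 k / s).

Lemma I_mixture i x u : I_integrand_dens P i t x u =
  \sum_k mixture (stress_factor (u_dens P t x) i k) x u.
Proof.
rewrite /I_integrand_dens /inner mulr_sumr; apply: eq_bigr => k _.
have [_ dP] := is_derive_density x u k.
rewrite [grad _ _ _ _]mxE dP mulrA -(mixtureZ mv vC C00 mw wC)//.
  apply: mixture_ext => y r; rewrite /stress_factor; congr (_ * _ * _).
    by rewrite -[in LHS](centre_coor y r u i) addrAC.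
  by rewrite mxE [X in _ + X]mxE -[in LHS](centre_coor y r u k) addrAC.
Qed.

Lemma stress_integral i k x ub :
  leb.-integrable [set: V] (fun u => (mixture (stress_factor ub i k) x u)%:E) /\
  \int[leb]_u mixture (stress_factor ub i k) x u =
  wgauss v w (stress v s1 s2 ub i k t) s t x.
Proof.
apply: (mixture_integral mv vC C00 mw wC) => // [|y r].
  rewrite /stress_factor; apply: jadmM (jgrad k).
  have jb j : jadm (fun y r z => cmean v s1 s2 t y r j - ub ord0 j - z ord0 j).
    rewrite [X in jadm X](_ : _ =
        (fun y r z : V => cmean v s1 s2 t y r j - z ord0 j + - ub ord0 j)); last first.
      by apply/funext => y'; apply/funext => r; apply/funext => z; ring.
    exact: jadmD.
  exact: jadmM.
rewrite gmean_stress//.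
rewrite /stress; field.
by rewrite !gt_eqF.
Qed.

End fixed_time.

Theorem gas_system_of_density :
  moments_exist_dens P /\ gas_system s1 (rho_dens P) (u_dens P) (I_dens P).
Proof.
split.
  move=> t x t0; split.
  - by case: (density_mass t0 x).
  - by move=> i; case: (density_momentum t0 x i).
  - by move=> k u; case: (is_derive_density t0 x u k).
  move=> i; under eq_fun do rewrite I_mixture//.
  by apply: integrableR_sum => // k; case: (stress_integral t0 i k x (u_dens P t x)).
apply: (gas_system_of_moments mv vC C00 mw wC w0 s_neq0) => t x.
- by move=> t0; exact: rho_mass.
- by move=> i t0; exact: rhou_momentum.
move=> i t0; rewrite /I_dens.
under eq_Rintegral do rewrite I_mixture//.
rewrite RintegralR_sum//; last by move=> k; case: (stress_integral t0 i k x (u_dens P t x)).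
by apply: eq_bigr => k _; case: (stress_integral t0 i k x (u_dens P t x)).
Qed.

End density_case.

(** * Velocity moments of a measure *)

Section image_density.
Context d (T : measurableType d) d' (T' : measurableType d') (R : realType).
Variables (mu : {measure set T -> \bar R}) (v : T -> T') (g : T -> R).
Hypotheses (mv : measurable_fun [set: T] v) (mg : measurable_fun [set: T] g).
Hypothesis g0 : forall y, 0 <= g y.

(** The image under [v] of the measure of density [g]. *)
Definition image_density : {measure set T' -> \bar R} :=
  measure_function_pushforward__canonical__measure_function_Measure
    (density_measure mu mg g0) mv.

Lemma image_densityE A :
  image_density A = (\int[mu]_(y in v @^-1` A) (g y)%:E)%E.
Proof. by []. Qed.

Variable Q : {measure set T' -> \bar R}.
Hypothesis QE : forall A, measurable A -> Q A = image_density A.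

Lemma ge0_integral_image (f : T' -> \bar R) :
  measurable_fun [set: T'] f -> (forall u, 0 <= f u)%E ->
  (\int[Q]_u f u = \int[mu]_y (f (v y) * (g y)%:E))%E.
Proof.
move=> mf f0; rewrite (eq_measure_integral image_density); last first.
  by move=> A mA _; exact: QE.
rewrite ge0_integral_pushforward// preimage_setT.
rewrite (@ge0_integral_density _ _ _ mu _ g)//.
  exact: measurableT_comp.
by move=> x; exact: f0.
Qed.

Lemma integral_image (f : T' -> R) : measurable_fun [set: T'] f ->
  mu.-integrable [set: T] (EFin \o (fun y => f (v y) * g y)) ->
  Q.-integrable [set: T'] (EFin \o f) /\
  \int[Q]_u f u = \int[mu]_y (f (v y) * g y).
Proof.
move=> mf /integrableP[_ ifg].
have mfE : measurable_fun [set: T'] (EFin \o f) by exact/measurable_EFinP.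
split.
  apply/integrableP; split => //.
  rewrite ge0_integral_image//; last exact: measurableT_comp.
  apply: le_lt_trans ifg; rewrite le_eqVlt; apply/orP; left; apply/eqP.
  by apply: eq_integral => y _; rewrite /= normrM (ger0_norm (g0 y)).
rewrite /Rintegral; congr fine; rewrite [LHS]integralE [RHS]integralE.
rewrite !ge0_integral_image//; [|exact: measurable_funeneg|exact: measurable_funepos].
by congr (_ - _)%E; apply: eq_integral => y _; rewrite /= ?funeposE ?funenegE /=
  -?EFinN -?EFin_max -?EFinM; congr EFin; rewrite maxr_pMl// ?mul0r ?mulNr.
Qed.

End image_density.

Section charge_difference.
Context d (T : measurableType d) (R : realType).
Variables (nu : {charge set T -> \bar R}) (Q1 Q2 : {measure set T -> \bar R}).
Hypothesis Q1_fin : forall A, measurable A -> Q1 A \is a fin_num.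
Hypothesis Q2_fin : forall A, measurable A -> Q2 A \is a fin_num.
Hypothesis nuE : forall A, measurable A -> nu A = (Q1 A - Q2 A)%E.

(** The Jordan decomposition is dominated by any other one, so that integrability
    passes to it; and since the difference of the two parts is the same, so is the
    difference of the integrals. *)
Lemma charge_integral_difference (f : T -> R) : measurable_fun [set: T] f ->
  Q1.-integrable [set: T] (EFin \o f) -> Q2.-integrable [set: T] (EFin \o f) ->
  charge_integrable nu f /\
  charge_integral nu f = \int[Q1]_u f u - \int[Q2]_u f u.
Proof.
move=> mf f1 f2; rewrite /charge_integrable /charge_integral.
set nuPN := projT2 _; move: (projT1 _) nuPN => [P N] /= nuPN.
have [[mP _] [mN _] _ _] := nuPN.
have le1 A : measurable A -> (jordan_pos nuPN A <= Q1 A)%E.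
  move=> mA; rewrite jordan_posE cjordan_posE /crestr0 mem_set// /crestr nuE; last exact: measurableI.
  have mAP : measurable (A `&` P) by exact: measurableI.
  rewrite leeBlDr ?Q2_fin// (@le_trans _ _ (Q1 A))//.
    by rewrite le_measure ?inE.
  by rewrite leeDl.
have le2 A : measurable A -> (jordan_neg nuPN A <= Q2 A)%E.
  move=> mA; rewrite jordan_negE cjordan_negE /crestr0 mem_set// /crestr nuE; last exact: measurableI.
  have mAN : measurable (A `&` N) by exact: measurableI.
  rewrite fin_num_oppeB ?Q2_fin//= addeC leeBlDr ?Q1_fin// (@le_trans _ _ (Q2 A))//.
    by rewrite le_measure ?inE.
  by rewrite leeDl.
have mfE : measurable_fun [set: T] (EFin \o f) by exact/measurable_EFinP.
have ile (m1 m2 : {measure set T -> \bar R}) :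
    (forall A, measurable A -> (m1 A <= m2 A)%E) ->
    m2.-integrable [set: T] (EFin \o f) -> m1.-integrable [set: T] (EFin \o f).
  move=> m12 /integrableP[_ i2]; apply/integrableP; split => //.
  apply: le_lt_trans i2; apply: ge0_le_measure_integral => //.
  exact: measurableT_comp.
have fp := ile _ _ le1 f1; have fn := ile _ _ le2 f2.
split; first by [].
have E : (\int[measure_add (jordan_pos nuPN) Q2]_u (f u)%:E =
          \int[measure_add (jordan_neg nuPN) Q1]_u (f u)%:E)%E.
  apply: eq_measure_integral => A mA _; rewrite /= /msum !big_ord_recl !big_ord0 !adde0 /=.
  have H := jordan_decomp nuPN mA; rewrite nuE// /cadd/= cscaleN1 in H.
  have swap (a b p m : \bar R) : a \is a fin_num -> b \is a fin_num ->
      p \is a fin_num -> m \is a fin_num -> (a - b = p - m)%E -> (p + b = m + a)%E.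
    move: a b p m => [a||] [b||] [p||] [m||]// _ _ _ _.
    by rewrite -!EFinB -!EFinD => -[E]; congr EFin; lra.
  exact: (swap _ _ _ _ (Q1_fin mA) (Q2_fin mA)
    (fin_num_measure (jordan_pos nuPN) A mA) (fin_num_measure (jordan_neg nuPN) A mA) H).
move: E; rewrite !integral_measure_add// !RintegralE// -!EFinD => -[] H.
by move: H; set a := (\int[_]_u f u); lra.
Qed.

End charge_difference.

Section measure_case.
Context (R : realType) (n : nat).
Local Notation V := 'rV[R]_n.
Local Notation leb := (lebesgue_rV R n).
Local Notation ek := (basis_vec R).
Variables (v : V -> V) (C0 : R).
Hypothesis mv : forall k, measurable_fun [set: V] (fun y => v y ord0 k).
Hypothesis vC : forall y k, `|v y ord0 k| <= C0.
Hypothesis C00 : 0 <= C0.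
Variables (w : V -> R) (Cw : R).
Hypothesis mw : measurable_fun [set: V] w.
Hypothesis wC : forall y, `|w y| <= Cw.
Hypothesis w0 : forall y, 0 <= w y.
Variable s1 : R.
Hypothesis s_neq0 : (s1, 0 : R) != (0, 0).
Local Notation var := (varX s1 0).
Local Notation resid := (resid v).
Local Notation adm := (adm v).
Local Notation wgauss := (wgauss v w).

Variable P : R -> V -> {finite_measure set V -> \bar R}.
Hypothesis PE : forall t x Y, 0 < t -> measurable Y ->
  fine (P t x Y) = tgauss v (fun y _ => w y * \1_Y (v y)) (var t) t x.

Let mv' : measurable_fun [set: V] v. Proof. exact: measurable_fun_rV. Qed.

(** The gradient measures have to be defined at all times, but the variance is
    positive only at positive ones. *)
Definition var_total (t : R) : R := if 0 < t then var t else 1.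

Let vt0 t : 0 < var_total t.
Proof. by rewrite /var_total; case: ifPn => // t0; exact: varX_gt0. Qed.

Let vtE t : 0 < t -> var_total t = var t.
Proof. by rewrite /var_total => ->. Qed.

Definition mass_density t x y : R := w y * gaussn (var_total t) (resid t x y).

Definition grad_density t x k y : R :=
  w y * - (resid t x y ord0 k / var_total t) * gaussn (var_total t) (resid t x y).

Let admI (Y : set V) : measurable Y -> adm (fun y _ => \1_Y (v y)).
Proof.
move=> mY; apply: (@adm_weight _ _ _ _ 1).
  by apply: (measurableT_comp (f := \1_Y : V -> R) _ mv'); exact: measurable_indic.
by move=> y; rewrite indicE ger0_norm// lern1 leq_b1.
Qed.

Let adm_grad t k : adm (fun y r => - (r ord0 k / var_total t)).
Proof. by apply: admN; apply: admM; [exact: (adm_coor mv)|exact: adm_cst]. Qed.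

Let integrable_grad t x k : leb.-integrable [set: V] (EFin \o grad_density t x k).
Proof. exact: (integrable_wgauss mv vC C00 mw wC t x (adm_grad t k) (vt0 t)). Qed.

Definition grad_measure t x k : {charge set V -> \bar R} :=
  measure_function_pushforward__canonical__charge_Charge
    (charge_induced_charge__canonical__charge_Charge (integrable_grad t x k)) mv'.

Lemma grad_measureE t x k A :
  grad_measure t x k A = (\int[leb]_(y in v @^-1` A) (grad_density t x k y)%:E)%E.
Proof. by []. Qed.

Let mpre A : measurable A -> measurable (v @^-1` A).
Proof. by move=> mA; rewrite -[X in measurable X]setTI; exact: mv'. Qed.

Let integral_preimage (A : set V) (g : V -> R) :
  \int[leb]_(y in v @^-1` A) g y = \int[leb]_y (g y * \1_A (v y)).
Proof.
rewrite /Rintegral integral_mkcond; congr fine; apply: eq_integral => y _.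
rewrite patchE indicE; have [Ay|Ay] := pselect (A (v y)).
  by rewrite !mem_set// mulr1.
by rewrite !memNset// mulr0.
Qed.

(** With the velocity frozen at [v y], the position only enters through the Gaussian
    factor, whose logarithmic derivative is the factor in [grad_density]. *)
Lemma is_x_gradient_grad_measure : is_x_gradient P grad_measure.
Proof.
move=> t x k t0 Y mY.
have d y (r : V) : is_derive r (ek k) (fun=> \1_Y (v y) : R) 0 by exact: is_derive_cst.
have := is_derive_wgauss_x mv vC C00 mw wC t x (vt0 t) (admI mY) (adm_cst v 0) d.
rewrite vtE// (_ : wgauss _ _ _ = fun x => fine (P t x Y)); last first.
  by apply/funext => z; rewrite PE.
move=> H; apply: is_derive_eq.
rewrite grad_measureE -[RHS]/(\int[leb]_(y in v @^-1` Y) grad_density t x k y).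
rewrite integral_preimage; apply: eq_Rintegral => y _.
by rewrite /grad_density vtE// inner_basis; ring.
Qed.

Let mmass t x : measurable_fun [set: V] (mass_density t x).
Proof.
apply: measurable_funM => //.
exact: (measurableT_comp (measurable_gaussn _) (measurable_resid mv t x)).
Qed.

Let mass0 t x y : 0 <= mass_density t x y.
Proof. by rewrite mulr_ge0// gaussn_ge0. Qed.

Lemma integral_P t x (f : V -> R) : 0 < t -> measurable_fun [set: V] f ->
  adm (fun y _ => f (v y)) ->
  (P t x).-integrable [set: V] (EFin \o f) /\
  \int[P t x]_u f u = wgauss (fun y _ => f (v y)) (var t) t x.
Proof.
move=> t0 mf af.
have -> : wgauss (fun y _ => f (v y)) (var t) t x =
    \int[leb]_y (f (v y) * mass_density t x y).
  by apply: eq_Rintegral => y _; rewrite /mass_density vtE//; ring.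
have QE A : measurable A ->
    P t x A = image_density leb mv' (mmass t x) (mass0 t x) A.
  move=> mA; rewrite image_densityE.
  have iA : leb.-integrable (v @^-1` A) (EFin \o mass_density t x).
    apply: (integrableS measurableT) => //; first exact: mpre.
    have := integrable_wgauss mv vC C00 mw wC t x (adm_cst v 1) (vt0 t).
    by apply: eq_integrable => // y _; rewrite /= mulr1.
  rewrite RintegralE//; last exact: mpre.
  rewrite -[LHS]fineK ?fin_num_measure// PE// integral_preimage; congr EFin.
  by apply: eq_Rintegral => y _; rewrite /mass_density vtE//; ring.
apply: (integral_image QE mf).
have := integrable_wgauss mv vC C00 mw wC t x af (vt0 t).
by apply: eq_integrable => // y _; rewrite /= /mass_density; congr EFin; ring.
Qed.

(** The density of the gradient changes sign; its positive and negative parts give a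
    decomposition of the charge to which the comparison with Jordan's applies. *)
Lemma integral_dP t x k (f : V -> R) : 0 < t -> measurable_fun [set: V] f ->
  adm (fun y _ => f (v y)) ->
  charge_integrable (grad_measure t x k) f /\
  charge_integral (grad_measure t x k) f =
    wgauss (fun y r => - (r ord0 k / var t) * f (v y)) (var t) t x.
Proof.
move=> t0 mf af.
pose g := grad_density t x k.
have mg : measurable_fun [set: V] g.
  by have /integrableP[/measurable_EFinP] := integrable_grad t x k.
pose gp y := Num.max (g y) 0; pose gm y := Num.max (- g y) 0.
have mgp : measurable_fun [set: V] gp by exact: measurable_maxr.
have mgm : measurable_fun [set: V] gm by apply: measurable_maxr => //; exact: measurableT_comp.
have gp0 y : 0 <= gp y by rewrite le_max lexx orbT.
have gm0 y : 0 <= gm y by rewrite le_max lexx orbT.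
have gpm y : g y = gp y - gm y.
  by rewrite /gp /gm; case: (leP 0 (g y)) => h; case: (leP 0 (- g y)) => h'; lra.
have gp_le y : `|gp y| <= `|g y|.
  by rewrite ger0_norm// ge_max normr_ge0 ler_norm.
have gm_le y : `|gm y| <= `|g y|.
  by rewrite ger0_norm// ge_max normr_ge0 -normrN ler_norm.
pose Q1 := image_density leb mv' mgp gp0.
pose Q2 := image_density leb mv' mgm gm0.
have mfv : measurable_fun [set: V] (fun y => f (v y)) by exact: measurableT_comp.
have ifg : leb.-integrable [set: V] (EFin \o (fun y => f (v y) * g y)).
  have := integrable_wgauss mv vC C00 mw wC t x (admM af (adm_grad t k)) (vt0 t).
  by apply: eq_integrable => // y _; rewrite /= /g /grad_density; congr EFin; ring.
have ile (h h' : V -> R) : measurable_fun [set: V] h -> (forall y, `|h y| <= `|h' y|) ->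
    leb.-integrable [set: V] (EFin \o h') -> leb.-integrable [set: V] (EFin \o h).
  move=> mh hh' ih'; apply: (le_integrable measurableT _ _ ih').
    exact/measurable_EFinP.
  by move=> y _; rewrite /= lee_fin.
have ifp : leb.-integrable [set: V] (EFin \o (fun y => f (v y) * gp y)).
  apply: ile ifg; first exact: measurable_funM.
  by move=> y; rewrite normrM [leRHS]normrM ler_wpM2l.
have ifm : leb.-integrable [set: V] (EFin \o (fun y => f (v y) * gm y)).
  apply: ile ifg; first exact: measurable_funM.
  by move=> y; rewrite normrM [leRHS]normrM ler_wpM2l.
have igp : leb.-integrable [set: V] (EFin \o gp) by exact: ile (integrable_grad t x k).
have igm : leb.-integrable [set: V] (EFin \o gm) by exact: ile (integrable_grad t x k).
have Q1_fin A : measurable A -> Q1 A \is a fin_num.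
  move=> mA; rewrite image_densityE; apply: integrable_fin_num; first exact: mpre.
  by apply: (integrableS measurableT) => //; exact: mpre.
have Q2_fin A : measurable A -> Q2 A \is a fin_num.
  move=> mA; rewrite image_densityE; apply: integrable_fin_num; first exact: mpre.
  by apply: (integrableS measurableT) => //; exact: mpre.
have nuE A : measurable A -> grad_measure t x k A = (Q1 A - Q2 A)%E.
  move=> mA; have mvA := mpre mA; rewrite grad_measureE !image_densityE.
  rewrite -integralB_EFin//.
  - by apply: eq_integral => y _; rewrite -EFinB -gpm.
  - exact: (integrableS measurableT).
  - exact: (integrableS measurableT).
have [f1 E1] := integral_image (fun A (_ : measurable A) => erefl (Q1 A)) mf ifp.
have [f2 E2] := integral_image (fun A (_ : measurable A) => erefl (Q2 A)) mf ifm.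
have [ci ->] := charge_integral_difference Q1_fin Q2_fin nuE mf f1 f2.
split => //; rewrite E1 E2 -RintegralB//; apply: eq_Rintegral => y _.
by rewrite -mulrBr -gpm /g /grad_density vtE//; ring.
Qed.

Let slope0 t : slope s1 0 t = 0.
Proof. by rewrite /slope /covXU expr0n/= !mul0r. Qed.

Let resvar0 t : resvar s1 0 t = 0.
Proof. by rewrite /resvar /varU /covXU !expr0n/= !mul0r expr0n/= mul0r subrr. Qed.

Let adm_vi i : adm (fun y _ => v y ord0 i). Proof. exact: (adm_v mv vC). Qed.

Let rho_massm t x : 0 < t -> rho_meas P t x = mass v w s1 0 t x.
Proof.
move=> t0; have [_] := integral_P x t0 (f := fun=> 1) (measurable_cst _) (adm_cst v 1).
by [].
Qed.

Let momentum_meas t x i : 0 < t ->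
  (P t x).-integrable [set: V] (fun u => (u ord0 i)%:E) /\
  \int[P t x]_u u ord0 i = momentum v w s1 0 i t x.
Proof.
move=> t0; have [iP ->] := integral_P x t0 (measurable_coor i) (adm_vi i).
split => //; apply: wgauss_ext => y r.
by rewrite /cmean slope0 mul0r addr0.
Qed.

Let adm_factor (ub : V) i k : adm (fun y _ => (v y ord0 i - ub ord0 i) * (v y - ub) ord0 k).
Proof.
rewrite [X in adm X](_ : _ = (fun y _ => (v y ord0 i - ub ord0 i) * (v y ord0 k - ub ord0 k))).
  by apply: admM; apply: admB => //; exact: adm_cst.
by apply/funext => y; apply/funext => r; rewrite !mxE.
Qed.

Let measurable_factor (ub : V) i k :
  measurable_fun [set: V] (fun u : V => (u ord0 i - ub ord0 i) * (u - ub) ord0 k).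
Proof.
under eq_fun do rewrite !mxE.
by apply: measurable_funM; apply: measurable_funB => //; exact: measurable_coor.
Qed.

Theorem gas_system_of_measure :
  [/\ is_x_gradient P grad_measure, moments_exist_meas P grad_measure
    & gas_system s1 (rho_meas P) (u_meas P) (I_meas P grad_measure)].
Proof.
split.
- exact: is_x_gradient_grad_measure.
- move=> t x t0; split=> [i|i k]; first by case: (momentum_meas x i t0).
  by case: (integral_dP x k t0 (measurable_factor (u_meas P t x) i k)
              (adm_factor (u_meas P t x) i k)).
apply: (gas_system_of_moments mv vC C00 mw wC w0 s_neq0) => t x.
- exact: rho_massm.
- move=> i t0; rewrite mxE (momentum_meas x i t0).2 -/(rho_meas P t x) rho_massm//.
  have [m0|m0] := eqVneq (mass v w s1 0 t x) 0; last by rewrite mulrC divfK.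
  by rewrite m0 mul0r (momentum_of_mass mv vC C00 mw wC w0 s_neq0).
move=> i t0; apply: eq_bigr => k _.
have [_ ->] := integral_dP x k t0 (measurable_factor (u_meas P t x) i k)
              (adm_factor (u_meas P t x) i k).
apply: wgauss_ext => y r; rewrite /stress /cmean slope0 resvar0 !mxE; ring.
Qed.

End measure_case.

(** * Families of independent Gaussian variables *)

Section independent_gaussians.
Context (R : realType) (d : measure_display) (T : measurableType d).
Variable Pr : probability T R.

Lemma mutually_independent_comp (I J : finType) (e : J -> I) (Y : I -> T -> R) :
  bijective e -> mutually_independent Pr Y ->
  mutually_independent Pr (fun j => Y (e j)).
Proof.
move=> [f ef fe] ind B mB.
have := ind (fun i => B (f i)) (fun i => mB (f i)).
rewrite (reindex e)/=; last by exists f => ? _; [exact: ef|exact: fe].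
under eq_bigr do rewrite ef.
move=> <-; congr (Pr _); apply/seteqP; split=> w /= H i.
  by have := H (f i); rewrite fe.
by have := H (e i); rewrite ef.
Qed.

Variables (m : nat) (Y : 'I_m -> T -> R) (tau : 'I_m -> R).
Hypothesis mY : forall i, measurable_fun [set: T] (Y i).
Hypothesis tau_gt0 : forall i, 0 < tau i.
Hypothesis indep : mutually_independent Pr Y.
Hypothesis lawY : forall i B, measurable B ->
  Pr (Y i @^-1` B) = normal_prob 0 (Num.sqrt (tau i)) B.
Local Notation V := 'rV[R]_m.

Let box (B : 'I_m -> set R) : set V := [set v | forall i, B i (v ord0 i)].

Let boxes : set (set V) :=
  [set A | exists2 B, (forall i, measurable (B i)) & A = box B].

Let measurable_box B : (forall i, measurable (B i)) -> measurable (box B).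
Proof.
move=> mB; rewrite (_ : box B = \bigcap_(i in [set: 'I_m])
    ([set: V] `&` (fun v => v ord0 i) @^-1` B i)).
  by apply: fin_bigcap_measurable => // i _; apply: measurable_coor.
by apply/seteqP; split=> [v Bv i _|v Bv i]; [split=> //; exact: Bv|case: (Bv i I)].
Qed.

Let boxesE : @measurable _ V = <<s boxes >>.
Proof.
apply/seteqP; split.
  apply: smallest_sub; first exact: smallest_sigma_algebra.
  rewrite -bigcup_seq/= => A [i _ [B mB <-]]; apply: sub_gen_smallest.
  exists (fun j => if j == i then B else setT) => [j|].
    by case: ifP.
  rewrite setTI; apply/seteqP; split=> v /= Bv.
    by move=> j; case: eqP => // ->.
  by have := Bv i; rewrite eqxx.
apply: smallest_sub; first exact: sigma_algebra_measurable.
by move=> A [B mB ->]; exact: measurable_box.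
Qed.

Let vec (w : T) : V := \row_i Y i w.

Let measurable_vec : measurable_fun [set: T] vec.
Proof. by apply: measurable_fun_rV => i; under eq_fun do rewrite mxE; exact: mY. Qed.

Let dens (v : V) : R := \prod_i gauss (tau i) (v ord0 i).

Let measurable_dens : measurable_fun [set: V] dens.
Proof. by apply: (@measurable_prod_coor _ m (fun i => gauss (tau i))) => i; exact: measurable_gauss. Qed.

Let dens_ge0 v : 0 <= dens v.
Proof. by apply: prodr_ge0 => i _; exact: gauss_ge0. Qed.

(** The boxes are stable under intersection and generate the sigma-algebra, and on
   them independence makes the law a product. *)
Let gaussian_law A : measurable A ->
  pushforward Pr vec A = (\int[lebesgue_rV R m]_(v in A) (dens v)%:E)%E.
Proof.
pose m1 : {measure set V -> \bar R} := 
  measure_function_pushforward__canonical__measure_function_Measure Pr measurable_vec.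
pose m2 : {measure set V -> \bar R} := density_measure (lebesgue_rV R m) measurable_dens dens_ge0.
apply: (@measure_unique _ _ _ boxes (fun=> setT) _ _ _ _ m1 m2).
- exact: boxesE.
- move=> _ _ [B1 mB1 ->] [B2 mB2 ->]; exists (fun i => B1 i `&` B2 i).
    by move=> i; exact: measurableI.
  apply/seteqP; split=> v /=; first by move=> [h1 h2] i; split; [exact: h1|exact: h2].
  by move=> h; split=> i; case: (h i).
- move=> _; exists (fun=> setT) => //.
  by apply/seteqP; split.
- by rewrite bigcup_const.
- move=> _ [B mB ->]; rewrite /m1 /m2 /= /pushforward /density_measure.
  rewrite (_ : _ @^-1` _ = [set w | forall i, B i (Y i w)]); last first.
    by apply/seteqP; split=> w /= h i; have := h i; rewrite mxE.
  rewrite indep// integral_mkcond.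
  transitivity (\int[lebesgue_rV R m]_v
      (\prod_i (\1_(B i) (v ord0 i) * gauss (tau i) (v ord0 i)))%:E)%E; last first.
    apply: eq_integral => v _; rewrite patchE big_split/=; case: ifPn => [|].
      rewrite inE => Bv; rewrite big1 ?mul1r// => i _.
      by rewrite indicE mem_set//; exact: Bv.
    rewrite notin_setE => /existsNP[i /= Bi].
    by rewrite (bigD1 i)//= indicE memNset// !mul0r.
  rewrite (@integral_prod_rV _ _ (fun i z => \1_(B i) z * gauss (tau i) z)).
  + apply: eq_bigr => i _; rewrite lawY// /normal_prob integral_mkcond.
    apply: eq_integral => z _; rewrite patchE indicE -gauss_normal_pdf//.
    by rewrite sub0r gaussN; case: ifPn => _; rewrite ?mul1r ?mul0r.
  + move=> i; apply: measurable_funM; last exact: measurable_gauss.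
    exact: measurable_indic.
  + by move=> i z; rewrite mulr_ge0 ?gauss_ge0.
- by move=> _; rewrite /m1 /= /pushforward preimage_setT probability_setT ltry.
Qed.

Lemma expectation_gaussians (h : V -> R) :
  measurable_fun [set: V] h -> (forall v, 0 <= h v) ->
  (\int[Pr]_w (h (vec w))%:E =
   \int[lebesgue_rV R m]_v (h v * \prod_i gauss (tau i) (v ord0 i))%:E)%E.
Proof.
move=> mh h0.
pose m1 : {measure set V -> \bar R} := 
  measure_function_pushforward__canonical__measure_function_Measure Pr measurable_vec.
transitivity (\int[m1]_v (h v)%:E)%E.
  rewrite ge0_integral_pushforward//; first exact/measurable_EFinP.
  by move=> v _; rewrite lee_fin.
rewrite (@ge0_integral_density _ _ _ (lebesgue_rV R m) m1 dens)//; last exact/measurable_EFinP.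
Qed.

End independent_gaussians.

Section gaussian_convolution.
Context (R : realType) (n : nat).

Lemma posdef_add (A B D a b t : R) : 0 < A -> B ^+ 2 < A * D -> 0 <= t ->
  (B + a * b * t) ^+ 2 < (A + a ^+ 2 * t) * (D + b ^+ 2 * t).
Proof.
move=> A0 BAD t0; rewrite -subr_gt0.
have q0 : 0 <= A * b ^+ 2 - 2 * (B * a * b) + D * a ^+ 2.
  rewrite -(pmulr_rge0 _ A0).
  have -> : A * (A * b ^+ 2 - 2 * (B * a * b) + D * a ^+ 2) =
      (A * b - B * a) ^+ 2 + (A * D - B ^+ 2) * a ^+ 2 by ring.
  by rewrite addr_ge0 ?sqr_ge0// mulr_ge0 ?sqr_ge0// subr_ge0 ltW.
have -> : (A + a ^+ 2 * t) * (D + b ^+ 2 * t) - (B + a * b * t) ^+ 2 =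
   (A * D - B ^+ 2) + t * (A * b ^+ 2 - 2 * (B * a * b) + D * a ^+ 2) by ring.
by rewrite ltr_wpDr ?subr_gt0// mulr_ge0.
Qed.

Lemma measurable_gauss2 d (T : measurableType d) (A B D : R) (f g : T -> R) :
  measurable_fun [set: T] f -> measurable_fun [set: T] g ->
  measurable_fun [set: T] (fun z => gauss2 A B D (f z) (g z)).
Proof.
move=> mf mg; apply: measurable_funM.
  by apply: measurableT_comp => //; exact: measurable_gauss.
apply: measurableT_comp; first exact: measurable_gauss.
by apply: measurable_funB => //; apply: measurable_funM.
Qed.

Let lin m (kappa : 'I_m -> 'I_n) (a : 'I_m -> R) (v : 'rV[R]_m) (k : 'I_n) : R :=
  \sum_(i | kappa i == k) a i * v ord0 i.

Let lin_cons m (kappa : 'I_m.+1 -> 'I_n) a z (v : 'rV[R]_m) k :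
  lin kappa a (rV_cons (z, v)) k =
  (if kappa ord0 == k then a ord0 * z else 0) +
  lin (fun i => kappa (lift ord0 i)) (fun i => a (lift ord0 i)) v k.
Proof.
rewrite /lin big_mkcond big_ord_recl rV_cons0; congr (_ + _).
by rewrite [RHS]big_mkcond; apply: eq_bigr => i _; rewrite rV_consS.
Qed.

Let measurable_lin m (kappa : 'I_m -> 'I_n) a k :
  measurable_fun [set: 'rV[R]_m] (fun v => lin kappa a v k).
Proof.
rewrite /lin; under eq_fun do rewrite big_mkcond.
apply: measurable_sum => i; case: (kappa i == k) => //.
by apply: measurable_funM => //; exact: measurable_coor.
Qed.

(** Integrating one variable at a time only affects the covariance matrix of the
    coordinate to which that variable contributes. *)
Lemma integral_gauss2_lin m (kappa : 'I_m -> 'I_n) (a b tau : 'I_m -> R)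
    (A B D x u : 'I_n -> R) :
  (forall i, 0 < tau i) -> (forall k, 0 < A k) -> (forall k, B k ^+ 2 < A k * D k) ->
  (\int[lebesgue_rV R m]_v
     (\prod_k gauss2 (A k) (B k) (D k)
        (x k - \sum_(i | kappa i == k) a i * v ord0 i)
        (u k - \sum_(i | kappa i == k) b i * v ord0 i)
      * \prod_i gauss (tau i) (v ord0 i))%:E =
   (\prod_k gauss2 (A k + \sum_(i | kappa i == k) a i ^+ 2 * tau i)
                   (B k + \sum_(i | kappa i == k) a i * b i * tau i)
                   (D k + \sum_(i | kappa i == k) b i ^+ 2 * tau i)
                   (x k) (u k))%:E)%E.
Proof.
elim: m kappa a b tau A B D => [|m IH] kappa a b tau A B D tau0 A0 BAD.
  rewrite integral_dirac// ?diracT ?mul1e.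
    rewrite !big_ord0 mulr1; congr EFin; apply: eq_bigr => k _.
    by rewrite !big_ord0 !subr0 !addr0.
  apply/measurable_EFinP; apply: measurable_funM.
    apply: measurable_prod => k _; apply: measurable_gauss2.
      by apply: measurable_funB => //; exact: measurable_lin.
    by apply: measurable_funB => //; exact: measurable_lin.
  by apply: (@measurable_prod_coor _ _ (fun i => gauss (tau i))) => i; exact: measurable_gauss.

have mint (kap : 'I_m.+1 -> 'I_n) (c c' : 'I_m.+1 -> R) (x1 u1 : 'I_n -> R) :
  measurable_fun [set: 'rV[R]_m.+1] (fun v => (\prod_k gauss2 (A k) (B k) (D k)
        (x1 k - \sum_(i | kap i == k) c i * v ord0 i)
        (u1 k - \sum_(i | kap i == k) c' i * v ord0 i)
      * \prod_i gauss (tau i) (v ord0 i))%:E).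
  apply/measurable_EFinP; apply: measurable_funM.
    apply: measurable_prod => k _; apply: measurable_gauss2.
      by apply: measurable_funB => //; exact: measurable_lin.
    by apply: measurable_funB => //; exact: measurable_lin.
  by apply: (@measurable_prod_coor _ _ (fun i => gauss (tau i))) => i; exact: measurable_gauss.
rewrite integral_rV_S2//; last first.
  by move=> v; rewrite lee_fin mulr_ge0// prodr_ge0// => *; rewrite ?gauss2_ge0 ?gauss_ge0.
pose k0 := kappa ord0.
pose upd (f : 'I_n -> R) c k := f k + (if k0 == k then c else 0).
pose A1 := upd A (a ord0 ^+ 2 * tau ord0).
pose B1 := upd B (a ord0 * b ord0 * tau ord0).
pose D1 := upd D (b ord0 ^+ 2 * tau ord0).
pose kappa' i := kappa (lift ord0 i).
have A10 k : 0 < A1 k.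
  by rewrite /A1 /upd ltr_pwDl//; case: ifP => // _; rewrite mulr_ge0 ?sqr_ge0// ltW.
have BAD1 k : B1 k ^+ 2 < A1 k * D1 k.
  rewrite /A1 /B1 /D1 /upd; case: ifP => _; last by rewrite !addr0.
  by apply: posdef_add => //; exact: ltW.
have updE (f : 'I_n -> R) (c : 'I_m.+1 -> R) k :
    f k + \sum_(i | kappa i == k) c i =
    upd f (c ord0) k + \sum_(i | kappa' i == k) c (lift ord0 i).
  by rewrite big_mkcond big_ord_recl addrA -big_mkcond.
transitivity (\int[lebesgue_rV R m]_v
     (\prod_k gauss2 (A1 k) (B1 k) (D1 k)
        (x k - \sum_(i | kappa' i == k) a (lift ord0 i) * v ord0 i)
        (u k - \sum_(i | kappa' i == k) b (lift ord0 i) * v ord0 i)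
      * \prod_i gauss (tau (lift ord0 i)) (v ord0 i))%:E)%E; last first.
  rewrite IH//; congr EFin; apply: eq_bigr => k _.
  by rewrite -(updE A (fun i => a i ^+ 2 * tau i))
    -(updE B (fun i => a i * b i * tau i)) -(updE D (fun i => b i ^+ 2 * tau i)).
apply: eq_integral => v _.
pose x' k := x k - \sum_(i | kappa' i == k) a (lift ord0 i) * v ord0 i.
pose u' k := u k - \sum_(i | kappa' i == k) b (lift ord0 i) * v ord0 i.
pose G := \prod_i gauss (tau (lift ord0 i)) (v ord0 i).
pose P := \prod_(k | k != k0) gauss2 (A k) (B k) (D k) (x' k) (u' k).
transitivity (\int[lebesgue_measure]_z ((P * G)%:E *
   (gauss2 (A k0) (B k0) (D k0) (x' k0 - a ord0 * z) (u' k0 - b ord0 * z)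
      * gauss (tau ord0) z)%:E))%E.
  apply: eq_integral => z _; rewrite -EFinM; congr EFin.
  rewrite [X in _ * X = _]big_ord_recl rV_cons0.
  under [X in _ * (_ * X) = _]eq_bigr do rewrite rV_consS.
  rewrite -/G (bigD1 k0)//= -/P.
  have linE c (x0 : 'I_n -> R) k : x0 k - \sum_(i | kappa i == k) c i * rV_cons (z, v) ord0 i =
      (x0 k - \sum_(i | kappa' i == k) c (lift ord0 i) * v ord0 i)
       - (if k0 == k then c ord0 * z else 0).
    by have := lin_cons kappa c z v k; rewrite /lin => ->; rewrite opprD addrA addrAC.
  rewrite !linE eqxx -/(x' k0) -/(u' k0).
  have -> : \prod_(i < n | i != k0) gauss2 (A i) (B i) (D i)
      (x i - \sum_(i0 | kappa i0 == i) a i0 * rV_cons (z, v) ord0 i0)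
      (u i - \sum_(i0 | kappa i0 == i) b i0 * rV_cons (z, v) ord0 i0) = P.
    by apply: eq_bigr => k kk0; rewrite !linE eq_sym (negbTE kk0) !subr0.
  by set g2 := gauss2 _ _ _ _ _; ring.
rewrite ge0_integralZl_EFin//; last 3 first.
- by move=> z _; rewrite lee_fin mulr_ge0 ?gauss2_ge0 ?gauss_ge0.
- apply/measurable_EFinP/measurable_funM; last exact: measurable_gauss.
  by apply: measurable_gauss2; apply: measurable_funB => //; apply: measurable_funM.
- by rewrite mulr_ge0// prodr_ge0// => *; rewrite ?gauss2_ge0 ?gauss_ge0.
rewrite integral_gauss2_line// -EFinM; congr EFin.
rewrite mulrAC -/G; congr (_ * _).
rewrite [RHS](bigD1 k0)//= mulrC; congr (_ * _).
  by rewrite /A1 /B1 /D1 /upd eqxx.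
apply: eq_bigr => k kk0.
by rewrite /A1 /B1 /D1 /upd eq_sym (negbTE kk0) !addr0.
Qed.

End gaussian_convolution.

Section gaussian_family.
Context (R : realType) (n : nat) (d : measure_display) (T : measurableType d).
Variable Pr : probability T R.

Lemma expectation_gauss2_lin (I : finType) (Y : I -> T -> R)
    (kappa : I -> 'I_n) (a b tau : I -> R) (A B D x u : 'I_n -> R) :
  (forall i, measurable_fun [set: T] (Y i)) ->
  (forall i, 0 < tau i) -> mutually_independent Pr Y ->
  (forall i C, measurable C -> Pr (Y i @^-1` C) = normal_prob 0 (Num.sqrt (tau i)) C) ->
  (forall k, 0 < A k) -> (forall k, B k ^+ 2 < A k * D k) ->
  (\int[Pr]_w
     (\prod_k gauss2 (A k) (B k) (D k)
        (x k - \sum_(i | kappa i == k) a i * Y i w)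
        (u k - \sum_(i | kappa i == k) b i * Y i w))%:E =
   (\prod_k gauss2 (A k + \sum_(i | kappa i == k) a i ^+ 2 * tau i)
                   (B k + \sum_(i | kappa i == k) a i * b i * tau i)
                   (D k + \sum_(i | kappa i == k) b i ^+ 2 * tau i)
                   (x k) (u k))%:E)%E.
Proof.
move=> mY tau0 ind lawY A0 BAD.
pose e (j : 'I_#|I|) : I := enum_val j.
have be : bijective e by exact: enum_val_bij.
have rE (F : I -> R) k : \sum_(i | kappa i == k) F i = \sum_(j | kappa (e j) == k) F (e j).
  by rewrite (reindex e)//; exact: onW_bij.
have := @integral_gauss2_lin R n #|I| (kappa \o e) (a \o e) (b \o e) (tau \o e) A B D x u
  (fun j => tau0 (e j)) A0 BAD.
under [in X in _ -> _ = X]eq_bigr do rewrite !rE.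
move=> <-.
pose h (v : 'rV[R]_#|I|) := \prod_k gauss2 (A k) (B k) (D k)
        (x k - \sum_(i | kappa (e i) == k) a (e i) * v ord0 i)
        (u k - \sum_(i | kappa (e i) == k) b (e i) * v ord0 i).
have mlin (c : I -> R) (k : 'I_n) :
    measurable_fun [set: 'rV[R]_#|I|] (fun v => \sum_(i | kappa (e i) == k) c (e i) * v ord0 i).
  under eq_fun do rewrite big_mkcond.
  apply: measurable_sum => i; case: (kappa (e i) == k) => //.
  by apply: measurable_funM => //; exact: measurable_coor.
have mh : measurable_fun [set: 'rV[R]_#|I|] h.
  apply: measurable_prod => k _; apply: measurable_gauss2.
    by apply: measurable_funB.
  by apply: measurable_funB.
have h0 v : 0 <= h v by rewrite prodr_ge0// => k _; exact: gauss2_ge0.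
have := expectation_gaussians (fun j => mY (e j)) (fun j => tau0 (e j))
  (mutually_independent_comp be ind) (fun j => lawY (e j)) mh h0.
move=> <-; apply: eq_integral => w _; congr EFin; apply: eq_bigr => k _.
by rewrite !rE; congr (gauss2 _ _ _ (_ - _) (_ - _)); apply: eq_bigr => i _; rewrite mxE.
Qed.

End gaussian_family.

(** * The law of the integrated noise *)

Section riemann.
Context (R : realType).
Local Notation leb := (@lebesgue_measure R).

(** The Riemann sums are integrals of step functions, bounded because the path is
    continuous on a segment: dominated convergence applies. *)
Lemma riemann_sum_cvg (f : R -> R) (t : R) : 0 < t ->
  {within `[0, +oo[, continuous f} ->
  t / N.+1%:R * \sum_(j < N.+1) f (j.+1%:R * (t / N.+1%:R)) @[N --> \oo] -->
  \int[leb]_(s in `[0, t]) f s.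
Proof.
move=> t0 cf.
have c0t : {within `[0, t], continuous f}.
  by apply: continuous_subspaceW cf => s /=; rewrite !in_itv/= => /andP[-> _].
have if0t : leb.-integrable `[0, t] (EFin \o f).
  by apply: continuous_compact_integrable => //; exact: segment_compact.
have sub : `[0, t[%classic `<=` `[0, t]%classic.
  by move=> s /=; rewrite !in_itv/= => /andP[-> /ltW].
have if0t' : leb.-integrable `[0, t[ (EFin \o f) by exact: integrableS if0t.
have [M M0 fM] : exists2 M, 0 <= M & forall s, s \in `[0, t] -> `|f s| <= M.
  have [c _ fc] := EVT_max (ltW t0) c0t.
  have cNf : {within `[0, t], continuous (- f)}.
    by move=> s; apply: continuousN; exact: c0t.
  have [c' _ fc'] := EVT_max (ltW t0) cNf.
  exists (Num.max `|f c| `|f c'|) => [|s s0t]; first by rewrite le_max normr_ge0.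
  rewrite ler_norml le_max; apply/andP; split; last first.
    by rewrite (le_trans (fc s s0t))// ler_norm.
  rewrite lerNl (le_trans (fc' s s0t))// le_max; apply/orP; right.
  by rewrite -normrN ler_norm.
rewrite -Rintegral_itv_bndo_bndc//.
pose h N : R := t / N.+1%:R.
have h0 N : 0 < h N by rewrite divr_gt0.
pose cell N j : set R := `[j%:R * h N, j.+1%:R * h N[%classic.
pose g N (s : R) := \sum_(j < N.+1) f (j.+1%:R * h N) * \1_(cell N j) s.
have icell N j : leb.-integrable `[0, t[ (EFin \o \1_(cell N j)).
  by apply: (integrableS measurableT) => //; exact: integrable_indic_itv.
have cellS N (j : 'I_N.+1) : cell N j `<=` `[0, t[%classic.
  move=> s; rewrite /cell /= !in_itv/= => /andP[js sj]; apply/andP; split.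
    by rewrite (le_trans _ js)// mulr_ge0// ltW.
  rewrite (lt_le_trans sj)// /h mulrA ler_pdivrMr// mulrC ler_pM2l//.
  by rewrite ler_nat ltn_ord.
have -> : (fun N => t / N.+1%:R * \sum_(j < N.+1) f (j.+1%:R * (t / N.+1%:R))) =
          (fun N => \int[leb]_(s in `[0, t[) g N s).
  apply/funext => N; rewrite -/(h N) /g RintegralR_sum//; last first.
    by move=> j; exact: integrableRZ.
  rewrite mulr_sumr; apply: eq_bigr => j _.
  rewrite RintegralZl// mulrC; congr (_ * _).
  have mcell : measurable (cell N j) by exact: measurable_itv.
  rewrite /Rintegral integral_indic// setIidl; last exact: cellS.
  have cellE : (@lebesgue_measure R) (cell N j : set R) = (h N)%:E.
    have := @lebesgue_measure_itv R `[j%:R * h N, j.+1%:R * h N[.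
    rewrite /= lte_fin ltr_pM2r// ltr_nat ltnSn/= => ->.
    by rewrite -natr1 mulrDl mul1r -EFinD; congr EFin; ring.
  exact: (esym (f_equal fine cellE)).
have gE N s : s \in `[0, t[ -> exists2 p, g N s = f p & s <= p <= s + h N /\ p <= t.
  rewrite in_itv/= => /andP[s0 st].
  have sh0 : 0 <= s / h N by rewrite divr_ge0// ltW.
  have /andP[j1 j2] := truncn_itv sh0.
  set j := Num.trunc _ in j1 j2.
  rewrite ler_pdivlMr// in j1; rewrite ltr_pdivrMr// in j2.
  have jN : (j < N.+1)%N.
    rewrite truncn_lt_nat// ltr_pdivrMr// /h mulrCA divff ?mulr1//.
  exists (j.+1%:R * h N).
    rewrite /g (bigD1 (Ordinal jN))//= indicE mem_set/=; last first.
      by rewrite /cell/= in_itv/= j1 j2.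
    rewrite mulr1 big1 ?addr0// => i /negP ij.
    rewrite indicE memNset ?mulr0// /cell/= in_itv/= => /andP[i1 i2]; apply: ij.
    apply/eqP/val_inj => /=; apply/eqP; rewrite eqn_leq.
    have H1 : (i%:R : R) < j.+1%:R by rewrite -(ltr_pM2r (h0 N)) (le_lt_trans i1).
    have H2 : (j%:R : R) < i.+1%:R by rewrite -(ltr_pM2r (h0 N)) (le_lt_trans j1).
    by move: H1 H2; rewrite !ltr_nat !ltnS => -> ->.
  split; first by rewrite (ltW j2)/= -natr1 mulrDl mul1r lerD2r.
  by rewrite /h mulrA ler_pdivrMr// mulrC ler_pM2l// ler_nat.
have mg N : measurable_fun `[0, t[ (g N).
  have : leb.-integrable `[0, t[%classic (EFin \o g N).
    by apply: integrableR_sum => // j; exact: integrableRZ.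
  by case/integrableP => /measurable_EFinP.
have hcvg : h N @[N --> \oo] --> 0.
  by rewrite -(mulr0 t); apply: cvgMr; exact: cvg_harmonic.
have gf s : `[0, t[%classic s -> (g N s)%:E @[N --> \oo] --> (f s)%:E.
  move=> s0t; apply: cvg_EFin; first by near=> N.
  have s0 : `[0, +oo[%classic s by move: s0t; rewrite /= !in_itv/= => /andP[->].
  move/subspace_continuousP : cf => /(_ s s0) /cvgrPdist_le cfs.
  apply/cvgrPdist_le => /= e e0.
  have /nbhs_ballP[r /= r0 H] := cfs e e0.
  move/cvgrPdist_lt : hcvg => /(_ r r0); apply: filterS => N.
  rewrite sub0r normrN ger0_norm ?(ltW (h0 N))// => hr.
  have [p -> [/andP[sp ph] _]] := gE N s s0t.
  apply: H => /=.
    rewrite /ball/= distrC ger0_norm ?subr_ge0// ltrBlDl (le_lt_trans ph)// ltrD2l//.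
  by move: s0; rewrite /= !in_itv/= => /andP[s0 _]; rewrite (le_trans s0 sp).
have := @dominated_convergence _ _ _ leb `[0, t[%classic (measurable_itv _)
  (fun N s => (g N s)%:E) (EFin \o f) (cst M%:E).
case.
- by move=> N; have /measurable_EFinP := mg N.
- by case/integrableP : if0t'.
- by apply: aeW => s; exact: gf.
- apply/integrableP; split => //.
  rewrite integral_cst//= lebesgue_measure_itv/= lte_fin t0.
  by rewrite -EFinB -EFinM ltry.
- apply: aeW => s N s0t; rewrite lee_fin.
  have [p -> [/andP[sp _] pt]] := gE N s s0t.
  apply: fM; rewrite in_itv/= pt andbT (le_trans _ sp)//.
  by move: s0t; rewrite /= in_itv/= => /andP[].
move=> _ _ H.
have E : (\int[leb]_(x in `[0%R, t[) (EFin \o f) x)%E =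
    (\int[leb]_(s in `[0, t[) f s)%:E.
  by apply: RintegralE.
by move: H; rewrite E => /fine_cvg.
Unshelve. all: end_near. Qed.

End riemann.

Section gauss_cvg.
Context (R : realType) (I : Type) (F : set_system I) (FF : Filter F).

Lemma cvg_gauss (A z : I -> R) (A0 z0 : R) : 0 < A0 -> A x @[x --> F] --> A0 ->
  z x @[x --> F] --> z0 -> gauss (A x) (z x) @[x --> F] --> gauss A0 z0.
Proof.
move=> A00 cA cz; rewrite /gauss; apply: cvgM.
  apply: cvgV; first by rewrite gt_eqF// sqrtr_gt0 mulrn_wgt0// mulr_gt0 ?pi_gt0.
  apply: continuous_cvg; first exact: sqrt_continuous.
  by apply: cvgMn; apply: cvgMl.
apply: continuous_cvg; first exact: continuous_expR.
apply: cvgM; first by apply: cvgN; rewrite expr2; under eq_fun do rewrite expr2; exact: cvgM.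
apply: cvgV; first by rewrite gt_eqF// mulrn_wgt0.
exact: cvgMn.
Qed.

Lemma cvg_gauss2 (A B D x u : I -> R) (A0 B0 D0 x0 u0 : R) :
  0 < A0 -> B0 ^+ 2 < A0 * D0 ->
  A i @[i --> F] --> A0 -> B i @[i --> F] --> B0 -> D i @[i --> F] --> D0 ->
  x i @[i --> F] --> x0 -> u i @[i --> F] --> u0 ->
  gauss2 (A i) (B i) (D i) (x i) (u i) @[i --> F] --> gauss2 A0 B0 D0 x0 u0.
Proof.
move=> A00 BAD cA cB cD cx cu; rewrite /gauss2; apply: cvgM; first exact: cvg_gauss.
have cAV : (A i)^-1 @[i --> F] --> A0^-1 by apply: cvgV => //; rewrite gt_eqF.
apply: cvg_gauss; first by rewrite subr_gt0 ltr_pdivrMr// mulrC.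
  apply: cvgB => //; apply: cvgM => //.
  by rewrite expr2; under eq_fun do rewrite expr2; exact: cvgM.
by apply: cvgB => //; apply: cvgM => //; apply: cvgM.
Qed.

Lemma cvg_prodr (J : finType) (f : J -> I -> R) (l : J -> R) :
  (forall j, f j i @[i --> F] --> l j) ->
  \prod_j f j i @[i --> F] --> \prod_j l j.
Proof.
move=> fl; apply: cvg_big => //.
exact: mul_continuous.
Qed.

End gauss_cvg.

Section increments.
Context (R : realType) (n : nat) (d : measure_display) (T : measurableType d).

(** Two processes are independent through their sigma-algebras; this brings events
    about increments into them. *)
Lemma increments_event (W : R -> T -> 'rV[R]_n) (I : finType) (s r : I -> R)
    (k : I -> 'I_n) (B : I -> set R) :
  (forall i, 0 <= s i) -> (forall i, 0 <= r i) -> (forall i, measurable (B i)) ->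
  process_sigma_algebra W
    [set w | forall i, B i (W (s i) w ord0 (k i) - W (r i) w ord0 (k i))].
Proof.
move=> s0 r0 mB.
pose G := [set A | exists t (C : set 'rV[R]_n),
         [/\ 0 <= t, measurable C & A = W t @^-1` C]].
pose S := g_sigma_algebraType G.
have mW (t : R) : 0 <= t -> measurable_fun [set: S] (W t : S -> 'rV[R]_n).
  move=> t0 _ C mC; rewrite setTI; apply: sub_sigma_algebra.
  by exists t, C.
rewrite -[process_sigma_algebra W]/(@measurable _ S).
rewrite (_ : [set w | _] = \bigcap_(i in [set: I]) ([set: S] `&`
   (fun w : S => W (s i) w ord0 (k i) - W (r i) w ord0 (k i)) @^-1` B i)).
  apply: fin_bigcap_measurable => // i _.
  have mc (t : R) : 0 <= t -> measurable_fun [set: S] (fun w : S => W t w ord0 (k i)).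
    by move=> t0; exact: (measurableT_comp (measurable_coor (k i)) (mW t t0)).
  by apply: measurable_funB => //; exact: mc.
by apply/seteqP; split=> [w H i _|w H i]; [split=> //; exact: H|case: (H i Logic.I)].
Qed.

(** Summation by parts, turning the values of a path into its increments. *)
Lemma abel_sum (g : nat -> R) M :
  \sum_(j < M) (M - j)%:R * (g j.+1 - g j) = \sum_(j < M) (g j.+1 - g 0%N).
Proof.
elim: M => [|M IH]; first by rewrite !big_ord0.
rewrite !big_ord_recr/= -IH subSn// subnn mul1r addrC.
have -> : g M.+1 - g 0%N = (g M.+1 - g M) + \sum_(j < M) (g j.+1 - g j).
  by rewrite -(big_mkord xpredT (fun j => g j.+1 - g j)) telescope_sumr// addrA subrK.
rewrite addrCA; congr (_ + _); rewrite -big_split/=; apply: eq_bigr => j _.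
by rewrite subSn ?(ltnW (ltn_ord j))// -natr1 mulrDl mul1r.
Qed.

Lemma sum_nat M : \sum_(j < M) ((M - j)%:R : R) = M%:R * (M%:R + 1) / 2.
Proof.
rewrite (reindex_inj rev_ord_inj)/=.
under eq_bigr => j _ do rewrite subKn//.
elim: M => [|M IH]; first by rewrite big_ord0 !mul0r.
by rewrite big_ord_recr/= IH -natr1; field.
Qed.

Lemma sum_nat_sqr M : \sum_(j < M) ((M - j)%:R ^+ 2 : R) =
  M%:R * (M%:R + 1) * (2 * M%:R + 1) / 6.
Proof.
rewrite (reindex_inj rev_ord_inj)/=.
under eq_bigr => j _ do rewrite subKn//.
elim: M => [|M IH]; first by rewrite big_ord0 !mul0r.
by rewrite big_ord_recr/= IH -natr1; field.
Qed.

End increments.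

Section brownian_increments.
Context (R : realType) (n : nat) (d : measure_display) (T : measurableType d).
Variables (Pr : probability T R) (W1 W2 : R -> T -> 'rV[R]_n).
Hypothesis W1_brownian : is_brownian Pr W1.
Hypothesis W2_brownian : is_brownian Pr W2.
Hypothesis W1_W2_indep : independent_processes Pr W1 W2.
Variables (s1 s2 t : R).
Hypothesis t0 : 0 < t.

Section subdivision.
Variable N : nat.
Let h : R := t / N.+1%:R.
Let h0 : 0 < h. Proof. by rewrite divr_gt0. Qed.

Let index : finType := ('I_N.+1 * 'I_n + 'I_n)%type.

(** The increments of [W2] on the subdivision together with the one of [W1] on the
   whole interval. Times are written as multiples of a step to be the terms of an
   increasing sequence. *)
Definition increment (i : index) (w : T) : R :=
  match i with
  | inl jk => W2 (jk.1.+1%:R * h) w ord0 jk.2 - W2 (jk.1%:R * h) w ord0 jk.2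
  | inr k => W1 (1%:R * t) w ord0 k - W1 (0%:R * t) w ord0 k
  end.

Definition increment_var (i : index) : R :=
  match i with inl _ => h | inr _ => t end.

Definition increment_coor (i : index) : 'I_n :=
  match i with inl jk => jk.2 | inr k => k end.

Lemma measurable_increment i : measurable_fun [set: T] (increment i).
Proof.
have [mW1 _ _ _ _] := W1_brownian; have [mW2 _ _ _ _] := W2_brownian.
case: i => [jk|k] /=; apply: measurable_funB;
  apply: (measurableT_comp (measurable_coor _));
  by [apply: mW2; rewrite mulr_ge0// ltW|apply: mW1; rewrite mulr_ge0// ltW].
Qed.

Lemma increment_law i B : measurable B ->
  Pr (increment i @^-1` B) = normal_prob 0 (Num.sqrt (increment_var i)) B.
Proof.
move=> mB; have [_ _ _ lW1 _] := W1_brownian; have [_ _ _ lW2 _] := W2_brownian.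
case: i => [jk|k] /=.
  have -> : h = jk.1.+1%:R * h - jk.1%:R * h by rewrite -natr1; ring.
  apply: lW2 => //; first by rewrite mulr_ge0// ltW.
  by rewrite ltr_pM2r// ltr_nat.
have -> : Num.sqrt t = Num.sqrt (1%:R * t - 0%:R * t) by congr Num.sqrt; ring.
by apply: lW1 => //; rewrite ?mul0r// mul1r.
Qed.

Lemma increments_independent : mutually_independent Pr increment.
Proof.
move=> B mB.
have [_ _ _ _ iW1] := W1_brownian; have [_ _ _ _ iW2] := W2_brownian.
pose E1 := [set w | forall k : 'I_n,
  B (inr k) (W1 (1%:R * t) w ord0 k - W1 (0%:R * t) w ord0 k)].
pose E2 := [set w | forall jk : 'I_N.+1 * 'I_n,
  B (inl jk) (W2 (jk.1.+1%:R * h) w ord0 jk.2 - W2 (jk.1%:R * h) w ord0 jk.2)].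
have -> : [set w | forall i, B i (increment i w)] = E1 `&` E2.
  apply/seteqP; split=> [w H|w [H1 H2]] /=.
    by split=> k; [exact: (H (inr k))|exact: (H (inl k))].
  by case=> [jk|k]; [exact: H2|exact: H1].
have sE1 : process_sigma_algebra W1 E1.
  apply: (@increments_event _ _ _ _ W1 'I_n (fun=> 1%:R * t) (fun=> 0%:R * t) id
    (fun k => B (inr k))) => // k; rewrite mulr_ge0// ltW//.
have sE2 : process_sigma_algebra W2 E2.
  apply: (@increments_event _ _ _ _ W2 _ (fun jk : 'I_N.+1 * 'I_n => jk.1.+1%:R * h)
   (fun jk => jk.1%:R * h) snd (fun jk => B (inl jk))) => // k;
   rewrite mulr_ge0// ltW//.
rewrite (W1_W2_indep sE1 sE2) big_sumType/= muleC; congr (_ * _)%E.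
  have h_inc j : j%:R * h < j.+1%:R * h by rewrite ltr_pM2r// ltr_nat.
  have h_0 : 0 <= 0%:R * h by rewrite mul0r.
  exact: (iW2 N.+1 (fun j => j%:R * h) h_0 h_inc (fun jk => B (inl jk))
    (fun jk => mB (inl jk))).
have t_inc j : j%:R * t < j.+1%:R * t by rewrite ltr_pM2r// ltr_nat.
have t_0 : 0 <= 0%:R * t by rewrite mul0r.
have := iW1 1%N (fun j => j%:R * t) t_0 t_inc (fun jk => B (inr jk.2))
    (fun jk => mB (inr jk.2)).
rewrite -(pair_bigA _ (fun (i : 'I_1) (k : 'I_n) => Pr ((fun w =>
   W1 (i.+1%:R * t) w ord0 k - W1 (i%:R * t) w ord0 k) @^-1` B (inr k))))/=.
rewrite big_ord1 => <-; congr (Pr _); apply/seteqP; split=> w /= H.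
  by move=> [j k] /=; rewrite (ord1 j); exact: (H k).
by move=> k; exact: (H (ord0, k)).
Qed.

Definition drift_coef (i : index) : R :=
  match i with inl jk => s2 * h * (N.+1 - jk.1)%:R | inr _ => s1 end.

Definition velocity_coef (i : index) : R :=
  match i with inl _ => s2 | inr _ => 0 end.

Lemma sum_increment_coor (F : index -> R) k :
  \sum_(i | increment_coor i == k) F i = \sum_j F (inl (j, k)) + F (inr k).
Proof.
rewrite big_sumType/= big_pred1_eq; congr (_ + _).
transitivity (\sum_(j : 'I_N.+1) \sum_(l | l == k) F (inl (j, l))).
  rewrite (pair_big_dep predT (fun _ l => l == k) (fun j l => F (inl (j, l))))/=.
  by apply: eq_big => [[]|[]].
by apply: eq_bigr => j _; rewrite big_pred1_eq.
Qed.

Definition riemann_position (k : 'I_n) (w : T) : R :=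
  s2 * (h * \sum_(j < N.+1) (W2 (j.+1%:R * h) w ord0 k - W2 (0%:R * h) w ord0 k))
  + s1 * (W1 (1%:R * t) w ord0 k - W1 (0%:R * t) w ord0 k).

Definition velocity_noise (k : 'I_n) (w : T) : R :=
  s2 * (W2 (N.+1%:R * h) w ord0 k - W2 (0%:R * h) w ord0 k).

Lemma riemann_positionE k w : riemann_position k w =
  \sum_(i | increment_coor i == k) drift_coef i * increment i w.
Proof.
rewrite sum_increment_coor/= /riemann_position; congr (_ + _).
rewrite -(abel_sum (fun j => W2 (j%:R * h) w ord0 k)) mulrA mulr_sumr.
by apply: eq_bigr => j _; rewrite mulrA.
Qed.

Lemma velocity_noiseE k w : velocity_noise k w =
  \sum_(i | increment_coor i == k) velocity_coef i * increment i w.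
Proof.
rewrite sum_increment_coor/= mul0r addr0 /velocity_noise -mulr_sumr; congr (_ * _).
rewrite -(big_mkord xpredT (fun j => W2 (j.+1%:R * h) w ord0 k - W2 (j%:R * h) w ord0 k)).
by rewrite telescope_sumr.
Qed.

(** Here [e] is the inverse of the number of steps; the limit is at [e = 0]. *)
Definition riemann_varX (e : R) : R :=
  s2 ^+ 2 * (t ^+ 3 * ((1 + e) * (2 + e)) / 6) + s1 ^+ 2 * t.
Definition riemann_covXU (e : R) : R := s2 ^+ 2 * (t ^+ 2 * (1 + e) / 2).

Lemma expectation_riemann (e : R) (x u : 'I_n -> R) : 0 < e ->
  (\int[Pr]_w (\prod_k gauss2 e 0 e (x k - riemann_position k w)
      (u k - velocity_noise k w))%:E =
  (\prod_k gauss2 (e + riemann_varX N.+1%:R^-1) (riemann_covXU N.+1%:R^-1)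
     (e + varU s2 t) (x k) (u k))%:E)%E.
Proof.
move=> e0.
have tau0 i : 0 < increment_var i by case: i.
have e00 : (0 : R) ^+ 2 < e * e by rewrite expr0n/= mulr_gt0.
have := @expectation_gauss2_lin R n d T Pr index increment increment_coor drift_coef velocity_coef
  increment_var (fun=> e) (fun=> 0) (fun=> e) x u measurable_increment tau0
  increments_independent increment_law (fun=> e0) (fun=> e00).
under eq_integral do under eq_bigr do rewrite -riemann_positionE -velocity_noiseE.
move=> ->; congr EFin; apply: eq_bigr => k _.
have N0 : N.+1%:R != 0 :> R by [].
rewrite !sum_increment_coor/=; congr (gauss2 (_ + _) _ (_ + _) _ _).
- have E (j : 'I_N.+1) : (s2 * h * (N.+1 - j)%:R) ^+ 2 * h =
    (s2 ^+ 2 * h ^+ 3) * (N.+1 - j)%:R ^+ 2 by ring.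
  under eq_bigr do rewrite E.
  rewrite -mulr_sumr sum_nat_sqr /riemann_varX; congr (_ + _).
  by move: N0; rewrite /h; set M := N.+1%:R => N0; field.
- have E (j : 'I_N.+1) : s2 * h * (N.+1 - j)%:R * s2 * h =
    (s2 ^+ 2 * h ^+ 2) * (N.+1 - j)%:R by ring.
  under eq_bigr do rewrite E.
  rewrite -mulr_sumr sum_nat /riemann_covXU mulr0 mul0r addr0 add0r.
  by move: N0; rewrite /h; set M := N.+1%:R => N0; field.
- rewrite sumr_const card_ord expr0n/= mul0r addr0 -mulr_natr /varU /h.
  by move: N0; set M := N.+1%:R => N0; field.
Qed.

End subdivision.

Variables (y v : 'rV[R]_n) (X U : R -> T -> 'rV[R]_n).
Hypothesis XU : sde_solution Pr W1 W2 s1 s2 y v X U.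

(** The noise being additive, the integral equation gives the solution explicitly in
    terms of the paths. *)
Lemma riemann_position_cvg : {ae Pr, forall w, forall k,
  riemann_position N k w @[N --> \oo] --> X t w ord0 k - (y ord0 k + t * v ord0 k)}.
Proof.
have [_ z1 _ _ _] := W1_brownian; have [_ z2 c2 _ _] := W2_brownian.
have [_ _ sol] := XU.
apply: filterS3 z1 z2 _; last first.
  apply: filterI; [exact: c2|exact: sol].
move=> w w10 w20 [cont sl] k.
have f0 : W2 0 w ord0 k = 0 by rewrite w20 mxE.
have f1 : W1 0 w ord0 k = 0 by rewrite w10 mxE.
have [XE _] := sl t (ltW t0) k.
have UE s : 0 <= s -> U s w ord0 k = v ord0 k + s2 * W2 s w ord0 k.
  by move=> /sl/(_ k)[].
have ck : {within `[0, +oo[, continuous (fun s : R => W2 s w ord0 k)}.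
  apply/subspace_continuousP => s s0.
  move/subspace_continuousP : cont => /(_ s s0) H.
  have Ff : Filter (within `[0, +oo[%classic (nbhs s)) by exact: within_filter.
  exact: (@continuous_cvg _ _ _ _ Ff (fun s' => W2 s' w)
    (fun M : 'rV[R]_n => M ord0 k) (W2 s w) (@coord_continuous _ _ _ _ _ _) H).
have iW2 : lebesgue_measure.-integrable `[0, t] (EFin \o (fun s : R => W2 s w ord0 k)).
  apply: continuous_compact_integrable; first exact: segment_compact.
  by apply: continuous_subspaceW ck => s /=; rewrite !in_itv/= => /andP[-> _].
have IE : \int[lebesgue_measure]_(s in `[0, t]) U s w ord0 k =
    t * v ord0 k + s2 * \int[lebesgue_measure]_(s in `[0, t]) W2 s w ord0 k.
  transitivity (\int[lebesgue_measure]_(s in `[0, t]) (v ord0 k + s2 * W2 s w ord0 k)).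
    apply: eq_Rintegral => s; rewrite inE/= in_itv/= => /andP[s0 _]; exact: UE.
  rewrite RintegralD//; last 2 first.
  - apply: continuous_compact_integrable; first exact: segment_compact.
    exact: cst_continuous.
  - exact: integrableRZ.
  rewrite RintegralZl//; congr (_ + _).
  rewrite /Rintegral integral_cst//= lebesgue_measure_itv/= lte_fin t0.
  by rewrite -EFinB -EFinM/= subr0 mulrC.
have -> : X t w ord0 k - (y ord0 k + t * v ord0 k) =
  s2 * \int[lebesgue_measure]_(s in `[0, t]) W2 s w ord0 k + s1 * W1 t w ord0 k.
  by rewrite XE IE; ring.
have -> : (fun N => riemann_position N k w) =
  (fun N => s2 * (t / N.+1%:R * \sum_(j < N.+1) W2 (j.+1%:R * (t / N.+1%:R)) w ord0 k)
     + s1 * W1 t w ord0 k).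
  apply/funext => N; rewrite /riemann_position !mul0r f0 f1 mul1r subr0.
  by congr (_ * (_ * _) + _); apply: eq_bigr => j _; rewrite subr0.
by apply: cvgD; [apply: cvgMr; exact: (riemann_sum_cvg t0 ck)|exact: cvg_cst].
Qed.

Lemma velocity_noise_eq : {ae Pr, forall w, forall k N,
  velocity_noise N k w = U t w ord0 k - v ord0 k}.
Proof.
have [_ z2 c2 _ _] := W2_brownian.
have [_ _ sol] := XU.
apply: filterS2 z2 sol => w w20 sl k N.
have [_ ->] := sl t (ltW t0) k.
rewrite /velocity_noise mul0r w20 mxE subr0.
have -> : N.+1%:R * (t / N.+1%:R) = t by rewrite mulrC divfK.
by rewrite addrC addKr.
Qed.

(** The Gaussian smoothing of the law of the noise is the Gaussian density with
    the covariance of the integrated Brownian motion: both sides are limits of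
    the identity for the Riemann sums. *)
Lemma expectation_smoothing (s_neq0 : (s1, s2) != (0, 0)) (e : R) (x u : 'rV[R]_n) : 0 < e ->
  (\int[Pr]_w (gaussn e (x - (X t w - (y + t *: v))) * gaussn e (u - (U t w - v)))%:E =
   (\prod_k gauss2 (e + varX s1 s2 t) (covXU s2 t) (e + varU s2 t)
     (x ord0 k) (u ord0 k))%:E)%E.
Proof.
move=> e0.
pose c : R := (Num.sqrt (e * pi *+ 2))^-1.
have gc z : gauss e z <= c by exact: gauss_le_peak.
have c0 : 0 <= c by rewrite invr_ge0 sqrtr_ge0.
pose f N w := \prod_k gauss2 e 0 e (x ord0 k - riemann_position N k w)
      (u ord0 k - velocity_noise N k w).
pose g w := gaussn e (x - (X t w - (y + t *: v))) * gaussn e (u - (U t w - v)).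
have gE w : g w = \prod_k gauss2 e 0 e
    (x ord0 k - (X t w ord0 k - (y ord0 k + t * v ord0 k)))
    (u ord0 k - (U t w ord0 k - v ord0 k)).
  rewrite /g /gaussn -big_split/=; apply: eq_bigr => k _.
  by rewrite gauss2_diag !mxE.
have mf N : measurable_fun [set: T] (fun w => (f N w)%:E).
  have mlin (a : _ -> R) k : measurable_fun [set: T] (fun w : T =>
      \sum_(i | @increment_coor N i == k) a i * @increment N i w).
    rewrite (_ : (fun w : T => _) = fun w => \sum_i
      (if @increment_coor N i == k then a i * @increment N i w else 0)).
      apply: (@measurable_sum _ T R setT _ _ (fun i w =>
        if @increment_coor N i == k then a i * @increment N i w else 0)) => i.
      case: (increment_coor i == k); last exact: measurable_cst.
      by apply: measurable_funM => //; exact: measurable_increment.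
    by apply/funext => w; rewrite big_mkcond.
  apply/measurable_EFinP/measurable_prod => k _; apply: measurable_gauss2.
    apply: measurable_funB => //.
    rewrite (_ : riemann_position N k = fun w =>
      \sum_(i | @increment_coor N i == k) @drift_coef N i * @increment N i w)//.
    by apply/funext => w; exact: riemann_positionE.
  apply: measurable_funB => //.
  rewrite (_ : velocity_noise N k = fun w =>
    \sum_(i | @increment_coor N i == k) @velocity_coef N i * @increment N i w)//.
  by apply/funext => w; exact: velocity_noiseE.
have mg : measurable_fun [set: T] (fun w => (g w)%:E).
  have [mX mU _] := XU.
  apply/measurable_EFinP; rewrite (funext gE).
  apply: measurable_prod => k _; apply: measurable_gauss2;
    do 2 (apply: measurable_funB => //);
    apply: (measurableT_comp (measurable_coor k)).
    by apply: mX; exact: ltW.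
  by apply: mU; exact: ltW.
have fg : {ae Pr, forall w, setT w -> (f N w)%:E @[N --> \oo] --> (g w)%:E}.
  apply: filterS2 riemann_position_cvg velocity_noise_eq => w cX eU _.
  apply: cvg_EFin; first by near=> N.
  rewrite gE; apply: cvg_prodr => k; apply: cvg_gauss2 => //.
  - by rewrite expr0n/= mulr_gt0.
  - exact: cvg_cst.
  - exact: cvg_cst.
  - exact: cvg_cst.
  - by apply: cvgB; [exact: cvg_cst|exact: cX].
  - by under eq_fun do rewrite eU; exact: cvg_cst.
have fb : {ae Pr, forall w N, setT w -> (`|(f N w)%:E| <= (cst ((c * c) ^+ n)%:E) w)%E}.
  apply: aeW => w N _ /=; rewrite lee_fin ger0_norm; last first.
    by apply: prodr_ge0 => k _; exact: gauss2_ge0.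
  rewrite -[X in _ <= _ ^+ X]card_ord -prodr_const; apply: ler_prod => k _.
  by rewrite gauss2_ge0/= gauss2_diag ler_pM ?gauss_ge0.
have ic : Pr.-integrable [set: T] (cst ((c * c) ^+ n)%:E).
  exact: finite_measure_integrable_cst.
have [_ _ H] := dominated_convergence measurableT mf mg fg ic fb.
rewrite -/(g _); move: H.
rewrite (_ : (fun N => _) = (fun N => (\prod_k gauss2 (e + riemann_varX N.+1%:R^-1)
  (riemann_covXU N.+1%:R^-1) (e + varU s2 t) (x ord0 k) (u ord0 k))%:E)); last first.
  by apply/funext => N; rewrite -expectation_riemann.
move=> H; apply: (cvg_unique _ H); first exact: ereal_hausdorff.
apply: cvg_EFin; first by near=> N.
have Hh := @cvg_harmonic R.
have cX : riemann_varX N.+1%:R^-1 @[N --> \oo] --> varX s1 s2 t.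
  rewrite /riemann_varX (_ : varX s1 s2 t =
     s2 ^+ 2 * (t ^+ 3 * ((1 + 0) * (2 + 0)) / 6) + s1 ^+ 2 * t); last first.
    by rewrite /varX; field.
  apply: cvgD; last exact: cvg_cst.
  apply: cvgMr; apply: cvgMl; apply: cvgMr; apply: cvgM.
    by apply: cvgD; [exact: cvg_cst|exact: Hh].
  by apply: cvgD; [exact: cvg_cst|exact: Hh].
have cXU : riemann_covXU N.+1%:R^-1 @[N --> \oo] --> covXU s2 t.
  rewrite /riemann_covXU (_ : covXU s2 t = s2 ^+ 2 * (t ^+ 2 * (1 + 0) / 2)); last first.
    by rewrite /covXU; field.
  apply: cvgMr; apply: cvgMl; apply: cvgMr.
  by apply: cvgD; [exact: cvg_cst|exact: Hh].
have VX := varX_gt0 s_neq0 t0.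
have VU : 0 <= varU s2 t by rewrite /varU mulr_ge0 ?sqr_ge0// ltW.
apply: cvg_prodr => k; apply: cvg_gauss2 => //; last first.
- exact: cvg_cst.
- exact: cvg_cst.
- exact: cvg_cst.
- by apply: cvgD; [exact: cvg_cst|exact: cX].
- have [s20|s20] := eqVneq s2 0.
    rewrite /covXU /varU s20 !expr0n/= !mul0r expr0n/= addr0.
    by move: VX; rewrite s20 => VX; rewrite mulr_gt0// addr_gt0.
  apply: lt_trans (cov_lt s1 t0 s20) _.
  have VU' : 0 < varU s2 t by rewrite /varU mulr_gt0// exprn_even_gt0.
  rewrite -subr_gt0 (_ : _ - _ = e * (e + varU s2 t) + varX s1 s2 t * e); last by ring.
  by rewrite addr_gt0// mulr_gt0// addr_gt0.
- by rewrite addr_gt0.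
Unshelve. all: end_near. Qed.

End brownian_increments.

(** * Identification of the joint law *)

Section dominated_gaussian.
Context (R : realType) (n : nat).
Local Notation V := 'rV[R]_n.
Local Notation leb := (lebesgue_rV R n).
Variables (v : V -> V) (C0 : R).
Hypothesis vC : forall y k, `|v y ord0 k| <= C0.
Hypothesis C00 : 0 <= C0.
Local Notation resid := (resid v).

(** A vanishing smoothing parameter is added to the variance; the variances stay in
    a bounded range, for which there is a common envelope. *)
Lemma dominated_gaussn (h : nat -> V -> R) (h' : V -> R) C s t x : 0 < s ->
  (forall m, measurable_fun [set: V] (h m)) -> measurable_fun [set: V] h' ->
  (forall m y, `|h m y| <= C * gaussn (m.+1%:R^-1 + s) (resid t x y)) ->
  (forall y, h m y @[m --> \oo] --> h' y) ->
  (forall m, (\int[leb]_y `|(h m y)%:E| < +oo)%E) /\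
  (\int[leb]_y (h m y)%:E)%E @[m --> \oo] --> (\int[leb]_y (h' y)%:E)%E.
Proof.
move=> s0 mh mh' hC hh'.
pose B := `|x| + `|t| * C0.
have B0 : 0 <= B by rewrite addr_ge0// mulr_ge0.
have s1 : s <= 1 + s by rewrite lerDr.
have [K K0 HK] := gaussn_envelope n 0 s0 s1 B0.
have iG : leb.-integrable [set: V] (EFin \o (fun y => `|C| * K * gaussn (4 * (1 + s)) y)).
  by apply: integrable_gaussn_scaled; rewrite mulr_gt0// addr_gt0.
have hG m y : `|h m y| <= `|C| * K * gaussn (4 * (1 + s)) y.
  apply: le_trans (hC m y) _; apply: le_trans (_ : `|C| * gaussn (m.+1%:R^-1 + s) (resid t x y) <= _).
    by rewrite ler_wpM2r ?gaussn_ge0// ler_norm.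
  rewrite -mulrA ler_wpM2l// -[leLHS]mul1r -(expr0 (1 + sqn (x - t *: v y - y))) HK//.
    by rewrite lerDr invr_ge0 ler0n/= lerD2r invf_le1// ler1n.
  move=> k; rewrite !mxE (le_trans (ler_normB _ _))// lerD ?rV_norm_ge//.
  by rewrite normrM ler_wpM2l.
split.
  move=> m; apply: (@le_lt_trans _ _ (\int[leb]_y (`|C| * K * gaussn (4 * (1 + s)) y)%:E)%E).
    apply: ge0_le_integral => //.
    - by apply/measurable_EFinP/measurableT_comp.
    - by case/integrableP : iG.
    - by move=> y _; rewrite lee_fin; exact: hG.
  by rewrite RintegralE// ltry.
have mhE m : measurable_fun [set: V] (fun y => (h m y)%:E) by exact/measurable_EFinP.
have mhE' : measurable_fun [set: V] (fun y => (h' y)%:E) by exact/measurable_EFinP.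
have cv : {ae leb, forall y, setT y -> (h m y)%:E @[m --> \oo] --> (h' y)%:E}.
  by apply: aeW => y _; apply: cvg_EFin; [near=> m|exact: hh'].
have bd : {ae leb, forall y m, setT y ->
    (`|(h m y)%:E| <= (`|C| * K * gaussn (4 * (1 + s)) y)%:E)%E}.
  by apply: aeW => y m _; rewrite lee_fin.
by have [] := dominated_convergence measurableT mhE mhE' cv iG bd.
Unshelve. all: end_near. Qed.

End dominated_gaussian.

Section joint_law.
Context (R : realType) (n : nat) (d : measure_display) (T : measurableType d).
Local Notation V := 'rV[R]_n.
Local Notation leb := (lebesgue_rV R n).
Variables (Pr : probability T R) (W1 W2 : R -> T -> V).
Hypothesis W1_brownian : is_brownian Pr W1.
Hypothesis W2_brownian : is_brownian Pr W2.
Hypothesis W1_W2_indep : independent_processes Pr W1 W2.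
Variables (s1 s2 : R).
Hypothesis s_neq0 : (s1, s2) != (0, 0).
Variables (v : V -> V) (C0 : R).
Hypothesis mv : forall k, measurable_fun [set: V] (fun y => v y ord0 k).
Hypothesis vC : forall y k, `|v y ord0 k| <= C0.
Hypothesis C00 : 0 <= C0.
Variables (w : V -> R) (Cw : R).
Hypothesis mw : measurable_fun [set: V] w.
Hypothesis wC : forall y, `|w y| <= Cw.
Hypothesis w0 : forall y, 0 <= w y.
Variables X U : V -> R -> T -> V.
Hypothesis XU_sde : forall y, sde_solution Pr W1 W2 s1 s2 y (v y) (X y) (U y).
Variable t : R.
Hypothesis t0 : 0 < t.

Local Notation resid := (resid v).
Local Notation law := (joint_law Pr w X U).

Let mX y : measurable_fun [set: T] (X y t).
Proof. by have [+ _ _] := XU_sde y; apply; exact: ltW. Qed.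

Let mU y : measurable_fun [set: T] (U y t).
Proof. by have [_ + _] := XU_sde y; apply; exact: ltW. Qed.

Let mcoor m (F : T -> 'rV[R]_m) k : measurable_fun [set: T] F ->
  measurable_fun [set: T] (fun om => F om ord0 k).
Proof. by move=> mF; exact: (measurableT_comp (measurable_coor k) mF). Qed.

Let N (om : T) : V := X 0 t om - (0 + t *: v 0).
Let M (om : T) : V := U 0 t om - v 0.

Let flow (z : V * T) : V * V := ((z.1 + t *: v z.1) + N z.2, v z.1 + M z.2).

Let mflow : measurable_fun [set: V * T] flow.
Proof.
apply/measurable_fun_pairP; split; apply: measurable_fun_rV => k.
- under eq_fun do rewrite !mxE.
  apply: measurable_funD.
    apply: measurable_funD.
      exact: (measurableT_comp (measurable_coor k) measurable_fst).
    apply: measurable_funM => //.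
    exact: (measurableT_comp (mv k) measurable_fst).
  apply: measurable_funB => //.
  exact: (measurableT_comp (mcoor k (mX 0)) measurable_snd).
- under eq_fun do rewrite !mxE.
  apply: measurable_funD; first exact: (measurableT_comp (mv k) measurable_fst).
  apply: measurable_funB => //.
  exact: (measurableT_comp (mcoor k (mU 0)) measurable_snd).
Qed.

(** The noise being additive, all the solutions are translates of one of them. *)
Lemma solution_flow y : {ae Pr, forall om, (X y t om, U y t om) = flow (y, om)}.
Proof.
have cX z := riemann_position_cvg W1_brownian W2_brownian t0 (XU_sde z).
have eU z := velocity_noise_eq W2_brownian t0 (XU_sde z).
apply: filterS2 (filterI (cX y) (cX 0)) (filterI (eU y) (eU 0)) => om [cy c0] [uy u0].
rewrite /flow /N /M /=; congr pair; apply/rowP => k; rewrite !mxE.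
  have := cvg_unique (@Rhausdorff R) (cy k) (c0 k); rewrite !mxE => H.
  by apply/eqP; rewrite addrC -subr_eq H.
have := uy k 0%N; rewrite (u0 k 0%N) => ->; ring.
Qed.

Let mpair y : measurable_fun [set: T] (fun om => (X y t om, U y t om)).
Proof. by apply/measurable_fun_pairP; split; [exact: mX|exact: mU]. Qed.

Let mflow_y y : measurable_fun [set: T] (fun om => flow (y, om)).
Proof. exact: (measurableT_comp mflow (pair1_measurable y)). Qed.

Let mw1 : measurable_fun [set: V * T] (fun z => w z.1).
Proof. exact: (measurableT_comp mw measurable_fst). Qed.

Let w10 (z : V * T) : 0 <= w z.1. Proof. exact: w0. Qed.

(** The joint law is the image, by the flow of the starting point and the noise, of
    [w y dy] times the probability. *)
Lemma joint_law_measure : exists nu : {measure set (V * V) -> \bar R},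
  (forall A, measurable A -> nu A = law t A) /\
  forall f : V * V -> R, measurable_fun [set: V * V] f -> (forall z, 0 <= f z) ->
    (\int[nu]_z (f z)%:E =
     \int[leb]_y ((w y)%:E * \int[Pr]_om (f (X y t om, U y t om))%:E))%E.
Proof.
pose nu0 : {measure set (V * T) -> \bar R} := density_measure (leb \x Pr)%E mw1 w10.
pose nu : {measure set (V * V) -> \bar R} :=
  measure_function_pushforward__canonical__measure_function_Measure nu0 mflow.
have nuf (f : V * V -> R) : measurable_fun [set: V * V] f -> (forall z, 0 <= f z) ->
    (\int[nu]_z (f z)%:E =
     \int[leb]_y ((w y)%:E * \int[Pr]_om (f (X y t om, U y t om))%:E))%E.
  move=> mf f0.
  have mfl : measurable_fun [set: V * T] (fun z => f (flow z)).
    exact: (measurableT_comp mf mflow).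
  rewrite ge0_integral_pushforward//; last 2 first.
  - exact/measurable_EFinP.
  - by move=> z _; rewrite lee_fin.
  rewrite preimage_setT (@ge0_integral_density _ _ _ (leb \x Pr)%E _ (fun z => w z.1))//; last 2 first.
  - exact/measurable_EFinP.
  - by move=> z; rewrite lee_fin.
  rewrite fubini_tonelli1//; last 2 first.
  - by apply: emeasurable_funM; exact/measurable_EFinP.
  - by move=> z; rewrite -EFinM lee_fin mulr_ge0.
  apply: eq_integral => y _; rewrite /fubini_F/=.
  under eq_integral do rewrite muleC.
  have mfy : measurable_fun [set: T] (fun om => f (flow (y, om))).
    exact: (measurableT_comp mf (mflow_y y)).
  rewrite ge0_integralZl//; last 3 first.
  - exact/measurable_EFinP.
  - by move=> om _; rewrite lee_fin.
  - by rewrite lee_fin.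
  congr mule; apply: ge0_ae_eq_integral => //.
  - exact/measurable_EFinP.
  - by apply/measurable_EFinP/(measurableT_comp mf (mpair y)).
  - by move=> om _; rewrite lee_fin.
  - by move=> om _; rewrite lee_fin.
  by apply: filterS (solution_flow y) => om /= -> _.
exists nu; split => // A mA.
have -> : nu A = (\int[nu]_z (\1_A z)%:E)%E by rewrite integral_indic// setIT.
rewrite nuf//.
apply: eq_integral => y _; congr mule.
rewrite -[X in _ = Pr X]setIT -integral_indic//.
by rewrite -[X in measurable X]setTI; exact: mpair.
Qed.

Lemma smoothed_law (e : R) (x u y : V) : 0 < e ->
  (\int[Pr]_om (gaussn e (x - X y t om) * gaussn e (u - U y t om))%:E =
   (\prod_k gauss2 (e + varX s1 s2 t) (covXU s2 t) (e + varU s2 t)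
     (resid t x y ord0 k) (u ord0 k - v y ord0 k))%:E)%E.
Proof.
move=> e0.
have := expectation_smoothing W1_brownian W2_brownian W1_W2_indep t0 (XU_sde y)
  s_neq0 (resid t x y) (u - v y) e0.
under [X in X = _ -> _]eq_integral => om _.
  rewrite (_ : resid t x y - _ = x - X y t om); last first.
    by rewrite /resid; apply/rowP => k; rewrite !mxE; ring.
  rewrite (_ : u - v y - _ = u - U y t om); last first.
    by apply/rowP => k; rewrite !mxE; ring.
  over.
move=> ->; congr EFin; apply: eq_bigr => k _; by rewrite !mxE.
Qed.

Local Notation V0 := (varX s1 s2 t).
Local Notation B := (covXU s2 t).
Local Notation D := (varU s2 t).

(** A density of the joint law which is continuous is given everywhere by the
    Gaussian mixture: both have the same smoothings. *)
Lemma density_formula (P : R -> V -> V -> R) (x u : V) : 0 < s2 ->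
  is_density P law ->
  P t x u = tgauss v (fun y r => w y *
    gaussn (resvar s1 s2 t) (u - v y - slope s1 s2 t *: r)) V0 t x.
Proof.
move=> s20 /(_ t t0)[cP P0 lawP].
have s20' : s2 != 0 by rewrite gt_eqF.
have V00 : 0 < V0 := varX_gt0 s_neq0 t0.
have q0 : 0 < resvar s1 s2 t := resvar_gt0 s_neq0 t0 s20'.
have BVD := cov_lt s1 t0 s20'.
have D0 : 0 < D by rewrite /varU mulr_gt0// exprn_gt0.
have [nu [nuA nuf]] := joint_law_measure.
pose p (z : V * V) := P t z.1 z.2.
have mp : measurable_fun [set: V * V] p by exact: continuous_measurable_rV2.
pose k m (z : V * V) := gaussn m.+1%:R^-1 (x - z.1) * gaussn m.+1%:R^-1 (u - z.2).
have mk m : measurable_fun [set: V * V] (k m).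
  apply: measurable_funM.
    by apply: (@measurable_gaussn_shift _ _ _ _ _ x fst); exact: measurable_fst.
  by apply: (@measurable_gaussn_shift _ _ _ _ _ u snd); exact: measurable_snd.
pose h m y := w y * \prod_k gauss2 (m.+1%:R^-1 + V0) B (m.+1%:R^-1 + D)
     (resid t x y ord0 k) (u ord0 k - v y ord0 k).
pose h' y := w y * \prod_k gauss2 V0 B D (resid t x y ord0 k) (u ord0 k - v y ord0 k).
have kh m : (\int[leb \x leb]_z (k m z * p z)%:E = \int[leb]_y (h m y)%:E)%E.
  transitivity (\int[nu]_z (k m z)%:E)%E.
    rewrite [RHS](@ge0_integral_density _ _ _ (leb \x leb)%E _ p)//.
    - by move=> z; exact: P0.
    - by move=> A mA; rewrite nuA// lawP.
    - exact/measurable_EFinP.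
    - by move=> z; rewrite lee_fin mulr_ge0 ?gaussn_ge0.
  rewrite nuf//; last by move=> z; rewrite mulr_ge0 ?gaussn_ge0.
  by apply: eq_integral => y _; rewrite smoothed_law// -EFinM.
have mr k' : measurable_fun [set: V] (fun y => resid t x y ord0 k').
  exact: (measurableT_comp (measurable_coor k') (measurable_resid mv t x)).
have mg2 a b : measurable_fun [set: V] (fun y => \prod_k' gauss2 a B b
     (resid t x y ord0 k') (u ord0 k' - v y ord0 k')).
  by apply: measurable_prod => i _; apply: measurable_gauss2 => //; exact: measurable_funB.
have mh m : measurable_fun [set: V] (h m) by exact: measurable_funM.
have mh' : measurable_fun [set: V] h' by exact: measurable_funM.
pose C := Cw * (Num.sqrt (resvar s1 s2 t * pi *+ 2))^-1 ^+ n.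
have hC m y : `|h m y| <= C * gaussn (m.+1%:R^-1 + V0) (resid t x y).
  have e0 : (0 : R) < m.+1%:R^-1 by [].
  move: e0; set e := m.+1%:R^-1 => e0.
  rewrite normrM [X in _ * X <= _]ger0_norm; last first.
    by rewrite prodr_ge0// => i _; exact: gauss2_ge0.
  rewrite /C -mulrA ler_pM// ?prodr_ge0// => [i _|]; first exact: gauss2_ge0.
  rewrite -[X in _ ^+ X]card_ord -prodr_const /gaussn -big_split/=.
  apply: ler_prod => i _; rewrite gauss2_ge0/= /gauss2 mulrC ler_pM ?gauss_ge0//.
  have le_q : resvar s1 s2 t <= e + D - B ^+ 2 / (e + V0).
    rewrite /resvar lerB//; first by rewrite lerDr ltW.
    have le_V : V0 <= e + V0 by rewrite lerDr ltW.
    by rewrite ler_wpM2l ?sqr_ge0// lef_pV2 ?posrE// addr_gt0.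
  apply: le_trans (gauss_le_peak _ (lt_le_trans q0 le_q)) _.
  rewrite lef_pV2 ?posrE ?sqrtr_gt0 ?mulrn_wgt0 ?mulr_gt0 ?pi_gt0//.
    rewrite ler_sqrt ?mulrn_wge0 ?mulr_ge0 ?pi_ge0//; last by rewrite (le_trans (ltW q0)).
    by rewrite ler_wMn2r// ler_wpM2r ?pi_ge0.
  exact: lt_le_trans q0 _.
have Hh := @cvg_harmonic R.
have hh' y : h m y @[m --> \oo] --> h' y.
  apply: cvgMr; apply: cvg_prodr => i; apply: cvg_gauss2 => //.
  - by rewrite -[X in _ --> X]add0r; apply: cvgD; [exact: Hh|exact: cvg_cst].
  - exact: cvg_cst.
  - by rewrite -[X in _ --> X]add0r; apply: cvgD; [exact: Hh|exact: cvg_cst].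
  - exact: cvg_cst.
  - exact: cvg_cst.
have [hoo cvh] := dominated_gaussn vC C00 V00 mh mh' hC hh'.
have poo : (\int[leb \x leb]_z (gaussn 1 (x - z.1) * gaussn 1 (u - z.2) * p z)%:E < +oo)%E.
  have := kh 0%N; rewrite /k invr1 => ->.
  apply: le_lt_trans (hoo 0%N); apply: ge0_le_integral => //.
  - by move=> y _; rewrite lee_fin mulr_ge0// prodr_ge0// => i _; exact: gauss2_ge0.
  - exact/measurable_EFinP.
  - by apply/measurable_EFinP/measurableT_comp.
  - by move=> y _; rewrite lee_fin ler_norm.
have := approx_identity_rV2 cP (fun z => P0 z.1 z.2) poo.
under eq_fun do rewrite kh.
move=> /(cvg_unique (@ereal_hausdorff R))/(_ cvh)/(congr1 fine)/= ->.
apply: eq_Rintegral => y _; rewrite /h' -mulrA; congr (_ * _).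
rewrite mulrC /gaussn -big_split/=; apply: eq_bigr => i _.
by rewrite /gauss2 !mxE.
Qed.

(** Same argument in the position variable alone, the velocity being frozen. *)
Lemma density_measure_formula (P : R -> V -> {finite_measure set V -> \bar R})
    (x : V) (Y : set V) : s2 = 0 ->
  is_density_measure P law -> measurable Y ->
  fine (P t x Y) = tgauss v (fun y _ => w y * \1_Y (v y)) V0 t x.
Proof.
move=> s20 /(_ t t0)[cP lawP] mY.
have V00 : 0 < V0 := varX_gt0 s_neq0 t0.
have [nu [nuA nuf]] := joint_law_measure.
pose p z := fine (P t z Y).
have cp : continuous p by exact: cP.
have p0 z : 0 <= p z by exact: fine_ge0.
have mp : measurable_fun [set: V] p by exact: continuous_measurable_rV.
have mv' : measurable_fun [set: V] v by exact: measurable_fun_rV.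
have mI : measurable_fun [set: V] (\1_Y : V -> R) by exact: measurable_indic.
have mI2 : measurable_fun [set: V * V] (fun z : V * V => \1_Y z.2 : R).
  exact: (measurableT_comp mI measurable_snd).
have I20 (z : V * V) : 0 <= \1_Y z.2 :> R by [].
pose nuY : {measure set V -> \bar R} :=
  measure_function_pushforward__canonical__measure_function_Measure
    (density_measure nu mI2 I20) (@measurable_fst _ _ V V).
have nuYE A : measurable A -> (nuY A = \int[leb]_(z in A) (p z)%:E)%E.
  move=> mA; rewrite -[LHS]/(\int[nu]_(z in fst @^-1` A) (\1_Y z.2)%:E)%E.
  transitivity (nu (A `*` Y)).
    rewrite (_ : (fun z : V * V => _) = (fun z => (\1_([set: V] `*` Y) z)%:E)); last first.
      apply/funext => z; rewrite !indicE; congr (nat_of_bool _)%:R%:E.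
      by apply/idP/idP => /set_mem => [Yz|[_ Yz]]; exact: mem_set.
    rewrite integral_indic//; last 2 first.
    - by rewrite -[X in measurable X]setTI; exact: measurable_fst.
    - exact: measurableX.
    by congr (nu _); apply/seteqP; split=> [z [[_ ?] ?]|z [? ?]].
  rewrite nuA ?lawP//; last exact: measurableX.
  by apply: eq_integral => z _; rewrite /p fineK// fin_num_measure.
pose k m (z : V) := gaussn m.+1%:R^-1 (x - z).
have mk m : measurable_fun [set: V] (k m).
  exact: measurable_gaussn_shift.
pose h m y := w y * \1_Y (v y) * gaussn (m.+1%:R^-1 + V0) (resid t x y).
pose h' y := w y * \1_Y (v y) * gaussn V0 (resid t x y).
have U_frozen y : {ae Pr, forall om, U y t om = v y}.
  apply: filterS (velocity_noise_eq W2_brownian t0 (XU_sde y)) => om H.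
  apply/rowP => i; have := H i 0%N; rewrite /velocity_noise s20 mul0r => /esym/eqP.
  by rewrite subr_eq0 => /eqP.
have B0 : B = 0 by rewrite /covXU s20 expr0n/= !mul0r.
have D0 : D = 0 by rewrite /varU s20 expr0n/= !mul0r.
have mkX m y : measurable_fun [set: T] (fun om => gaussn m (x - X y t om)).
  exact: measurable_gaussn_shift.
(* The smoothing of the frozen velocity, taken at the velocity itself, contributes
   on both sides the same positive constant. *)
have EX e y : 0 < e -> (\int[Pr]_om (gaussn e (x - X y t om))%:E =
    (gaussn (e + V0) (resid t x y))%:E)%E.
  move=> e0; have := smoothed_law x (v y) y e0.
  rewrite B0 D0 addr0.
  have ge0 : 0 < gaussn e (0 : V) by exact: gaussn_gt0.
  rewrite (_ : \prod_i _ = gaussn e (0 : V) * gaussn (e + V0) (resid t x y)); last first.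
    rewrite mulrC /gaussn -big_split/=; apply: eq_bigr => i _.
    rewrite /gauss2 subrr expr0n/= !mul0r !subr0; congr (_ * gauss _ _).
    by rewrite mxE.
  have -> : (\int[Pr]_om (gaussn e (x - X y t om) * gaussn e (v y - U y t om))%:E =
      (gaussn e (0 : V))%:E * \int[Pr]_om (gaussn e (x - X y t om))%:E)%E.
    transitivity (\int[Pr]_om ((gaussn e (0 : V))%:E * (gaussn e (x - X y t om))%:E))%E; last first.
      rewrite ge0_integralZl//.
      - exact/measurable_EFinP.
      - by move=> om _; rewrite lee_fin gaussn_ge0.
      - by rewrite lee_fin ltW.
    apply: ge0_ae_eq_integral => //.
    - apply/measurable_EFinP/measurable_funM; first exact: mkX.
      exact: measurable_gaussn_shift.
    - by apply/measurable_EFinP/measurable_funM; first exact: measurable_cst.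
    - by move=> om _; rewrite lee_fin mulr_ge0 ?gaussn_ge0.
    - by move=> om _; rewrite -EFinM lee_fin mulr_ge0 ?gaussn_ge0.
    by apply: filterS (U_frozen y) => om /= -> _; rewrite subrr mulrC.
  move=> /(congr1 (fun z => (gaussn e (0 : V))^-1%:E * z)%E).
  by rewrite muleA -!EFinM mulrA mulVf ?gt_eqF// !mul1e mul1r.
have kh m : (\int[leb]_z (k m z * p z)%:E = \int[leb]_y (h m y)%:E)%E.
  transitivity (\int[nuY]_z (k m z)%:E)%E.
    rewrite [RHS](@ge0_integral_density _ _ _ leb _ p)//.
    - exact/measurable_EFinP.
    - by move=> z; rewrite lee_fin gaussn_ge0.
  rewrite ge0_integral_pushforward//; last 2 first.
  - exact/measurable_EFinP.
  - by move=> z _; rewrite lee_fin gaussn_ge0.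
  have mk1 : measurable_fun [set: V * V] (fun z => k m z.1).
    exact: (measurableT_comp (mk m) measurable_fst).
  rewrite preimage_setT (@ge0_integral_density _ _ _ nu _ (fun z => \1_Y z.2))//; last 2 first.
  - exact/measurable_EFinP.
  - by move=> z; rewrite lee_fin gaussn_ge0.
  rewrite (nuf (fun z => k m z.1 * \1_Y z.2)); last 2 first.
  - exact: measurable_funM.
  - by move=> z; rewrite mulr_ge0 ?gaussn_ge0.
  apply: eq_integral => y _.
  transitivity ((w y)%:E * ((\1_Y (v y))%:E * \int[Pr]_om (gaussn m.+1%:R^-1 (x - X y t om))%:E))%E.
    congr mule.
    transitivity (\int[Pr]_om ((\1_Y (v y) : R)%:E * (gaussn m.+1%:R^-1 (x - X y t om))%:E))%E; last first.
      rewrite ge0_integralZl//.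
      - exact/measurable_EFinP.
      - by move=> om _; rewrite lee_fin gaussn_ge0.
    apply: ge0_ae_eq_integral => //.
    - apply/measurable_EFinP/measurable_funM; first exact: mkX.
      exact: (measurableT_comp mI (mU y)).
    - by apply/measurable_EFinP/measurable_funM; first exact: measurable_cst.
    - by move=> om _; rewrite lee_fin mulr_ge0 ?gaussn_ge0.
    - by move=> om _; rewrite lee_fin mulr_ge0 ?gaussn_ge0.
    by apply: filterS (U_frozen y) => om /= -> _; rewrite mulrC.
  by rewrite EX// -!EFinM mulrA.
have mg e : measurable_fun [set: V] (fun y => gaussn e (resid t x y)).
  exact: (measurableT_comp (measurable_gaussn _) (measurable_resid mv t x)).
have mwI : measurable_fun [set: V] (fun y => w y * \1_Y (v y)).
  by apply: measurable_funM => //; exact: (measurableT_comp mI mv').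
have mh m : measurable_fun [set: V] (h m) by exact: measurable_funM.
have mh' : measurable_fun [set: V] h' by exact: measurable_funM.
have hC m y : `|h m y| <= Cw * gaussn (m.+1%:R^-1 + V0) (resid t x y).
  rewrite normrM (ger0_norm (gaussn_ge0 _ _)) ler_wpM2r ?gaussn_ge0//.
  by rewrite normrM -[leRHS]mulr1 ler_pM// ger0_norm// indicE lern1 leq_b1.
have hh' y : h m y @[m --> \oo] --> h' y.
  apply: cvgMr; apply: cvg_prodr => i; apply: cvg_gauss => //.
    by rewrite -[X in _ --> X]add0r; apply: cvgD; [exact: cvg_harmonic|exact: cvg_cst].
  exact: cvg_cst.
have [hoo cvh] := dominated_gaussn vC C00 V00 mh mh' hC hh'.
have poo : (\int[leb]_z (gaussn 1 (x - z) * p z)%:E < +oo)%E.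
  have := kh 0%N; rewrite /k invr1 => ->.
  apply: le_lt_trans (hoo 0%N); apply: ge0_le_integral => //.
  - by move=> y _; rewrite lee_fin mulr_ge0 ?gaussn_ge0// mulr_ge0.
  - exact/measurable_EFinP.
  - by apply/measurable_EFinP/measurableT_comp.
  - by move=> y _; rewrite lee_fin ler_norm.
have := approx_identity_rV cp p0 poo.
under eq_fun do rewrite kh.
by move=> /(cvg_unique (@ereal_hausdorff R))/(_ cvh)/(congr1 fine)/=; rewrite -/(p x) => ->.
Qed.

End joint_law.

(** * The system for the density and the velocity *)

Lemma bounded_funP (T : Type) (R : realType) (V : normedModType R) (f : T -> V) :
  bounded_fun f -> exists2 C, 0 <= C & forall x, `|f x| <= C.
Proof.
move=> [C [_ HC]]; exists (`|C| + 1) => [|x]; first by rewrite addr_ge0.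
by apply: (HC (`|C| + 1)) => //; rewrite (le_lt_trans (ler_norm C))// ltrDl.
Qed.

Theorem theorem2p3 (R : realType) (n : nat) (d : measure_display)
    (T : measurableType d) (Pr : probability T R)
    (W1 W2 : R -> T -> 'rV[R]_n)
    (u0 : 'rV[R]_n -> 'rV[R]_n) (rho0 : 'rV[R]_n -> R) (s1 s2 : R)
    (X U : 'rV[R]_n -> R -> T -> 'rV[R]_n)
    (n_gt0 : (0 < n)%N)
    (u0_C1 : C1_vec u0) (u0_Cb : Cb_vec u0)
    (rho0_L1_loc : L1_loc rho0) (rho0_bounded : bounded_fun rho0)
    (rho0_ge0 : forall x, 0 <= rho0 x)
    (s1_ge0 : 0 <= s1) (s2_ge0 : 0 <= s2) (s_neq0 : (s1, s2) != (0, 0))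
    (W1_brownian : is_brownian Pr W1) (W2_brownian : is_brownian Pr W2)
    (W1_W2_indep : independent_processes Pr W1 W2)
    (XU_sde : forall y, sde_solution Pr W1 W2 s1 s2 y (u0 y) (X y) (U y)) :
  (0 < s2 -> forall P : R -> 'rV[R]_n -> 'rV[R]_n -> R,
     is_density P (joint_law Pr rho0 X U) ->
     moments_exist_dens P /\
     gas_system s1 (rho_dens P) (u_dens P) (I_dens P)) /\
  (s2 = 0 -> forall P : R -> 'rV[R]_n -> {finite_measure set 'rV[R]_n -> \bar R},
     is_density_measure P (joint_law Pr rho0 X U) ->
     exists dP : R -> 'rV[R]_n -> 'I_n -> {charge set 'rV[R]_n -> \bar R},
       [/\ is_x_gradient P dP, moments_exist_meas P dP
         & gas_system s1 (rho_meas P) (u_meas P) (I_meas P dP)]).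
Proof.
have [cu0 /bounded_funP[C0 C00 u0C]] := u0_Cb.
have [mrho _] := rho0_L1_loc.
have [Cw _ rhoC] := bounded_funP rho0_bounded.
have mu0 k : measurable_fun [set: 'rV[R]_n] (fun y => u0 y ord0 k).
  apply: continuous_measurable_rV => y.
  by apply: (@continuous_comp _ _ _ u0 (fun M : 'rV[R]_n => M ord0 k));
    [exact: cu0|exact: coord_continuous].
have u0C' y k : `|u0 y ord0 k| <= C0 by rewrite (le_trans (rV_norm_ge _ _)).
split=> [s20 P denP|s20 P denP].
  apply: (gas_system_of_density mu0 u0C' C00 mrho rhoC rho0_ge0 s_neq0).
    by rewrite gt_eqF.
  move=> t x u t0.
  exact: (density_formula W1_brownian W2_brownian W1_W2_indep s_neq0 mu0 u0C' C00
    mrho rhoC rho0_ge0 XU_sde t0 x u s20 denP).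
have PE t x Y : 0 < t -> measurable Y -> fine (P t x Y) =
    tgauss u0 (fun y _ => rho0 y * \1_Y (u0 y)) (varX s1 s2 t) t x.
  move=> t0 mY.
  exact: (density_measure_formula W1_brownian W2_brownian W1_W2_indep s_neq0 mu0 u0C' C00
    mrho rhoC rho0_ge0 XU_sde t0 x s20 denP mY).
move: s_neq0 PE; rewrite s20 => s10 PE.
exists (grad_measure mu0 u0C' C00 mrho rhoC s10).
exact: (gas_system_of_measure mu0 u0C' C00 mrho rhoC rho0_ge0 s10 PE).
Qed.
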